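(* Let $M$ be a von Neumann algebra with a normal, tracial state $\varphi$, and let $a_1,\ldots,a_n$ be self-adjoint elements of $M$. Let $\{h_1,\ldots,h_n\}$ be a set of self-adjoint elements of $M$ which is freely independent with respect to $\{a_1,\ldots,a_n\}$ (under $\varphi$) and satisfies $\underline{\chi}(h_1,\ldots,h_n) > -\infty$. Then \[ n + \limsup_{\epsilon \to 0} \frac{\chi(a_1+\epsilon h_1,\ldots,a_n+\epsilon h_n : h_1,\ldots,h_n)}{|\log \epsilon|} = \limsup_{\epsilon \to 0} \frac{\mathbb K_{\epsilon}(a_1,\ldots,a_n)}{|\log \epsilon|} = \limsup_{\epsilon \to 0} \frac{\mathbb P_{\epsilon}(a_1,\ldots,a_n)}{|\log \epsilon|}. \]
   Context: Limits $\epsilon\to 0$ are over $\epsilon>0$, and $\log 0=-\infty$ (so all quantities below take values in $[-\infty,\infty]$). Matrix notation. $M_k^{sa}(\mathbb C)$ is the set of $k\times k$ self-adjoint complex matrices, $(M_k^{sa}(\mathbb C))^n$ the real vector space of $n$-tuples of such matrices, and $tr_k$ the normalized trace on $k\times k$ complex matrices. On $(M_k^{sa}(\mathbb C))^n$ let $\|(x_1,\ldots,x_n)\|_2^2=\sum_{i=1}^n k\cdot tr_k(x_i^2)$, let $\mathrm{vol}$ be Lebesgue measure with respect to the inner product norm $\|\cdot\|_2$, and let $\rho_k$ be the metric induced by the norm $k^{-1/2}\|\cdot\|_2$. Microstates. For self-adjoint $c_1,\ldots,c_q\in M$, $m,k\in\mathbb N$, $R,\gamma>0$, $\Gamma_R(c_1,\ldots,c_q;m,k,\gamma)$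 is the set of $(x_1,\ldots,x_q)\in(M_k^{sa}(\mathbb C))^q$ with operator norms $\|x_i\|\le R$ for all $i$ and \[|tr_k(x_{i_1}\cdots x_{i_p})-\varphi(c_{i_1}\cdots c_{i_p})|<\gamma\] for all $1\le p\le m$ and $1\le i_1,\ldots,i_p\le q$. For self-adjoint $c_1,\ldots,c_n,b_1,\ldots,b_p\in M$, $\Gamma_R(c_1,\ldots,c_n:b_1,\ldots,b_p;m,k,\gamma)$ is the image of $\Gamma_R(c_1,\ldots,c_n,b_1,\ldots,b_p;m,k,\gamma)$ under the projection onto the first $n$ coordinates. Free entropy (Voiculescu). Define \[\chi_R(c_1,\ldots,c_n:b_1,\ldots,b_p;m,\gamma)=\limsup_{k\to\infty}\left(k^{-2}\log \mathrm{vol}(\Gamma_R(c_1,\ldots,c_n:b_1,\ldots,b_p;m,k,\gamma))+\tfrac n2\log k\right),\] \[\chi_R(c_1,\ldots,c_n:b_1,\ldots,b_p)=\inf_{m\in\mathbb N,\gamma>0}\chi_R(c_1,\ldots,c_n:b_1,\ldots,b_p;m,\gamma),\] \[\chi(c_1,\ldots,c_n:b_1,\ldots,b_p)=\sup_{R>0}\chi_R(c_1,\ldots,c_n:b_1,\ldots,b_p).\] The free entropy $\chi(c_1,\ldots,c_n)$ is defined in the same way with $\Gamma_R(c_1,\ldots,c_n;m,k,\gamma)$ (no $b$'s), and $\underline{\chi}(c_1,\ldots,c_n)$ is the quantity obtained by replacing $\limsup_{k\to\infty}$ by $\liminf_{k\to\infty}$ in the definition of $\chi(c_1,\ldots,c_n)$.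 Packing and covering numbers. For a metric space $(X,d)$ and $\epsilon>0$, $P_\epsilon(X,d)$ is the maximum number of elements in a collection of mutually disjoint open $\epsilon$-balls of $X$, and $K_\epsilon(X,d)$ is the minimum number of open $\epsilon$-balls of $X$ required to cover $X$ (both are $0$ if $X=\emptyset$). Define successively \[\mathbb P_{\epsilon,R}(a_1,\ldots,a_n;m,k,\gamma)=P_\epsilon(\Gamma_R(a_1,\ldots,a_n;m,k,\gamma),\rho_k),\] \[\mathbb P_{\epsilon,R}(a_1,\ldots,a_n;m,\gamma)=\limsup_{k\to\infty}k^{-2}\log \mathbb P_{\epsilon,R}(a_1,\ldots,a_n;m,k,\gamma),\] \[\mathbb P_{\epsilon,R}(a_1,\ldots,a_n)=\inf\{\mathbb P_{\epsilon,R}(a_1,\ldots,a_n;m,\gamma):m\in\mathbb N,\gamma>0\},\] \[\mathbb P_\epsilon(a_1,\ldots,a_n)=\sup_{R>0}\mathbb P_{\epsilon,R}(a_1,\ldots,a_n).\] $\mathbb K_\epsilon(a_1,\ldots,a_n)$ is defined in the same way, replacing $P_\epsilon$ by $K_\epsilon$ in the first line. *)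

(* Defs.v *)
From HB Require Import structures.
From mathcomp Require Import all_boot all_order all_algebra.
From mathcomp.real_closed Require Import complex.
From mathcomp Require Import all_classical all_reals all_analysis.

Set Implicit Arguments.
Unset Strict Implicit.
Unset Printing Implicit Defensive.

Import Order.TTheory GRing.Theory Num.Theory.
Import numFieldNormedType.Exports.

Local Open Scope classical_set_scope.
Local Open Scope ring_scope.

(** A complex Hilbert space is a complete normed module [H] over [R[i]] with
    an inner product [ip], linear in its first argument, inducing the norm.
    Operators are plain functions [H -> H] with the pointwise linear structure
    of function spaces; their product is composition. *)
Section Operators.
Context {R : realType} {H : completeNormedModType R[i]}.
Variable ip : {dot H for Num.conj}.
Implicit Types (S T : H -> H) (M D : set (H -> H)) (phi : (H -> H) -> R[i]).

Definition induces_norm := forall v : H, ip v v = `|v| ^+ 2.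

Definition bounded_op T := linear T /\ continuous T.

Definition adjoint_of T S := forall u v, ip (T u) v = ip u (S v).

Definition self_adjoint T := adjoint_of T T.

(* The order of [R[i]] is partial: [0 <= z] says that [z] is a nonnegative
   real. *)
Definition positive_op T := forall v, 0 <= ip (T v) v.

Definition op_le S T := positive_op (T - S).

Definition commutant M : set (H -> H) :=
  [set T | bounded_op T /\ forall S, M S -> T \o S = S \o T].

(* A commutant is a unital algebra of bounded operators, so the second clause
   makes [M] one. *)
Definition von_neumann_algebra M :=
  (forall S T, M T -> bounded_op S -> adjoint_of T S -> M S) /\
  commutant (commutant M) = M.

(* [T] is the least upper bound of [D] among the self-adjoint elements
   of [M]. *)
Definition op_supremum M D T :=
  [/\ M T, self_adjoint T, (forall S, D S -> op_le S T) &
      forall T', M T' -> self_adjoint T' -> (forall S, D S -> op_le S T') ->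
        op_le T T'].

Definition normal_functional M phi := forall D T,
  D !=set0 ->
  (forall S, D S -> M S /\ self_adjoint S) ->
  (forall S1 S2, D S1 -> D S2 -> exists S, [/\ D S, op_le S1 S & op_le S2 S]) ->
  op_supremum M D T -> supremums [set phi S | S in D] (phi T).

(* The values of [phi] outside [M] are irrelevant. *)
Record normal_tracial_state M phi : Prop := NormalTracialState {
  nts_linear : forall c S T, M S -> M T ->
    phi (c *: S + T) = c * phi S + phi T;
  nts_positive : forall T, M T -> positive_op T -> 0 <= phi T;
  nts_unit : phi idfun = 1;
  nts_tracial : forall S T, M S -> M T -> phi (S \o T) = phi (T \o S);
  nts_normal : normal_functional M phi }.

Definition op_comp S T := S \o T.

End Operators.

Section Freeness.
Context {R : realType} {H : completeNormedModType R[i]}.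
Implicit Types (S T : H -> H) (A B : set (H -> H)) (phi : (H -> H) -> R[i]).

Inductive unital_algebra A : set (H -> H) :=
| ua_gen T : A T -> unital_algebra A T
| ua_unit : unital_algebra A idfun
| ua_linear c S T : unital_algebra A S -> unital_algebra A T ->
    unital_algebra A (c *: S + T)
| ua_comp S T : unital_algebra A S -> unital_algebra A T ->
    unital_algebra A (S \o T).

(* Freeness of the two sets [A] and [B], for sets of self-adjoint operators
   (so that the generated unital algebras are *-algebras); nothing is
   asked of the elements of [A] among themselves. The boolean [b] selects the
   algebra of the first letter of the alternating word. *)
Definition free_sets phi A B := forall (p : nat) (x : nat -> H -> H) (b : bool),
  (0 < p)%N ->
  (forall i, (i < p)%N -> unital_algebra (if odd i (+) b then A else B) (x i)) ->
  (forall i, (i < p)%N -> phi (x i) = 0) ->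
  phi (\big[op_comp/idfun]_(0 <= i < p) x i) = 0.

End Freeness.

Section Matrices.
Context {R : realType}.
Local Notation C := R[i].

Definition mxtuple n k := 'I_n -> 'M[C]_k.

Definition normalized_trace k (x : 'M[C]_k) : C := \tr x / k%:R.

Definition l2norm k (v : 'cV[C]_k) : R :=
  Num.sqrt (\sum_i complex.Re (`|v i 0| ^+ 2)).

Definition operator_norm k (x : 'M[C]_k) : R :=
  sup [set l2norm (x *m v) | v in [set v : 'cV[C]_k | l2norm v <= 1]].

Definition norm2 n k (x : mxtuple n k) : R :=
  Num.sqrt (\sum_i complex.Re (k%:R * normalized_trace (x i *m x i))).

Definition rho n k (x y : mxtuple n k) : R :=
  norm2 (fun i => x i - y i) / Num.sqrt k%:R.

Definition word_mx q k (x : mxtuple q k) (w : seq 'I_q) : 'M[C]_k :=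
  \big[mulmx/1%:M]_(i <- w) x i.

(* Lebesgue outer measure on the real functions on a finite set. On Borel
   sets it is the Lebesgue measure, and microstate sets and their projections
   are Borel (the latter are countable unions of compact sets). The covering
   family is indexed by a set [J] of naturals, possibly finite, because when
   [I] is empty every box has volume 1. *)
Definition lebesgue_outer (I : finType) (A : set (I -> R)) : \bar R :=
  ereal_inf [set v : \bar R |
    exists (J : set nat) (a b : nat -> I -> R),
    [/\ forall j i, a j i <= b j i,
        A `<=` \bigcup_(j in J) [set x | forall i, a j i <= x i <= b j i] &
        v = (\esum_(j in J) (\prod_i (b j i - a j i))%:E)%E]].

(* Orthonormal coordinates for [norm2] on tuples of self-adjoint matrices:
   see [norm2_sa_coord] and [sa_coord_onto]. *)
Definition sa_coord n k (u : 'I_n * 'I_k * 'I_k -> R) : mxtuple n k :=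
  fun i => \matrix_(j, l)
    (if j == l then (u (i, j, j) +i* 0)%C
     else if (j < l)%N
     then ((u (i, j, l) / Num.sqrt 2) +i* (u (i, l, j) / Num.sqrt 2))%C
     else ((u (i, l, j) / Num.sqrt 2) -i* (u (i, j, l) / Num.sqrt 2))%C).

Definition vol n k (A : set (mxtuple n k)) : \bar R :=
  lebesgue_outer [set u | A (sa_coord u)].

Lemma sa_coord_herm n k (u : 'I_n * 'I_k * 'I_k -> R) i :
  sa_coord u i \is hermsymmx.
Proof.
apply/is_hermitianmxP; rewrite expr0 scale1r; apply/matrixP => j l.
have cE (z : C) : Num.conj z = conjc z by [].
rewrite !mxE cE (eq_sym l j); case: eqVneq => [->|jl] /=.
  by rewrite oppr0.
case: ltngtP => //= [_|e]; first by rewrite opprK.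
by case/eqP: jl; apply: val_inj.
Qed.

Lemma norm2_sa_coord n k (u : 'I_n * 'I_k * 'I_k -> R) : (0 < k)%N ->
  norm2 (sa_coord u) ^+ 2 = \sum_i u i ^+ 2.
Proof.
move=> k0; have kn0 : (k%:R : C) != 0 by rewrite pnatr_eq0 -lt0n.
have ReD : {morph (@complex.Re R) : y z / y + z} by move=> [? ?] [? ?].
have tE i : complex.Re (k%:R * normalized_trace (sa_coord u i *m sa_coord u i))
    = \sum_j \sum_l u (i, j, l) ^+ 2.
  rewrite /normalized_trace mulrCA divff // mulr1 /mxtrace.
  rewrite (big_morph _ ReD (erefl _)).
  transitivity (\sum_j \sum_l (u (i, j, l) ^+ 2 / 2 + u (i, l, j) ^+ 2 / 2)).
    apply: eq_bigr => j _; rewrite mxE (big_morph _ ReD (erefl _)).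
    apply: eq_bigr => l _; rewrite !mxE (eq_sym l j).
    have s2 : (Num.sqrt 2 : R)^-1 ^+ 2 = 2^-1 by rewrite exprVn sqr_sqrtr.
    case: eqVneq => [->|jl] /=.
      by rewrite mulr0 subr0 -expr2 -splitr.
    case: ltngtP => /= [_|_|/val_inj/eqP]; last by rewrite (negbTE jl).
      by rewrite mulrN opprK -!expr2 !exprMn !s2.
    by rewrite mulNr opprK -!expr2 !exprMn !s2 addrC.
  transitivity (\sum_j \sum_l u (i, j, l) ^+ 2 / 2 +
                \sum_j \sum_l u (i, l, j) ^+ 2 / 2).
    by rewrite -big_split; apply: eq_bigr => j _; rewrite big_split.
  rewrite [X in _ + X]exchange_big -big_split; apply: eq_bigr => j _.
  by rewrite -big_split; apply: eq_bigr => l _ /=; rewrite -splitr.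
rewrite /norm2 sqr_sqrtr; last first.
  apply: sumr_ge0 => i _; rewrite tE; apply: sumr_ge0 => j _.
  by apply: sumr_ge0 => l _; exact: sqr_ge0.
under eq_bigr do rewrite tE.
rewrite pair_big pair_big /=.
by apply: eq_bigr => -[[i j] l].
Qed.

Lemma sa_coord_onto n k (x : mxtuple n k) :
  (forall i, x i \is hermsymmx) -> exists u, sa_coord u = x.
Proof.
move=> hx.
exists (fun ijl => let: (i, j, l) := ijl in
  if j == l then complex.Re (x i j j)
  else if (j < l)%N then complex.Re (x i j l) * Num.sqrt 2
  else complex.Im (x i l j) * Num.sqrt 2).
apply/funext => i; apply/matrixP => j l; rewrite mxE.
have xE a b : x i a b = conjc (x i b a).
  have /is_hermitianmxP := hx i; rewrite expr0 scale1r => /matrixP/(_ a b).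
  by rewrite !mxE.
have s2 : (Num.sqrt 2 : R) != 0 by rewrite sqrtr_eq0 -ltNge.
rewrite eqxx (eq_sym l j); case: eqVneq => [->|jl].
  have := xE l l; case: (x i l l) => c d /= [] /eqP.
  by rewrite -subr_eq0 opprK -mulr2n mulrn_eq0 /= => /eqP ->.
case: ltngtP => /= [_|_|/val_inj/eqP]; last by rewrite (negbTE jl).
  by rewrite !mulfK //; case: (x i j l).
by rewrite !mulfK // [RHS]xE; case: (x i l j).
Qed.

End Matrices.

Section Microstates.
Context {R : realType} {H : completeNormedModType R[i]}.
Variable phi : (H -> H) -> R[i].

Definition word_op q (c : 'I_q -> H -> H) (w : seq 'I_q) : H -> H :=
  \big[op_comp/idfun]_(i <- w) c i.

Definition Gamma q (c : 'I_q -> H -> H) (r : R) (m k : nat) (gamma : R) :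
    set (mxtuple q k) :=
  [set x | [/\ forall i, x i \is hermsymmx,
               forall i, operator_norm (x i) <= r &
               forall w : seq 'I_q, (1 <= size w <= m)%N ->
                 `|normalized_trace (word_mx x w) - phi (word_op c w)|
                   < (gamma%:C)%C ]].

Arguments Gamma {q} c r m k gamma.

Definition concat T n p (c : 'I_n -> T) (b : 'I_p -> T) (i : 'I_(n + p)) : T :=
  match fintype.split i with inl j => c j | inr j => b j end.

Definition Gamma_rel n p (c : 'I_n -> H -> H) (b : 'I_p -> H -> H)
    (r : R) (m k : nat) (gamma : R) : set (mxtuple n k) :=
  [set (fun i => x (lshift p i)) | x in Gamma (concat c b) r m k gamma].

Arguments Gamma_rel {n p} c b r m k gamma.

Definition sup_inf (f : R -> nat -> R -> \bar R) : \bar R :=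
  ereal_sup [set
    ereal_inf [set f r m gamma | m in [set: nat] & gamma in [set g : R | 0 < g]]
    | r in [set r : R | 0 < r]].

Definition log_vol n k (A : set (mxtuple (R := R) n k)) : \bar R :=
  (((k%:R ^+ 2)^-1)%:E * lne (vol A) + (n%:R / 2 * ln k%:R)%:E)%E.

Definition chi_rel n p (c : 'I_n -> H -> H) (b : 'I_p -> H -> H) : \bar R :=
  sup_inf (fun r m gamma =>
    limn_esup (fun k => log_vol (Gamma_rel c b r m k gamma))).

Definition chi n (c : 'I_n -> H -> H) : \bar R :=
  sup_inf (fun r m gamma =>
    limn_esup (fun k => log_vol (Gamma c r m k gamma))).

Definition chi_inf n (c : 'I_n -> H -> H) : \bar R :=
  sup_inf (fun r m gamma =>
    limn_einf (fun k => log_vol (Gamma c r m k gamma))).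

Definition ball_in (T : Type) (X : set T) (d : T -> T -> R) (e : R) (x : T) :=
  [set y | X y /\ d x y < e].

(* Balls are nonempty, so pairwise disjoint ones are distinct. *)
Definition packing_number (T : Type) (X : set T) (d : T -> T -> R) (e : R) :
    \bar R :=
  ereal_sup [set (N%:R)%:E | N in [set N : nat |
    exists x : 'I_N -> T, (forall i, X (x i)) /\
      forall i j, i != j -> ball_in X d e (x i) `&` ball_in X d e (x j) = set0]].

Definition covering_number (T : Type) (X : set T) (d : T -> T -> R) (e : R) :
    \bar R :=
  ereal_inf [set (N%:R)%:E | N in [set N : nat |
    exists x : 'I_N -> T, (forall i, X (x i)) /\
      X `<=` \bigcup_i ball_in X d e (x i)]].

Definition free_packing n (a : 'I_n -> H -> H) (e : R) : \bar R :=
  sup_inf (fun r m gamma => limn_esup (fun k =>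
    (((k%:R ^+ 2)^-1)%:E *
      lne (packing_number (Gamma a r m k gamma) (@rho R n k) e))%E)).

Definition free_covering n (a : 'I_n -> H -> H) (e : R) : \bar R :=
  sup_inf (fun r m gamma => limn_esup (fun k =>
    (((k%:R ^+ 2)^-1)%:E *
      lne (covering_number (Gamma a r m k gamma) (@rho R n k) e))%E)).

End Microstates.

Definition limsup_log_ratio {R : realType} (f : R -> \bar R) : \bar R :=
  limf_esup (fun e => (f e * (`|ln e|^-1)%:E)%E) ((0 : R)^'+).

(* Main.v *)
(** The entropy of [a + t h] relative to [h] is compared with the covering and
    packing numbers of the microstates of [a] at scale comparable to [t]; a
    factor [e ^ (C k ^ 2)] in volumes is harmless if [C] does not depend on
    [t], since it disappears after division by [`|ln t|].

    Upper bound: if [(z, y)] is a microstate of [(a + t h, h)], then [z - t y]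
    is one of [a], so [z] lies in one of the balls of radius about [t] around
    the centers of a [t]-covering of the microstates of [a].

    Lower bound: for a microstate [x] of [a], most microstates [y] of [h] are
    nearly free from [x] up to a unitary conjugation taken from a list of
    polynomial length in [k], and then [x + t y] is a microstate of
    [a + t h]. For packed points [x] these sets of sums are disjoint, and each
    of them has volume about [t ^ (n k ^ 2)] times that of the microstates of
    [h].

    The conjugations are found without Haar measure. For finitely many
    polynomial functions on the unitary group some finite list of unitaries is
    nearly invariant under all translations: nearly minimise the norm of the average
    of a feature map into a Hilbert space on which the translations act
    isometrically. Averages over such a list of derivatives along the unitary
    group therefore nearly vanish, which bounds by [C / k ^ 2] the mean square
    of the defect in the loop equation
    [\sum_i (tau (w_0 .. w_i) tau (w_(i+1) .. w_l)
             - tau (w_0 .. w_(i-1)) tau (w_i .. w_l)) = 0]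
    (the sum being over the letters [w_i] of the word [w] in [y]), so one
    unitary serves half of any finite set of [y]. Together with the moments of
    [x] and of [y] alone, the loop equation determines all joint moments, and
    freeness implies it for the operators. *)
Require Import Defs.
From HB Require Import structures.
From mathcomp Require Import all_boot all_order all_algebra.
From mathcomp.real_closed Require Import complex.
From mathcomp Require Import all_classical all_reals all_analysis.
From mathcomp Require Import ring lra zify.

Set Implicit Arguments.
Unset Strict Implicit.
Unset Printing Implicit Defensive.

Import Order.TTheory GRing.Theory Num.Theory.
Import numFieldNormedType.Exports.

Local Open Scope classical_set_scope.
Local Open Scope ring_scope.

(** * Lebesgue outer measure *)

Section OuterMeasure.
Context {R : realType} (I : finType).
Implicit Types (A B : set (I -> R)).
Local Notation lo := (@lebesgue_outer R I).

(** Volumes are treated as outer measures and compared on small cubes, in place of a change of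
    variables. A linear isometry then costs a factor [8 ^ (n * k ^ 2)], which is of the harmless
    kind.

    The rate [C / k ^ 2] arises by differentiating an entry [(a, b)] of the word times the conjugate
    of the loop defect in the direction of the matrix unit [(a, b)] and summing over the [k ^ 2]
    pairs. The derivative of the word yields [k ^ 2] times the squared modulus of the defect, while
    the derivative of the conjugate contracts to normalized traces bounded independently of [k].
    Matrix units are not tangent to the unitary group, so they are written as complex combinations
    of directions [i P] with [P] a projection, along which rational curves of unitaries exist.

    The order of the quantifiers shapes the estimates. The cut-off [R] stands under a supremum, so
    the constants must not depend on it: tuples are measured by their second moments, not by [R].
    The upper limit over [k] for the packing numbers may be attained along any subsequence, so the
    microstates of [h] must be large for all large [k]; this is what the lower free entropy
    provides. *)

Definition box (a b : I -> R) : set (I -> R) :=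
  [set x | forall i, a i <= x i <= b i].

Lemma prod_side_ge0 (a b : I -> R) : (forall i, a i <= b i) ->
  (0 <= (\prod_i (b i - a i))%:E)%E.
Proof. by move=> ab; rewrite lee_fin prodr_ge0// => i _; rewrite subr_ge0. Qed.

Lemma lebesgue_outer_ge0 A : (0 <= lo A)%E.
Proof.
apply: le_ereal_inf_tmp => _ [J [a [b [ab _ ->]]]].
by apply: esum_ge0 => j _; exact: prod_side_ge0.
Qed.

Lemma set_bij_pickle (K : countType) (J : set K) : set_bij J (pickle @` J) pickle.
Proof.
split; first by move=> x Jx; exists x.
  by move=> x y _ _ /(pcan_inj pickleK).
by move=> _ [x Jx <-]; exists x.
Qed.

Lemma lebesgue_outer_cover (K : countType) (J : set K) (a b : K -> I -> R) A :
  (forall j i, a j i <= b j i) -> A `<=` \bigcup_(j in J) box (a j) (b j) ->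
  (lo A <= \esum_(j in J) (\prod_i (b j i - a j i))%:E)%E.
Proof.
move=> ab AJ; apply: ereal_inf_lbound.
(* The degenerate default box only keeps the sides ordered; the index set contains codes of elements
   of [J] alone. *)
pose ext (f : K -> I -> R) n := if unpickle n is Some k then f k else fun=> 0.
exists (pickle @` J), (ext a), (ext b); split.
- by move=> j i; rewrite /ext; case: unpickle.
- move=> x /AJ[j Jj jx]; exists (pickle j); first by exists j.
  by rewrite /ext pickleK.
- rewrite (reindex_esum J _ pickle); last first.
    exact: set_bij_pickle.
  by apply: eq_esum => j _; rewrite /ext pickleK.
Qed.

Lemma le_lebesgue_outer A B : A `<=` B -> (lo A <= lo B)%E.
Proof.
move=> AB; apply: ereal_inf_le_tmp => _ [J [a [b [ab BJ ->]]]].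
by exists J, a, b; split => // x /AB/BJ.
Qed.

Lemma lebesgue_outer_box a b : (forall i, a i <= b i) ->
  (lo (box a b) <= (\prod_i (b i - a i))%:E)%E.
Proof.
move=> ab.
have := @lebesgue_outer_cover unit setT (fun=> a) (fun=> b) (box a b).
rewrite (_ : setT = [set tt]); last by apply/seteqP; split => // -[].
by rewrite esum_set1 ?prod_side_ge0// => -> // x xab; exists tt.
Qed.

Lemma esum_epsilon (K : countType) (J : set K) (e : R) : 0 <= e ->
  (\esum_(j in J) (e / (2 ^ (pickle j).+1)%:R)%:E <= e%:E)%E.
Proof.
move=> e0; pose f (n : nat) := (e / (2 ^ n.+1)%:R)%:E.
have f0 n : (0 <= f n)%E by rewrite lee_fin divr_ge0.
rewrite -(@reindex_esum _ _ _ J (pickle @` J) pickle f); last first.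
  exact: set_bij_pickle.
apply: le_trans (epsilon_trick0 xpredT e0).
rewrite nneseries_esumT// esum_mkcond; apply: le_esum => n _.
by case: ifP => _; [exact: lexx|exact: (f0 n)].
Qed.

Lemma le_esum1 (T : choiceType) (J : set T) (f : T -> \bar R) j :
  (forall i, J i -> 0 <= f i)%E -> J j -> (f j <= \esum_(i in J) f i)%E.
Proof.
move=> f0 Jj; apply: esum_ge; exists [set j]; last by rewrite fsbig_set1.
by split; [exact: finite_set1|move=> _ ->].
Qed.

Lemma lebesgue_outer_bigcup (K : countType) (J : set K) (A : K -> set (I -> R)) :
  (lo (\bigcup_(j in J) A j) <= \esum_(j in J) lo (A j))%E.
Proof.
have [[j Jj jy]|fin] := pselect (exists2 j, J j & lo (A j) = +oo%E).
  rewrite (_ : esum _ _ = +oo%E) ?leey//; apply/eqP.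
  rewrite eq_le leey -jy /=; apply: (@le_esum1 _ J (fun j => lo (A j))) => // i _.
  exact: lebesgue_outer_ge0.
apply/lee_addgt0Pr => e e0.
have /choice[F FP] : forall j, exists p : set nat * (nat -> I -> R) * (nat -> I -> R),
    J j -> [/\ forall l i, p.1.2 l i <= p.2 l i,
      A j `<=` \bigcup_(l in p.1.1) box (p.1.2 l) (p.2 l) &
      (\esum_(l in p.1.1) (\prod_i (p.2 l i - p.1.2 l i))%:E <=
        lo (A j) + (e / (2 ^ (pickle j).+1)%:R)%:E)%E].
  move=> j; have [Jj|] := pselect (J j); last first.
    by move=> nJ; exists (set0, fun _ _ => 0, fun _ _ => 0).
  have ep : 0 < e / (2 ^ (pickle j).+1)%:R by rewrite divr_gt0// ltr0n expn_gt0.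
  have lofin : lo (A j) \is a fin_num.
    rewrite fin_numE; apply/andP; split; last by apply/eqP => ?; apply: fin; exists j.
    by rewrite gt_eqF// (lt_le_trans _ (lebesgue_outer_ge0 _)).
  have [_ [J' [a [b [ab AJ ->]]]] lt] := lb_ereal_inf_adherent ep lofin.
  by exists (J', a, b) => _; split => //; exact: ltW.
pose L : set (K * nat) := J `*`` (fun j => (F j).1.1).
(* [F j] is controlled only for [j] in [J]; elsewhere both corners are 0, so that the sides are
   ordered for every index. *)
pose a p := if p.1 \in J then (F p.1).1.2 p.2 else fun=> 0.
pose b p := if p.1 \in J then (F p.1).2 p.2 else fun=> 0.
have le1 : (lo (\bigcup_(j in J) A j) <= \esum_(p in L) (\prod_i (b p i - a p i))%:E)%E.
  apply: lebesgue_outer_cover.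
    move=> [j l] i; rewrite /a /b /=; case: ifP => //; rewrite inE => Jj.
    by have [h _ _] := FP j Jj; exact: h.
  move=> x [j Jj Ax]; have [_ h _] := FP j Jj; have [l Fl xl] := h _ Ax.
  by exists (j, l) => //; rewrite /a /b /= mem_set.
apply: (le_trans le1).
rewrite -(@esum_esum R K nat J (fun j => (F j).1.1)
   (fun j l => (\prod_i (b (j, l) i - a (j, l) i))%:E)); last first.
  move=> j l Jj Fl; apply: prod_side_ge0 => i; rewrite /a /b /= mem_set//.
  by have [h _ _] := FP j Jj; exact: h.
apply: (@le_trans _ _ (\esum_(j in J) (lo (A j) + (e / (2 ^ (pickle j).+1)%:R)%:E))%E).
  apply: le_esum => j Jj; have [_ _ h] := FP j Jj.
  apply: le_trans h; rewrite le_eqVlt; apply/orP; left; apply/eqP.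
  by apply: eq_esum => l _; rewrite /a /b /= mem_set.
rewrite esumD; last 2 first.
- by move=> j _; exact: lebesgue_outer_ge0.
- by move=> j _; rewrite lee_fin divr_ge0// ltW.
by rewrite leeD2l// esum_epsilon// ltW.
Qed.

End OuterMeasure.

Section OuterLike.
Context {R : realType} (I : finType).
Implicit Types (A B : set (I -> R)) (Phi : set (I -> R) -> \bar R).
Local Notation lo := (@lebesgue_outer R I).

(** The part of the notion of outer measure that a comparison on cubes uses. The instances are the
    outer measure of a preimage and a sum of outer measures of traces on several sets. *)
Definition outer_like Phi :=
  [/\ forall A, (0 <= Phi A)%E,
      forall A B, A `<=` B -> (Phi A <= Phi B)%E &
      forall (K : countType) (J : set K) (A : K -> set (I -> R)),
        (Phi (\bigcup_(j in J) A j) <= \esum_(j in J) Phi (A j))%E].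

Lemma outer_like_bigcup Phi (K : finType) (P : pred K) (A : K -> set (I -> R)) :
  outer_like Phi -> (Phi (\bigcup_(j in [set` P]) A j) <= \sum_(j | P j) Phi (A j))%E.
Proof.
move=> [ge0 _ sub]; apply: (le_trans (sub _ _ _)).
rewrite esum_fset => [||j _]; [|exact: finite_finset|exact: ge0].
by rewrite -(@bigfs _ _ _ _ (index_enum K))// ?index_enum_uniq// => i _; rewrite mem_index_enum.
Qed.

Definition cube (c : I -> R) (s : R) : set (I -> R) :=
  [set x | forall i, c i <= x i <= c i + s].

Lemma lebesgue_outer_cube c s : 0 <= s -> (lo (cube c s) <= (s ^+ #|I|)%:E)%E.
Proof.
move=> s0; apply: le_trans (lebesgue_outer_box _) _ => [i|]; first by rewrite lerDl.
rewrite lee_fin -prodr_const; apply/ler_prod => i _.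
by rewrite addrAC subrr add0r s0 lexx.
Qed.

(** Continuity at 0 of a polynomial in [s]. It absorbs the overshoot of a grid of mesh [s] covering
    a box. *)
Lemma prod_perturb (l : I -> R) (K e d : R) : 0 < e -> 0 < d ->
  exists s, [/\ 0 < s, s <= d & K * \prod_i (l i + s) <= K * (\prod_i l i) + e].
Proof.
move=> e0 d0; pose q := K *: \prod_i ((l i)%:P + 'X).
have qE s : q.[s] = K * \prod_i (l i + s).
  by rewrite hornerZ horner_prod; under eq_bigr do rewrite hornerD hornerC hornerX.
have q0 : q.[0] = K * \prod_i l i.
  by rewrite qE; under eq_bigr do rewrite addr0.
have /cvgrPdist_lt/(_ _ e0) := @continuous_horner R q 0.
rewrite /prop_near1 => /nbhs_ballP[r /= r0 rP].
exists (Num.min (r / 2) d).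
have s0 : 0 < Num.min (r / 2) d by rewrite lt_min d0 divr_gt0.
split=> //; first by rewrite ge_min lexx orbT.
have /rP : ball 0 r (Num.min (r / 2) d).
  rewrite /ball /= sub0r normrN gtr0_norm// gt_min; apply/orP; left.
  by rewrite ltr_pdivrMr// ltr_pMr// ltr1n.
rewrite -qE -q0 distrC /= => /ltW; rewrite ler_distl => /andP[_].
by rewrite addrC.
Qed.

(** A grid of cubes of side [s] covers the box, and their total volume is at most that of the box
    with sides lengthened by [s]; then [s] is taken small. *)
Lemma outer_like_box Phi (K d : R) a b : outer_like Phi -> 0 <= K -> 0 < d ->
  (forall c s, 0 < s <= d -> (Phi (cube c s) <= (K * s ^+ #|I|)%:E)%E) ->
  (forall i, a i <= b i) ->
  (Phi (box a b) <= (K * \prod_i (b i - a i))%:E)%E.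
Proof.
move=> oPhi K0 d0 cubeP ab; apply/lee_addgt0Pr => e e0.
have [s [s0 sd Ks]] := prod_perturb (fun i => b i - a i) K e0 d0.
pose N i := (Num.truncn ((b i - a i) / s)).+1.
pose M := \max_i N i.
have NM i : (N i <= M)%N by exact: leq_bigmax.
pose P (z : {ffun I -> 'I_M}) := z \in family (fun i => [pred j : 'I_M | (j < N i)%N]).
pose c (z : {ffun I -> 'I_M}) i := a i + s * (z i)%:R.
have [ge0 mono _] := oPhi.
have sub : box a b `<=` \bigcup_(z in [set` P]) cube (c z) s.
  move=> x xab.
  have xN i : (Num.truncn ((x i - a i) / s) < N i)%N.
    rewrite ltnS; apply: le_truncn; rewrite ler_pM2r ?invr_gt0//.
    by rewrite lerD2r; have /andP[] := xab i.
  have xM i : (Num.truncn ((x i - a i) / s) < M)%N by exact: leq_trans (NM i).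
  exists [ffun i => Ordinal (xM i)].
    by apply/familyP => i; rewrite ffunE inE /= xN.
  move=> i; rewrite /c ffunE /=.
  have x0 : 0 <= (x i - a i) / s.
    by rewrite divr_ge0 ?(ltW s0)// subr_ge0; have /andP[] := xab i.
  have /andP[] := truncn_itv x0; set t := Num.truncn _; rewrite ler_pdivlMr// ltr_pdivrMr// -natr1 mulrDl mul1r.
  move=> h1 h2; apply/andP; split; lra.
apply: (le_trans (mono _ _ sub)); apply: (le_trans (outer_like_bigcup _ _ oPhi)).
apply: (@le_trans _ _ (\sum_(z | P z) (K * s ^+ #|I|)%:E)%E).
  by apply: lee_sum => z _; apply: cubeP; rewrite s0.
rewrite sumEFin -EFinD lee_fin; apply: le_trans Ks; rewrite -mulr_sumr ler_wpM2l//.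
have -> : s ^+ #|I| = \prod_(i : I) s by rewrite prodr_const.
rewrite -(@bigA_distr_big_dep _ _ _ _ _ I 'I_M
   (fun i => [pred j : 'I_M | (j < N i)%N]) (fun _ _ => s)) /=.
apply: ler_prod => i _; rewrite sumr_ge0 => [|j _]; last exact: ltW.
rewrite sumr_const; have -> : #|[pred j : 'I_M | (j < N i)%N]| = N i.
  rewrite -sum1_card (eq_bigl (fun j : 'I_M => (j < N i)%N))//.
  by rewrite -(big_ord_widen M (fun=> 1%N))// sum1_card card_ord.
rewrite -mulr_natl /N; set t := Num.truncn _; rewrite -natr1 mulrDl mul1r lerD2r -ler_pdivlMr//.
by rewrite truncn_le divr_ge0 ?(ltW s0)// subr_ge0.
Qed.

(** Domination on small cubes passes to boxes by grids and then to all sets by countable covers.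
    This is the tool by which maps of the coordinate space are shown to distort volumes in a
    controlled way. *)
Lemma outer_like_le Phi (K d : R) A : outer_like Phi -> 0 < K -> 0 < d ->
  (forall c s, 0 < s <= d -> (Phi (cube c s) <= (K * s ^+ #|I|)%:E)%E) ->
  (Phi A <= K%:E * lo A)%E.
Proof.
move=> oPhi K0 d0 cubeP; rewrite -lee_pdivrMl//.
apply: le_ereal_inf_tmp => _ [J [a [b [ab AJ ->]]]]; rewrite lee_pdivrMl//.
have [ge0 mono sub] := oPhi.
apply: (le_trans (mono _ _ AJ)); apply: (le_trans (sub _ _ _)).
apply: (@le_trans _ _ (\esum_(j in J) (K%:E * (\prod_i (b j i - a j i))%:E))%E).
  by apply: le_esum => j Jj; exact: (outer_like_box oPhi (ltW K0) d0 cubeP (ab j)).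
apply: ge_ereal_sup => _ [X [finX XJ] <-].
rewrite -ge0_mule_fsumr => [|j]; last exact/prod_side_ge0/ab.
rewrite lee_pmul2l ?lte_fin//.
by apply: esum_ge; exists X.
Qed.

End OuterLike.

Section Volumes.
Context {R : realType} (I : finType).
Implicit Types (A B : set (I -> R)) (Phi : set (I -> R) -> \bar R).
Local Notation lo := (@lebesgue_outer R I).

Lemma outer_like_preimage (J : finType) (T : (J -> R) -> I -> R) :
  outer_like (fun A : set (I -> R) => lebesgue_outer (T @^-1` A)).
Proof.
split=> [A|A B AB|K X A]; first exact: lebesgue_outer_ge0.
  by apply: le_lebesgue_outer => x; exact: AB.
by rewrite preimage_bigcup; exact: lebesgue_outer_bigcup.
Qed.

Lemma outer_like_lebesgue_outer : outer_like lo.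
Proof. exact: (outer_like_preimage id). Qed.

(** Comparing this functional with the outer measure itself gives superadditivity on separated
    sets. *)
Lemma outer_like_sum_setI (K : finType) (B : K -> set (I -> R)) :
  outer_like (fun A => \sum_(s : K) lo (A `&` B s))%E.
Proof.
split=> [A|A A' AA'|L X A].
- by apply: sume_ge0 => s _; exact: lebesgue_outer_ge0.
- by apply: lee_sum => s _; apply: le_lebesgue_outer; exact: setSI.
- rewrite esum_sum => [|j s _ _]; last exact: lebesgue_outer_ge0.
  apply: lee_sum => s _; rewrite setI_bigcupl; exact: lebesgue_outer_bigcup.
Qed.

(* A cube thinner than the separation [d] meets at most one of the sets. *)
Lemma lebesgue_outer_separated (K : finType) (B : K -> set (I -> R)) (d : R) :
  0 < d ->
  (forall s t x y, s != t -> B s x -> B t y -> exists i, d < `|x i - y i|) ->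
  (\sum_(s : K) lo (B s) <= lo (\bigcup_s B s))%E.
Proof.
move=> d0 sep.
have := @outer_like_le _ _ _ 1 d (\bigcup_s B s) (outer_like_sum_setI B) ltr01 d0.
rewrite mul1e => h; apply: le_trans (h _).
  apply: lee_sum => s _; apply: le_lebesgue_outer => x Bx; split => //; by exists s.
move=> c s /andP[s0 sd]; rewrite mul1r.
have [/existsP[k /asboolP[x [cx Bx]]]|] :=
    boolP [exists k, `[< exists x, cube c s x /\ B k x >]]; last first.
  move/existsPn => no; rewrite big1 ?lee_fin ?exprn_ge0 ?ltW// => k _.
  apply/eqP; rewrite eq_le lebesgue_outer_ge0 andbT.
  have -> : cube c s `&` B k = set0.
    apply/seteqP; split=> // x [cx Bx]; have /asboolP := no k.
    by case; exists x.
  have := @lebesgue_outer_cover R I nat set0 (fun=> fun=> 0) (fun=> fun=> 0) set0.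
  by rewrite esum_set0; apply.
rewrite (bigD1 k)//= big1 ?adde0 => [|l lk].
  by apply: le_trans (lebesgue_outer_cube c (ltW s0)); apply: le_lebesgue_outer => y [].
apply/eqP; rewrite eq_le lebesgue_outer_ge0 andbT.
have -> : cube c s `&` B l = set0.
  apply/seteqP; split=> // y [cy By]; have [i yx] := sep _ _ _ _ lk By Bx.
  have /andP[x1 x2] := cx i; have /andP[y1 y2] := cy i.
  by move: yx; rewrite ltNge => /negP[]; apply: le_trans sd; rewrite ler_norml; apply/andP; split; lra.
have := @lebesgue_outer_cover R I nat set0 (fun=> fun=> 0) (fun=> fun=> 0) set0.
by rewrite esum_set0; apply.
Qed.

Lemma sum_half_pow (N : nat) : \sum_(m < N) (2^-1 : R) ^+ m <= 2.
Proof.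
have h : \sum_(m < N) (2^-1 : R) ^+ m = 2 - 2 * 2^-1 ^+ N.
  elim: N => [|N IH]; first by rewrite big_ord0 expr0; lra.
  by rewrite big_ord_recr /= IH exprS; lra.
by rewrite h lerBlDr lerDl mulr_ge0// exprn_ge0.
Qed.

(* The cells of side [s] around [c] are indexed by signs and naturals [m i]; those meeting the
   ball have [sum_i m i <= d], so they number at most
   [sum_z 2 ^ (d - sum_i m i) <= 2 ^ d * 4 ^ d]. *)
Lemma lebesgue_outer_ball (c : I -> R) (s : R) : 0 < s ->
  (lo [set x | \sum_i (x i - c i) ^+ 2 <= #|I|%:R * s ^+ 2]%R <=
     ((8 * s) ^+ #|I|)%:E)%E.
Proof.
move=> s0; set d := #|I|; set A := [set x | _].
pose P (z : {ffun I -> bool * 'I_d.+1}) := (\sum_i (z i).2 <= d)%N.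
(* The sign tells on which side of [c i] the cell lies; a cell on the left starts one step further,
   at [m + 1]. *)
pose cc (z : {ffun I -> bool * 'I_d.+1}) i :=
  if (z i).1 then c i + s * (z i).2%:R else c i - s * ((z i).2.+1)%:R.
have sub : A `<=` \bigcup_(z in [set` P]) cube (cc z) s.
  move=> x Ax; pose t i := `|x i - c i| / s.
  have t0 i : 0 <= t i by rewrite divr_ge0// ltW.
  (* From [2 t <= t ^ 2 + 1]: a mean square at most 1 forces a mean at most 1. *)
  have tsum : \sum_i t i <= d%:R.
    have : \sum_i (t i) ^+ 2 <= d%:R.
      under eq_bigr do rewrite /t exprMn exprVn real_normK ?num_real//.
      by rewrite -mulr_suml ler_pdivrMr// exprn_gt0.
    have : \sum_i (2 * t i) <= \sum_i (t i ^+ 2 + 1).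
      apply: ler_sum => i _; rewrite -subr_ge0.
      have -> : t i ^+ 2 + 1 - 2 * t i = (t i - 1) ^+ 2 by ring.
      exact: sqr_ge0.
    by rewrite big_split /= -mulr_sumr sumr_const -/d; lra.
  have tnat : (\sum_i Num.truncn (t i) <= d)%N.
    rewrite -(ler_nat R) natr_sum; apply: le_trans tsum; apply: ler_sum => i _.
    by have /andP[] := truncn_itv (t0 i).
  have td i : (Num.truncn (t i) < d.+1)%N.
    by rewrite ltnS; apply: leq_trans tnat; rewrite (bigD1 i)//= leq_addr.
  exists [ffun i => (c i <= x i, Ordinal (td i))].
    by rewrite /= unfold_in /P; under eq_bigr do rewrite ffunE /=.
  move=> i; rewrite /cc ffunE /=.
  have := truncn_itv (t0 i); move: (Num.truncn _) => m.
  rewrite /t ler_pdivlMr// ltr_pdivrMr// -natr1.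
  case: (leP (c i) (x i)) => cx.
    have xc0 : 0 <= x i - c i by rewrite subr_ge0.
    rewrite (ger0_norm xc0) => /andP[h1 h2]; apply/andP; split; nra.
  have xc0 : x i - c i < 0 by rewrite subr_lt0.
  rewrite (ltr0_norm xc0) => /andP[h1 h2]; apply/andP; split; nra.
apply: (le_trans (le_lebesgue_outer sub)).
apply: (le_trans (outer_like_bigcup _ _ outer_like_lebesgue_outer)).
apply: (@le_trans _ _ (\sum_(z | P z) (s ^+ d)%:E)%E).
  by apply: lee_sum => z _; apply: lebesgue_outer_cube; exact: ltW.
rewrite sumEFin lee_fin exprMn mulrC.
have -> : \sum_(z | P z) s ^+ d = s ^+ d * \sum_(z | P z) 1.
  by rewrite mulr_sumr; under [RHS]eq_bigr do rewrite mulr1.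
rewrite ler_pM2l ?exprn_gt0//.
apply: (@le_trans _ _ (\sum_(z | P z) \prod_i (2 * 2^-1 ^+ (z i).2))).
  apply: ler_sum => z Pz; rewrite big_split /= prodr_const -/d.
  rewrite prodrXr exprVn -(ler_pM2r (x := 2 ^+ (\sum_i (z i).2)%N)) ?exprn_gt0//.
  by rewrite mul1r mulfVK ?expf_neq0// ler_weXn2l// ler1n.
apply: (@le_trans _ _ (\sum_(z : {ffun I -> bool * 'I_d.+1})
    \prod_i (2 * 2^-1 ^+ (z i).2))).
  rewrite [leRHS](bigID P) /= lerDl sumr_ge0// => z _; apply: prodr_ge0 => i _.
  by rewrite mulr_ge0// exprn_ge0.
rewrite -(bigA_distr_bigA (fun (_ : I) (p : bool * 'I_d.+1) => (2 * 2^-1 ^+ p.2 : R))).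
rewrite /= prodr_const -/d lerXn2r ?nnegrE//.
  by apply: sumr_ge0 => p _; rewrite mulr_ge0// exprn_ge0.
rewrite -(pair_bigA _ (fun (_ : bool) (m : 'I_d.+1) => (2 * 2^-1 ^+ m : R))) /=.
rewrite big_bool -mulr_sumr /=; have := sum_half_pow d.+1; lra.
Qed.

End Volumes.

(** * Matrices and tuples of matrices *)

Section Modulus.
Context {R : realType}.
Implicit Types (z : R[i]).

(** The norm of [R[i]] has values in [R[i]]; this is the same modulus as an element of the ordered
    field [R]. *)
Definition cabs z : R := complex.Re `|z|.

Lemma cabsE z : `|z| = ((cabs z)%:C)%C.
Proof. by rewrite /cabs normc_def. Qed.

Lemma cabs_ge0 z : 0 <= cabs z.
Proof. by rewrite /cabs normc_def /= sqrtr_ge0. Qed.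

Lemma cabsM z1 z2 : cabs (z1 * z2) = cabs z1 * cabs z2.
Proof. by apply: complexI; rewrite -cabsE normrM !cabsE rmorphM. Qed.

Lemma cabsD z1 z2 : cabs (z1 + z2) <= cabs z1 + cabs z2.
Proof. by rewrite -lecR rmorphD /= -!cabsE ler_normD. Qed.

Lemma cabsN z : cabs (- z) = cabs z.
Proof. by rewrite /cabs normrN. Qed.

Lemma cabsB z1 z2 : cabs (z1 - z2) <= cabs z1 + cabs z2.
Proof. by rewrite -(cabsN z2) cabsD. Qed.

Lemma cabs0 : cabs 0 = 0. Proof. by rewrite /cabs normr0. Qed.
Lemma cabs1 : cabs 1 = 1. Proof. by rewrite /cabs normr1. Qed.

Lemma cabs_sum (I : Type) (r : seq I) (P : pred I) (F : I -> R[i]) :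
  cabs (\sum_(i <- r | P i) F i) <= \sum_(i <- r | P i) cabs (F i).
Proof.
elim/big_ind2 : _ => [|z x z' x' h h'|//]; first by rewrite cabs0.
by apply: le_trans (cabsD _ _) _; exact: lerD.
Qed.

Lemma cabsV z : cabs z^-1 = (cabs z)^-1.
Proof. by apply: complexI; rewrite -cabsE normfV cabsE fmorphV. Qed.

Lemma cabs_real (x : R) : cabs (x%:C)%C = `|x|.
Proof. by rewrite /cabs normc_def /= expr0n addr0 sqrtr_sqr. Qed.

Lemma cabs_nat n : cabs n%:R = n%:R.
Proof. by rewrite /cabs normr_nat -(rmorph_nat (real_complex R)). Qed.

Lemma cabsJ z : cabs (conjc z) = cabs z.
Proof. by rewrite /cabs normcJ. Qed.

Lemma cabs_sqr z : ((cabs z ^+ 2)%:C)%C = z * conjc z.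
Proof. by rewrite rmorphXn /= -cabsE sqr_normc. Qed.

Lemma Re_normsq z : complex.Re (`|z| ^+ 2) = cabs z ^+ 2.
Proof. by rewrite cabsE -rmorphXn. Qed.

Lemma cabs_lt z (g : R) : (`|z| < (g%:C)%C) = (cabs z < g).
Proof. by rewrite cabsE ltcR. Qed.

Lemma cabs_eq0 z : (cabs z == 0) = (z == 0).
Proof. by rewrite -(inj_eq (@complexI R)) -cabsE normr_eq0. Qed.

Lemma Re_le_cabs z : complex.Re z <= cabs z.
Proof.
rewrite -lecR -cabsE; apply: le_trans (normc_ge_Re z).
by rewrite lecR ler_norm.
Qed.

Lemma cabsX z n : cabs (z ^+ n) = cabs z ^+ n.
Proof. by elim: n => [|n IH]; rewrite ?expr0 ?cabs1// !exprS cabsM IH. Qed.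

End Modulus.

Section Euclid.
Context {R : realType} (I : finType).
Implicit Types f g : I -> R.

Lemma cauchy_schwarz_sum f g :
  \sum_i f i * g i <= Num.sqrt (\sum_i f i ^+ 2) * Num.sqrt (\sum_i g i ^+ 2).
Proof.
set A := Num.sqrt _; set B := Num.sqrt _.
have A2 : A ^+ 2 = \sum_i f i ^+ 2 by rewrite sqr_sqrtr// sumr_ge0// => i _; exact: sqr_ge0.
have B2 : B ^+ 2 = \sum_i g i ^+ 2 by rewrite sqr_sqrtr// sumr_ge0// => i _; exact: sqr_ge0.
have zero (h : I -> R) : \sum_i h i ^+ 2 = 0 -> forall i, h i = 0.
  move=> /psumr_eq0P h0 i; apply/eqP; rewrite -sqrf_eq0; apply/eqP.
  by apply: h0 => // j _; exact: sqr_ge0.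
have [A0|A0] := eqVneq A 0.
  rewrite A0 mul0r big1// => i _; rewrite zero ?mul0r//.
  by rewrite -A2 A0 expr0n.
have [B0|B0] := eqVneq B 0.
  rewrite B0 mulr0 big1// => i _; rewrite [g i]zero ?mulr0//.
  by rewrite -B2 B0 expr0n.
have Ap : 0 < A by rewrite lt_neqAle eq_sym A0 sqrtr_ge0.
have Bp : 0 < B by rewrite lt_neqAle eq_sym B0 sqrtr_ge0.
have : \sum_i (2 * (A * B) * (f i * g i)) <= \sum_i (B ^+ 2 * f i ^+ 2 + A ^+ 2 * g i ^+ 2).
  apply: ler_sum => i _; rewrite -subr_ge0.
  have -> : B ^+ 2 * f i ^+ 2 + A ^+ 2 * g i ^+ 2 - 2 * (A * B) * (f i * g i) =
    (B * f i - A * g i) ^+ 2 by ring.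
  exact: sqr_ge0.
rewrite big_split /= -!mulr_sumr -A2 -B2.
have -> : B ^+ 2 * A ^+ 2 + A ^+ 2 * B ^+ 2 = 2 * (A * B) * (A * B) by ring.
by rewrite ler_pM2l// !mulr_gt0.
Qed.

Lemma minkowski_sum f g :
  Num.sqrt (\sum_i (f i + g i) ^+ 2) <=
  Num.sqrt (\sum_i f i ^+ 2) + Num.sqrt (\sum_i g i ^+ 2).
Proof.
set A := Num.sqrt (\sum_i f i ^+ 2); set B := Num.sqrt (\sum_i g i ^+ 2).
have A2 : A ^+ 2 = \sum_i f i ^+ 2 by rewrite sqr_sqrtr// sumr_ge0// => i _; exact: sqr_ge0.
have B2 : B ^+ 2 = \sum_i g i ^+ 2 by rewrite sqr_sqrtr// sumr_ge0// => i _; exact: sqr_ge0.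
have AB : 0 <= A + B by rewrite addr_ge0 ?sqrtr_ge0.
rewrite -[leRHS]ger0_norm// -sqrtr_sqr; apply: ler_wsqrtr.
under eq_bigr do rewrite sqrrD.
rewrite !big_split /= -A2 -B2 sqrrD lerD2r lerD2l.
by rewrite mulr2n lerD ?cauchy_schwarz_sum.
Qed.

End Euclid.

Section OperatorBounds.
Context {R : realType}.
Local Notation C := R[i].

Definition adj m k (x : 'M[C]_(m, k)) : 'M[C]_(k, m) := map_mx conjc x^T.

Lemma adjK m k (x : 'M[C]_(m, k)) : adj (adj x) = x.
Proof. by apply/matrixP => i j; rewrite !mxE conjcK. Qed.

Lemma adjM m k p (x : 'M[C]_(m, k)) (y : 'M[C]_(k, p)) :
  adj (x *m y) = adj y *m adj x.
Proof. by rewrite /adj trmx_mul map_mxM. Qed.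

Lemma hermP k (x : 'M[C]_k) : (x \is hermsymmx) <-> adj x = x.
Proof.
have cE (z : C) : Num.conj z = conjc z by [].
split=> [/is_hermitianmxP|h].
  rewrite expr0 scale1r => h; apply/matrixP => i j.
  by rewrite [in RHS]h !mxE.
apply/is_hermitianmxP; rewrite expr0 scale1r; apply/matrixP => i j.
by rewrite -[in LHS]h !mxE.
Qed.

Lemma l2norm_sqr k (v : 'cV[C]_k) : l2norm v ^+ 2 = \sum_i cabs (v i 0) ^+ 2.
Proof.
rewrite /l2norm sqr_sqrtr; last by apply: sumr_ge0 => i _; rewrite Re_normsq sqr_ge0.
by apply: eq_bigr => i _; rewrite Re_normsq.
Qed.

Lemma l2normE k (v : 'cV[C]_k) : l2norm v = Num.sqrt (\sum_i cabs (v i 0) ^+ 2).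
Proof. by rewrite -l2norm_sqr sqrtr_sqr ger0_norm// sqrtr_ge0. Qed.

Lemma l2norm_ge0 k (v : 'cV[C]_k) : 0 <= l2norm v.
Proof. exact: sqrtr_ge0. Qed.

Lemma l2normD k (v w : 'cV[C]_k) : l2norm (v + w) <= l2norm v + l2norm w.
Proof.
rewrite !l2normE; apply: le_trans (minkowski_sum _ _).
apply: ler_wsqrtr; apply: ler_sum => i _; rewrite mxE lerXn2r ?nnegrE ?cabs_ge0 ?cabsD//.
by rewrite addr_ge0 ?cabs_ge0.
Qed.

Lemma l2normZ k (c : C) (v : 'cV[C]_k) : l2norm (c *: v) = cabs c * l2norm v.
Proof.
rewrite !l2normE -[cabs c]ger0_norm ?cabs_ge0// -sqrtr_sqr -sqrtrM ?sqr_ge0//.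
by rewrite mulr_sumr; congr Num.sqrt; apply: eq_bigr => i _; rewrite mxE cabsM exprMn.
Qed.

Lemma l2norm0 k : l2norm (0 : 'cV[C]_k) = 0.
Proof. by rewrite -(scale0r 0) l2normZ cabs0 mul0r. Qed.

Lemma l2norm_eq0 k (v : 'cV[C]_k) : l2norm v = 0 -> v = 0.
Proof.
move=> v0; have := l2norm_sqr v; rewrite v0 expr0n /= => /esym/psumr_eq0P h.
apply/matrixP => i j; rewrite (ord1 j) mxE; apply/eqP.
by rewrite -cabs_eq0 -sqrf_eq0; apply/eqP/h => // l _; exact: sqr_ge0.
Qed.

Lemma cabs_entry_le k (v : 'cV[C]_k) i : cabs (v i 0) <= l2norm v.
Proof.
rewrite l2normE -[leLHS]ger0_norm ?cabs_ge0// -sqrtr_sqr; apply: ler_wsqrtr.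
by rewrite (bigD1 i)//= lerDl sumr_ge0// => j _; exact: sqr_ge0.
Qed.

(** An operator norm bound free of suprema, so that sums and products are estimated vector by
    vector. For [r >= 0] it is equivalent to [operator_norm x <= r]. *)
Definition opbd k (x : 'M[C]_k) (r : R) :=
  forall v : 'cV[C]_k, l2norm (x *m v) <= r * l2norm v.

Lemma opbdM k (x y : 'M[C]_k) r s : 0 <= r -> opbd x r -> opbd y s -> opbd (x *m y) (r * s).
Proof.
move=> r0 xr ys v; rewrite -mulmxA; apply: le_trans (xr _) _.
by rewrite -mulrA ler_wpM2l.
Qed.

Lemma opbdD k (x y : 'M[C]_k) r s : opbd x r -> opbd y s -> opbd (x + y) (r + s).
Proof.
move=> xr ys v; rewrite mulmxDl; apply: le_trans (l2normD _ _) _.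
by rewrite mulrDl lerD.
Qed.

Lemma opbdZ k (x : 'M[C]_k) r (c : C) : opbd x r -> opbd (c *: x) (cabs c * r).
Proof. by move=> xr v; rewrite -scalemxAl l2normZ -mulrA ler_wpM2l ?cabs_ge0. Qed.

Lemma opbdN k (x : 'M[C]_k) r : opbd x r -> opbd (- x) r.
Proof. by rewrite -scaleN1r => /(opbdZ (-1)); rewrite cabsN cabs1 mul1r. Qed.

Lemma opbd1 k : opbd (1%:M : 'M[C]_k) 1.
Proof. by move=> v; rewrite mul1mx mul1r. Qed.

Lemma opbd0 k : opbd (0 : 'M[C]_k) 0.
Proof. by move=> v; rewrite mul0mx l2norm0 mul0r. Qed.

Lemma opbd_le k (x : 'M[C]_k) r s : r <= s -> opbd x r -> opbd x s.
Proof. by move=> rs xr v; apply: le_trans (xr v) _; rewrite ler_wpM2r ?l2norm_ge0. Qed.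

Lemma l2norm_delta k (j : 'I_k) : l2norm (delta_mx j 0 : 'cV[C]_k) = 1.
Proof.
rewrite l2normE (bigD1 j)//= big1 => [|i ij].
  by rewrite mxE !eqxx cabs1 expr1n addr0 sqrtr1.
by rewrite mxE (negbTE ij) cabs0 expr0n.
Qed.

Lemma opbd_entry k (x : 'M[C]_k) r i j : opbd x r -> cabs (x i j) <= r.
Proof.
move=> /(_ (delta_mx j 0)); rewrite l2norm_delta mulr1; apply: le_trans.
by rewrite -colE -[x i j](_ : col j x i 0 = _) ?cabs_entry_le// mxE.
Qed.

Lemma opbd_sum k (J : finType) (x : J -> 'M[C]_k) (r : J -> R) : (forall j, opbd (x j) (r j)) ->
  opbd (\sum_j x j) (\sum_j r j).
Proof.
move=> xr; elim/big_ind2 : _ => [|? ? ? ?|//]; first exact: opbd0.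
exact: opbdD.
Qed.

Lemma opbd_delta k (i j : 'I_k) : opbd (delta_mx i j : 'M[C]_k) 1.
Proof.
move=> v; rewrite mul1r l2normE (bigD1 i)//= big1 => [|l li].
  rewrite addr0 sqrtr_sqr ger0_norm ?cabs_ge0// mxE (bigD1 j)//= big1 => [|l lj].
    by rewrite mxE !eqxx mul1r addr0 cabs_entry_le.
  by rewrite mxE (negbTE lj) andbF mul0r.
rewrite mxE big1 ?cabs0 ?expr0n// => m _.
by rewrite mxE (negbTE li) mul0r.
Qed.

(** The crude factor [k ^ 2] suffices: it only enters the mesh of a net, which may shrink
    polynomially in [k]. *)
Lemma opbd_entries k (x : 'M[C]_k) e : 
  (forall i j, cabs (x i j) <= e) -> opbd x ((k * k)%:R * e).
Proof.
move=> xe; rewrite [x]matrix_sum_delta.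
have -> : (k * k)%:R * e = \sum_(i < k) \sum_(j < k) e.
  by rewrite !sumr_const !card_ord -mulrnA mulr_natl.
apply: opbd_sum => i; apply: opbd_sum => j.
apply: opbd_le (xe i j) _; rewrite -[cabs _]mulr1; apply: opbdZ; exact: opbd_delta.
Qed.

(** A supremum is informative only for a bounded set, so a crude entrywise bound comes before the
    normalisation of the vector. *)
Lemma operator_norm_opbd k (x : 'M[C]_k) r : operator_norm x <= r -> opbd x r.
Proof.
set S := [set l2norm (x *m v) | v in [set v : 'cV[C]_k | l2norm v <= 1]].
have [e e0 xe] : exists2 e : R, 0 <= e & opbd x e.
  pose e := \sum_i \sum_j cabs (x i j).
  have e0 : 0 <= e by apply: sumr_ge0 => i _; apply: sumr_ge0 => j _; exact: cabs_ge0.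
  exists ((k * k)%:R * e); first by rewrite mulr_ge0.
  apply: opbd_entries => i j; rewrite /e (bigD1 i)//= (bigD1 j)//= -addrA lerDl.
  rewrite addr_ge0//; first by apply: sumr_ge0 => l _; exact: cabs_ge0.
  by apply: sumr_ge0 => l _; apply: sumr_ge0 => m _; exact: cabs_ge0.
have ubS : has_ubound S.
  exists e => _ [v v1 <-]; apply: le_trans (xe v) _.
  by rewrite -[leRHS]mulr1 ler_wpM2l.
move=> xr v; have [v0|v0] := eqVneq (l2norm v) 0.
  by rewrite (l2norm_eq0 v0) mulmx0 l2norm0 mulr0.
have vp : 0 < l2norm v by rewrite lt_neqAle eq_sym v0 l2norm_ge0.
pose c : C := ((l2norm v)^-1%:C)%C.
have cc : cabs c = (l2norm v)^-1 by rewrite cabs_real ger0_norm// invr_ge0 ltW.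
have : l2norm (x *m (c *: v)) <= r.
  apply: le_trans xr; apply: ub_le_sup => //; exists (c *: v) => //=.
  by rewrite l2normZ cc mulVf.
by rewrite -scalemxAr l2normZ cc mulrC ler_pdivrMr.
Qed.

Lemma opbd_operator_norm k (x : 'M[C]_k) r : 0 <= r -> opbd x r -> operator_norm x <= r.
Proof.
move=> r0 xr; apply: ge_sup; first by exists (l2norm (x *m 0)); exists 0; rewrite //= l2norm0.
move=> _ [v v1 <-]; apply: le_trans (xr v) _.
by rewrite -[leRHS]mulr1 ler_wpM2l.
Qed.

Lemma trace_opbd k (x : 'M[C]_k) r : 0 <= r -> opbd x r -> cabs (normalized_trace x) <= r.
Proof.
move=> r0 xr; rewrite /normalized_trace cabsM cabsV cabs_nat.
case: k x xr => [|k] x xr; first by rewrite invr0 mulr0.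
rewrite ler_pdivrMr ?ltr0n//; apply: le_trans (cabs_sum _ _ _) _.
rewrite mulr_natr -[k.+1 in leRHS]card_ord -sumr_const.
by apply: ler_sum => i _; exact: opbd_entry.
Qed.

Definition unitary k (u : 'M[C]_k) := u *m adj u = 1%:M.

Lemma unitaryV k (u : 'M[C]_k) : unitary u -> adj u *m u = 1%:M.
Proof. exact: mulmx1C. Qed.

Lemma unitary_adj k (u : 'M[C]_k) : unitary u -> unitary (adj u).
Proof. by move=> uu; rewrite /unitary adjK unitaryV. Qed.

Lemma adj1 k : adj (1%:M : 'M[C]_k) = 1%:M.
Proof. by apply/matrixP => i j; rewrite !mxE eq_sym conjc_nat. Qed.

Lemma unitary1 k : unitary (1%:M : 'M[C]_k).
Proof. by rewrite /unitary adj1 mulmx1. Qed.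

Lemma unitaryM k (u v : 'M[C]_k) : unitary u -> unitary v -> unitary (u *m v).
Proof.
by move=> uu vv; rewrite /unitary adjM mulmxA -[u *m v *m _]mulmxA vv mulmx1.
Qed.

Lemma l2norm_sqrE k (v : 'cV[C]_k) : ((l2norm v ^+ 2)%:C)%C = (adj v *m v) 0 0.
Proof.
rewrite l2norm_sqr rmorph_sum mxE; apply: eq_bigr => i _ /=.
by rewrite !mxE cabs_sqr mulrC.
Qed.

Lemma l2norm_unitary k (u : 'M[C]_k) v : unitary u -> l2norm (u *m v) = l2norm v.
Proof.
move=> uu; have : l2norm (u *m v) ^+ 2 = l2norm v ^+ 2.
  apply: complexI; rewrite !l2norm_sqrE adjM mulmxA -[adj v *m _ *m _]mulmxA.
  by rewrite unitaryV// mulmx1.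
by move/eqP; rewrite eqrXn2 ?l2norm_ge0// => /eqP.
Qed.

Lemma opbd_unitary k (u : 'M[C]_k) : unitary u -> opbd u 1.
Proof. by move=> uu v; rewrite l2norm_unitary// mul1r. Qed.

Definition uconj k (u x : 'M[C]_k) := u *m x *m adj u.

Lemma opbd_conj k (u x : 'M[C]_k) r : 0 <= r -> unitary u -> opbd x r ->
  opbd (uconj u x) r.
Proof.
move=> r0 uu xr; rewrite -[r]mulr1 -[r]mul1r /uconj; apply: opbdM; rewrite ?mul1r//.
  by rewrite -[r]mul1r; apply: opbdM => //; exact: opbd_unitary.
by apply: opbd_unitary; exact: unitary_adj.
Qed.

End OperatorBounds.

Section Tuples.
Context {R : realType}.
Local Notation C := R[i].
Variables (n k : nat).
Implicit Types x y z : mxtuple (R := R) n k.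

Definition herm_tuple x := forall i, x i \is hermsymmx.

(** For self-adjoint tuples this is the square of [norm2], whose definition by traces of squares
    does not display a sum of squares; the triangle inequality goes through it. *)
Definition frobenius2 x : R :=
  \sum_(p : 'I_n * 'I_k * 'I_k) cabs (x p.1.1 p.1.2 p.2) ^+ 2.

Lemma herm_entry (a : 'M[C]_k) : a \is hermsymmx -> forall i j, a i j = conjc (a j i).
Proof. by move=> /hermP h i j; rewrite -[in LHS]h !mxE. Qed.

Lemma eq_norm2 x y : (forall i, \tr (x i *m x i) = \tr (y i *m y i)) -> norm2 x = norm2 y.
Proof. by move=> xy; rewrite /norm2 /normalized_trace; under eq_bigr do rewrite xy. Qed.

Lemma norm2_herm x : (0 < k)%N -> herm_tuple x -> norm2 x = Num.sqrt (frobenius2 x).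
Proof.
move=> k0 hx; rewrite /norm2; congr Num.sqrt.
have kn0 : (k%:R : C) != 0 by rewrite pnatr_eq0 -lt0n.
have ReD : {morph (@complex.Re R) : y z / y + z} by move=> [? ?] [? ?].
transitivity (\sum_i \sum_j \sum_l cabs (x i j l) ^+ 2); last first.
  by rewrite pair_big pair_big; apply: eq_bigr => -[[i j] l].
apply: eq_bigr => i _; rewrite /normalized_trace mulrCA divff// mulr1 /mxtrace.
rewrite (big_morph _ ReD (erefl _)); apply: eq_bigr => j _.
rewrite mxE (big_morph _ ReD (erefl _)); apply: eq_bigr => l _.
by rewrite [x i l j]herm_entry// -cabs_sqr.
Qed.

Lemma norm2_ge0 x : 0 <= norm2 x. Proof. exact: sqrtr_ge0. Qed.

Lemma herm_tupleD x y : herm_tuple x -> herm_tuple y -> herm_tuple (fun i => x i + y i).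
Proof.
move=> hx hy i; apply/hermP/matrixP => a b; rewrite !mxE rmorphD /=.
by rewrite -!herm_entry.
Qed.

Lemma herm_tupleZ (c : R) x : herm_tuple x -> herm_tuple (fun i => (c%:C)%C *: x i).
Proof.
move=> hx i; apply/hermP/matrixP => a b; rewrite !mxE rmorphM /= oppr0.
by rewrite -!herm_entry.
Qed.

Lemma herm_tupleB x y : herm_tuple x -> herm_tuple y -> herm_tuple (fun i => x i - y i).
Proof.
move=> hx hy i; apply/hermP/matrixP => a b; rewrite !mxE rmorphB /=.
by rewrite -!herm_entry.
Qed.

Lemma norm2D x y : (0 < k)%N -> herm_tuple x -> herm_tuple y ->
  norm2 (fun i => x i + y i) <= norm2 x + norm2 y.
Proof.
move=> k0 hx hy; rewrite (norm2_herm k0 (herm_tupleD hx hy)) (norm2_herm k0 hx) (norm2_herm k0 hy).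
apply: le_trans (minkowski_sum _ _); apply: ler_wsqrtr; apply: ler_sum => p _.
by rewrite mxE lerXn2r ?nnegrE ?cabs_ge0 ?cabsD// addr_ge0 ?cabs_ge0.
Qed.

Lemma norm2Z (c : R) x : (0 < k)%N -> herm_tuple x ->
  norm2 (fun i => (c%:C)%C *: x i) = `|c| * norm2 x.
Proof.
move=> k0 hx; rewrite (norm2_herm k0 (herm_tupleZ c hx)) (norm2_herm k0 hx).
rewrite -sqrtr_sqr -sqrtrM ?sqr_ge0//; congr Num.sqrt; rewrite /frobenius2 mulr_sumr.
by apply: eq_bigr => p _; rewrite mxE cabsM exprMn cabs_real real_normK ?num_real.
Qed.

Lemma norm2BC x y : norm2 (fun i => x i - y i) = norm2 (fun i => y i - x i).
Proof.
by apply: eq_norm2 => i; rewrite -(opprB (y i)) mulNmx mulmxN opprK.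
Qed.

Lemma rhoC x y : rho x y = rho y x.
Proof. by rewrite /rho norm2BC. Qed.

Lemma rho_self x : rho x x = 0.
Proof.
rewrite /rho /norm2 big1 ?sqrtr0 ?mul0r// => i _.
by rewrite subrr mul0mx /normalized_trace mxtrace0 mul0r mulr0.
Qed.

Lemma rho_triangle y x z : (0 < k)%N -> herm_tuple x -> herm_tuple y -> herm_tuple z ->
  rho x z <= rho x y + rho y z.
Proof.
move=> k0 hx hy hz; rewrite /rho -mulrDl ler_pM2r ?invr_gt0 ?sqrtr_gt0 ?ltr0n//.
have := norm2D k0 (herm_tupleB hx hy) (herm_tupleB hy hz).
by under eq_fun do rewrite addrA subrK.
Qed.

Lemma norm2_rho x y : (0 < k)%N -> norm2 (fun i => x i - y i) = Num.sqrt k%:R * rho x y.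
Proof. by move=> k0; rewrite /rho mulrC divfK// sqrtr_eq0 -ltNge ltr0n. Qed.

Definition conj_tuple (u : 'M[C]_k) x : mxtuple n k := fun i => uconj u (x i).

Lemma herm_conj_tuple u x : herm_tuple x -> herm_tuple (conj_tuple u x).
Proof.
move=> hx i; apply/hermP; rewrite /conj_tuple /uconj !adjM adjK mulmxA.
by rewrite (proj1 (hermP (x i)) (hx i)).
Qed.

Lemma uconjK u (a : 'M[C]_k) : unitary u -> uconj (adj u) (uconj u a) = a.
Proof.
move=> uu; rewrite /uconj adjK !mulmxA unitaryV// mul1mx -mulmxA.
by rewrite unitaryV// mulmx1.
Qed.

Lemma uconjKV u (a : 'M[C]_k) : unitary u -> uconj u (uconj (adj u) a) = a.
Proof. by move=> uu; rewrite -[u in uconj u]adjK uconjK//; exact: unitary_adj. Qed.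

Lemma uconjM u (a b : 'M[C]_k) : unitary u -> uconj u (a *m b) = uconj u a *m uconj u b.
Proof.
move=> uu; rewrite /uconj !mulmxA; congr (_ *m _); congr (_ *m _).
by rewrite -[u *m a *m _ *m _]mulmxA unitaryV// mulmx1.
Qed.

Lemma uconjB u (a b : 'M[C]_k) : uconj u (a - b) = uconj u a - uconj u b.
Proof. by rewrite /uconj mulmxBr mulmxBl. Qed.

Lemma trace_uconj u (a : 'M[C]_k) : unitary u -> \tr (uconj u a) = \tr a.
Proof. by move=> uu; rewrite /uconj mxtrace_mulC mulmxA unitaryV// mul1mx. Qed.

Lemma norm2_conj_tuple u x y : unitary u ->
  norm2 (fun i => conj_tuple u x i - conj_tuple u y i) = norm2 (fun i => x i - y i).
Proof.
move=> uu; apply: eq_norm2 => i; rewrite /conj_tuple.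
have -> : uconj u (x i) - uconj u (y i) = uconj u (x i - y i) by rewrite uconjB.
by rewrite -(uconjM _ _ uu) trace_uconj.
Qed.

Local Notation coord := ('I_n * 'I_k * 'I_k -> R).

Lemma sa_coordP (u v : coord) (c : R) i :
  sa_coord (fun p => u p + c * v p) i = sa_coord u i + (c%:C)%C *: sa_coord v i.
Proof.
apply/matrixP => j l; rewrite !mxE.
case: ifP => _; first by simpc.
by case: ifP => _; apply/eqP; rewrite eq_complex /=; apply/andP; split; apply/eqP; ring.
Qed.

Lemma sa_coordB (u v : coord) i :
  sa_coord (fun p => u p - v p) i = sa_coord u i - sa_coord v i.
Proof.
rewrite -scaleN1r -[-1 in RHS](rmorphN1 (real_complex R)) -sa_coordP; congr (sa_coord _ _).
by apply/funext => p; rewrite mulN1r.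
Qed.

Lemma sum_coordB (u v : coord) : (0 < k)%N ->
  \sum_p (u p - v p) ^+ 2 = norm2 (fun i => sa_coord u i - sa_coord v i) ^+ 2.
Proof.
move=> k0; rewrite -(norm2_sa_coord (fun p => u p - v p) k0).
have -> // : sa_coord (fun p => u p - v p) = (fun i => sa_coord u i - sa_coord v i).
by apply/funext => i; exact: sa_coordB.
Qed.

Lemma herm_sa_coord (u : coord) : herm_tuple (sa_coord u).
Proof. by move=> i; exact: sa_coord_herm. Qed.

End Tuples.

Section Vol.
Context {R : realType}.
Local Notation C := R[i].
Variables (n k : nat).
Hypothesis k0 : (0 < k)%N.
Implicit Types x y z : mxtuple (R := R) n k.
Implicit Types A B : set (mxtuple (R := R) n k).
Local Notation coord := ('I_n * 'I_k * 'I_k)%type.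
Local Notation d := (n * k * k)%N.

Lemma card_coord : #|{: coord}| = d.
Proof. by rewrite !card_prod !card_ord. Qed.

Lemma vol_ge0 A : (0 <= vol A)%E. Proof. exact: lebesgue_outer_ge0. Qed.

Lemma le_vol A B : (forall x, herm_tuple x -> A x -> B x) -> (vol A <= vol B)%E.
Proof.
by move=> AB; apply: le_lebesgue_outer => u; apply: AB => i; exact: sa_coord_herm.
Qed.

Lemma vol_bigcup (K : finType) (P : pred K) (A : K -> set (mxtuple (R := R) n k)) :
  (vol (\bigcup_(s in [set` P]) A s) <= \sum_(s | P s) vol (A s))%E.
Proof.
apply: le_trans (outer_like_bigcup P _ (outer_like_lebesgue_outer _)).
exact: le_lebesgue_outer.
Qed.

(** If all [d] coordinates differed by at most [e / (d + 1)], the squared distance would be at most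
    [d * e ^ 2 / (d + 1) ^ 2 < e ^ 2]. So separation in [norm2] implies separation in some
    coordinate. *)
Lemma vol_separated (K : finType) (A : K -> set (mxtuple (R := R) n k)) (e : R) :
  0 < e ->
  (forall s t x y, s != t -> herm_tuple x -> herm_tuple y -> A s x -> A t y ->
    e <= norm2 (fun i => x i - y i)) ->
  (\sum_s vol (A s) <= vol (\bigcup_s A s))%E.
Proof.
move=> e0 sep; have e1 : 0 < e / (d.+1)%:R by rewrite divr_gt0.
apply: le_trans (lebesgue_outer_separated e1 _) _; last first.
  by apply: le_lebesgue_outer => u [s _ h]; exists s.
move=> s t u v st Au Bv; have := sep _ _ _ _ st (herm_sa_coord u) (herm_sa_coord v) Au Bv.
move=> h; apply/not_existsP => no.
have : norm2 (fun i => sa_coord u i - sa_coord v i) ^+ 2 < e ^+ 2.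
  rewrite -sum_coordB//.
  apply: (@le_lt_trans _ _ (\sum_(p : coord) (e / d.+1%:R) ^+ 2)).
    apply: ler_sum => p _; rewrite -[X in X <= _]real_normK ?num_real//.
    rewrite lerXn2r ?nnegrE// ?(ltW e1)//.
    by rewrite leNgt; apply/negP; exact: no.
  have e2 : 0 < e ^+ 2 by rewrite exprn_gt0.
  have dd : d%:R < d.+1%:R ^+ 2 :> R.
    by rewrite -natrX ltr_nat expnS expn1; exact: leq_pmulr.
  have -> : \sum_(p : coord) (e / d.+1%:R) ^+ 2 = e ^+ 2 * (d%:R / d.+1%:R ^+ 2).
    by rewrite sumr_const card_coord expr_div_n -[LHS]mulr_natr; ring.
  rewrite -[X in _ < X]mulr1 (ltr_pM2l e2).
  by rewrite ltr_pdivrMr ?exprn_gt0// mul1r.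
by rewrite ltNge lerXn2r ?nnegrE ?norm2_ge0// ltW.
Qed.

Lemma vol_ball x (s : R) : herm_tuple x -> 0 < s ->
  (vol [set y | norm2 (fun i => y i - x i)%R ^+ 2 <= d%:R * s ^+ 2]%R <=
    ((8 * s) ^+ d)%:E)%E.
Proof.
move=> hx s0; have [c cx] := sa_coord_onto hx.
have := lebesgue_outer_ball c s0; rewrite card_coord; apply: le_trans.
apply: le_lebesgue_outer => u ux.
have : norm2 (fun i => sa_coord u i - x i) ^+ 2 <= d%:R * s ^+ 2 by exact: ux.
by rewrite -cx -(sum_coordB _ _ k0).
Qed.

(* A conjugated cube lies in a ball of radius [s * sqrt d]. *)
Lemma vol_conj (u : 'M[C]_k) A : unitary u ->
  (vol [set x | A (conj_tuple u x)] <= (8 ^+ d)%:E * vol A)%E.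
Proof.
move=> uu.
have /choice[T TP] : forall v, exists w, sa_coord w = conj_tuple u (sa_coord v) :> mxtuple (R := R) n k.
  by move=> v; apply: sa_coord_onto; exact/herm_conj_tuple/herm_sa_coord.
have := @outer_like_le _ _ _ (8 ^+ d) 1 [set v | A (sa_coord v)] (outer_like_preimage T).
rewrite exprn_gt0// => /(_ isT ltr01) h; apply: le_trans (h _).
  by apply: le_lebesgue_outer => v /=; rewrite TP.
move=> c s /andP[s0 _]; rewrite card_coord -exprMn.
have [c' c'E] := sa_coord_onto (herm_conj_tuple (adj u) (herm_sa_coord c)).
apply: le_trans (vol_ball (herm_sa_coord c') s0).
apply: le_lebesgue_outer => v cTv /=.
rewrite -(norm2_conj_tuple _ _ uu) -TP c'E.
have -> : (fun i => sa_coord (T v) i - conj_tuple u (conj_tuple (adj u) (sa_coord c)) i) =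
  (fun i => sa_coord (T v) i - sa_coord c i).
  by apply/funext => i; rewrite /conj_tuple uconjKV.
rewrite -sum_coordB// mulr_natl -card_coord -sumr_const; apply: ler_sum => p _.
have /andP[h1 h2] := cTv p.
by rewrite lerXn2r ?nnegrE ?subr_ge0// ?lerBlDl// ltW.
Qed.

(** The preimage of a cube of side [s] under the affine map lies in a cube of side [s / e]. *)
Lemma vol_affine x (e : R) A : herm_tuple x -> 0 < e ->
  (vol [set y | A (fun i => x i + (e%:C)%C *: y i)%R] <= (e^-1 ^+ d)%:E * vol A)%E.
Proof.
move=> hx e0; have [c cx] := sa_coord_onto hx.
pose T (v : coord -> R) p := c p + e * v p.
have := @outer_like_le _ _ _ (e^-1 ^+ d) 1 [set v | A (sa_coord v)] (outer_like_preimage T).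
rewrite exprn_gt0 ?invr_gt0// => /(_ isT ltr01) h; apply: le_trans (h _).
  apply: le_lebesgue_outer => v /=; rewrite -cx.
  by have -> : (fun i => sa_coord c i + (e%:C)%C *: sa_coord v i) = sa_coord (T v);
    [apply/funext => i; rewrite sa_coordP|].
move=> b s /andP[s0 _]; rewrite card_coord -exprMn -card_coord.
apply: le_trans (lebesgue_outer_cube (fun p => (b p - c p) / e) _); last first.
  by rewrite mulr_ge0 ?invr_ge0 ?ltW.
apply: le_lebesgue_outer => v bv p; have /andP[h1 h2] := bv p.
rewrite /T in h1 h2; apply/andP; split; first by rewrite ler_pdivrMr//; lra.
have -> : (b p - c p) / e + e^-1 * s = (b p - c p + s) / e by ring.
by rewrite ler_pdivlMr//; lra.
Qed.

End Vol.

(** * Nearly invariant averages over unitaries *)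

Section ApproximateHaar.
Context {R : realType} (k : nat).
Local Notation C := R[i].
Local Notation U := 'M[C]_k.
Implicit Types (g u v : U) (us : seq U).

(** The family [e] maps [u] to the vector of all [e s u]. Invariance of its Gram kernel says that
    left translations act isometrically on the span of these vectors, without naming the action. *)
Definition inv_features (S : finType) (e : S -> U -> C) := forall g u v,
  unitary g ->
  \sum_s conjc (e s (g *m u)) * e s (g *m v) = \sum_s conjc (e s u) * e s v.

Definition spanned (S : finType) (e : S -> U -> C) (f : U -> C) :=
  exists c : S -> C, forall u, f u = \sum_s c s * e s u.

(** Linear functionals of invariant feature maps. They contain the matrix entries and are closed
    under conjugation, sums and products, hence contain the polynomials in the entries and their
    conjugates. *)
Definition polyfun (f : U -> C) :=
  exists (S : finType) (e : S -> U -> C), inv_features e /\ spanned e f.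

Lemma polyfun_cst c : polyfun (fun=> c).
Proof.
exists unit, (fun _ _ => 1); split; first by [].
by exists (fun=> c) => u; rewrite (big_pred1 tt) ?mulr1// => -[].
Qed.

Lemma polyfun_entry i j : polyfun (fun u => u i j).
Proof.
exists ('I_k * 'I_k)%type, (fun p u => u p.1 p.2); split; last first.
  exists (fun p => (p == (i, j))%:R) => u.
  by rewrite (bigD1 (i, j))//= eqxx mul1r big1 ?addr0// => p /negbTE ->; rewrite mul0r.
have kernelE u v : \sum_(p : 'I_k * 'I_k) conjc (u p.1 p.2) * v p.1 p.2 = \tr (adj u *m v).
  rewrite -(pair_bigA _ (fun i j => conjc (u i j) * v i j)) exchange_big /=.
  by apply: eq_bigr => a _; rewrite mxE; apply: eq_bigr => b _; rewrite !mxE.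
move=> g u v gg; rewrite !kernelE adjM -mulmxA (mulmxA (adj g)) unitaryV//.
by rewrite mul1mx.
Qed.

Lemma polyfunJ f : polyfun f -> polyfun (fun u => conjc (f u)).
Proof.
move=> [S [e [einv [c fE]]]]; exists S, (fun s u => conjc (e s u)); split.
  move=> g u v gg; have := einv g v u gg.
  have E (a b : S -> C) : \sum_s conjc (conjc (a s)) * conjc (b s) = \sum_s conjc (b s) * a s.
    by apply: eq_bigr => s _; rewrite conjcK mulrC.
  by rewrite (E (e^~ _) (e^~ _)) (E (e^~ _) (e^~ _)).
exists (fun s => conjc (c s)) => u; rewrite fE rmorph_sum.
by apply: eq_bigr => s _; rewrite rmorphM.
Qed.

Definition sum_features (S T : finType) (e : S -> U -> C) (e' : T -> U -> C) (p : S + T) :=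
  match p with inl s => e s | inr t => e' t end.

Lemma inv_sum_features (S T : finType) (e : S -> U -> C) (e' : T -> U -> C) :
  inv_features e -> inv_features e' -> inv_features (sum_features e e').
Proof. by move=> einv einv' g u v gg; rewrite !big_sumType /= einv// einv'. Qed.

Lemma spanned_inl (S T : finType) (e : S -> U -> C) (e' : T -> U -> C) f :
  spanned e f -> spanned (sum_features e e') f.
Proof.
move=> [c fE]; exists (fun p => if p is inl s then c s else 0) => u.
by rewrite big_sumType /= -fE [X in _ + X]big1 ?addr0// => t _; rewrite mul0r.
Qed.

Lemma spanned_inr (S T : finType) (e : S -> U -> C) (e' : T -> U -> C) f :
  spanned e' f -> spanned (sum_features e e') f.
Proof.
move=> [c fE]; exists (fun p => if p is inr t then c t else 0) => u.
by rewrite big_sumType /= -fE big1 ?add0r// => t _; rewrite mul0r.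
Qed.

Lemma spannedD (S : finType) (e : S -> U -> C) f f' :
  spanned e f -> spanned e f' -> spanned e (fun u => f u + f' u).
Proof.
move=> [c fE] [c' fE']; exists (fun s => c s + c' s) => u.
by rewrite fE fE' -big_split; apply: eq_bigr => s _; rewrite mulrDl.
Qed.

Lemma polyfunD f f' : polyfun f -> polyfun f' -> polyfun (fun u => f u + f' u).
Proof.
move=> [S [e [einv fe]]] [T [e' [einv' fe']]].
exists (S + T)%type, (sum_features e e'); split; first exact: inv_sum_features.
by apply: spannedD; [exact: spanned_inl|exact: spanned_inr].
Qed.

(** The kernel of a tensor product of feature maps is the product of the kernels, just as that of a
    direct sum is the sum. *)
Lemma polyfunM f f' : polyfun f -> polyfun f' -> polyfun (fun u => f u * f' u).
Proof.
move=> [S [e [einv [c fE]]]] [T [e' [einv' [c' fE']]]].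
exists (S * T)%type, (fun p u => e p.1 u * e' p.2 u); split.
  have kE u v : \sum_(p : S * T) conjc (e p.1 u * e' p.2 u) * (e p.1 v * e' p.2 v) =
      (\sum_s conjc (e s u) * e s v) * (\sum_s conjc (e' s u) * e' s v).
    rewrite mulr_suml -(pair_bigA _ (fun s t => conjc (e s u * e' t u) * (e s v * e' t v))).
    apply: eq_bigr => s _; rewrite mulr_sumr; apply: eq_bigr => t _ /=.
    by rewrite rmorphM mulrACA.
  by move=> g u v gg; rewrite !kE einv// einv'.
exists (fun p => c p.1 * c' p.2) => u; rewrite fE fE' mulr_suml.
rewrite -(pair_bigA _ (fun s t => c s * c' t * (e s u * e' t u))).
by apply: eq_bigr => s _; rewrite mulr_sumr; apply: eq_bigr => t _; rewrite /= mulrACA.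
Qed.

Lemma common_features (J : eqType) (F : J -> U -> C) (r : seq J) :
  (forall j, polyfun (F j)) -> exists (S : finType) (e : S -> U -> C),
  inv_features e /\ forall j, j \in r -> spanned e (F j).
Proof.
move=> FP; elim: r => [|j r [S [e [einv eP]]]].
  exists unit, (fun _ _ => 1); split => // j.
have [T [e' [einv' eP']]] := FP j.
exists (T + S)%type, (sum_features e' e); split; first exact: inv_sum_features.
move=> l; rewrite inE => /predU1P[->|lr]; first exact: spanned_inl.
by apply: spanned_inr; exact: eP.
Qed.

Definition avg us (f : U -> C) : C := (size us)%:R^-1 * \sum_(u <- us) f u.

Lemma avgD us f f' : avg us (fun u => f u + f' u) = avg us f + avg us f'.
Proof. by rewrite /avg big_split mulrDr. Qed.

Lemma avgZ us c f : avg us (fun u => c * f u) = c * avg us f.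
Proof. by rewrite /avg -mulr_sumr mulrCA. Qed.

Lemma avg_sum us (T : Type) (r : seq T) (F : T -> U -> C) :
  avg us (fun u => \sum_(t <- r) F t u) = \sum_(t <- r) avg us (F t).
Proof. by rewrite /avg exchange_big -mulr_sumr. Qed.

Lemma avg_le us f (K : R) : 0 <= K -> (forall u, u \in us -> cabs (f u) <= K) ->
  cabs (avg us f) <= K.
Proof.
move=> K0 fK; rewrite /avg cabsM cabsV cabs_nat.
have [s0|s0] := posnP (size us); first by rewrite s0 invr0 mul0r.
rewrite mulrC ler_pdivrMr ?ltr0n//; apply: le_trans (cabs_sum _ _ _) _.
apply: (@le_trans _ _ (\sum_(u <- us) K)).
  by rewrite big_seq [leRHS]big_seq; exact: ler_sum.
by rewrite big_const_seq count_predT iter_addr_0 mulr_natr.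
Qed.

Lemma cabs_ReIm (z : C) : cabs z ^+ 2 = complex.Re z ^+ 2 + complex.Im z ^+ 2.
Proof. by apply: complexI; rewrite add_Re2_Im2 cabsE -rmorphXn. Qed.

Lemma parallelogram (z w : C) :
  cabs (z - w) ^+ 2 + cabs (z + w) ^+ 2 = 2 * cabs z ^+ 2 + 2 * cabs w ^+ 2.
Proof. by rewrite !cabs_ReIm; case: z w => [a b] [c d] /=; ring. Qed.

Definition energy (S : finType) (e : S -> U -> C) us : R :=
  \sum_s cabs (avg us (e s)) ^+ 2.

Lemma energy_translate (S : finType) (e : S -> U -> C) g us : inv_features e ->
  unitary g -> energy e (map (mulmx g) us) = energy e us.
Proof.
move=> einv gg; apply: complexI.
have E vs : ((energy e vs)%:C)%C = ((size vs)%:R^-1 ^+ 2) *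
    \sum_(u <- vs) \sum_(v <- vs) \sum_s conjc (e s u) * e s v.
  rewrite rmorph_sum /=; under eq_bigr do rewrite cabs_sqr.
  transitivity (\sum_s (size vs)%:R^-1 ^+ 2 * (\sum_(u <- vs) \sum_(v <- vs) conjc (e s u) * e s v)).
    apply: eq_bigr => s _; rewrite /avg rmorphM fmorphV /= conjc_nat rmorph_sum /=.
    rewrite mulrACA -expr2; congr (_ * _).
    by rewrite mulrC mulr_suml; apply: eq_bigr => u _; rewrite mulr_sumr.
  rewrite -mulr_sumr; congr (_ * _); rewrite exchange_big; apply: eq_bigr => u _.
  by rewrite exchange_big.
rewrite !E size_map big_map; congr (_ * _); apply: eq_bigr => u _.
by rewrite big_map; apply: eq_bigr => v _; exact: einv.
Qed.

(* A near-minimiser [us] of the energy is nearly invariant: by the parallelogram law the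
   concatenation of [us] and its translate would otherwise have much smaller energy. *)
Lemma approx_invariant (J : finType) (F : J -> U -> C) (del : R) :
  (forall j, polyfun (F j)) -> 0 < del ->
  exists us, [/\ us <> [::], forall u, u \in us -> unitary u &
    forall j g, unitary g ->
      cabs (avg us (fun u => F j (g *m u)) - avg us (F j)) <= del].
Proof.
move=> FP d0; have [S [e [einv eP]]] := common_features (index_enum J) FP.
have /choice[c cP] : forall j, exists c : S -> C, forall u, F j u = \sum_s c s * e s u.
  by move=> j; apply: eP; rewrite mem_index_enum.
pose B := \sum_j \sum_s cabs (c j s).
have B0 : 0 <= B by apply: sumr_ge0 => j _; apply: sumr_ge0 => s _; exact: cabs_ge0.
(* Each feature will move by at most [2 * r], and [B] bounds the sum of the coefficients, so the
   total is at most [del]; the [+ 1] keeps the denominator positive. *)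
pose r := del / (2 * (B + 1)); have r0 : 0 < r by rewrite divr_gt0// mulr_gt0// ltr_wpDl.
pose good us := us <> [::] /\ forall u, u \in us -> unitary u.
pose E := [set energy e us | us in good].
have hE : has_inf E.
  split; last by exists 0 => _ [us _ <-]; apply: sumr_ge0 => s _; exact: sqr_ge0.
  exists (energy e [:: 1%:M]); exists [:: 1%:M] => //; split => // u.
  by rewrite inE => /eqP ->; exact: unitary1.
have [_ [us [us0 usU] <-] lt] := inf_adherent (exprn_gt0 2 r0) hE.
exists us; split => // j g gg.
pose w s := avg us (e s); pose w' s := avg us (fun u => e s (g *m u)).
have w'E s : w' s = avg (map (mulmx g) us) (e s) by rewrite /w' /avg size_map big_map.
have e' : energy e (map (mulmx g) us) = energy e us by exact: energy_translate.
have ge : inf E <= energy e (us ++ map (mulmx g) us).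
  apply: ge_inf; first exact: hE.2.
  exists (us ++ map (mulmx g) us) => //; split; first by case: (us) us0.
  move=> u; rewrite mem_cat => /orP[/usU//|/mapP[v /usU vv ->]].
  exact: unitaryM.
have catE s : avg (us ++ map (mulmx g) us) (e s) = 2^-1 * (w s + w' s).
  rewrite w'E /w /avg size_cat size_map addnn -mul2n natrM invfM big_cat /=.
  by rewrite mulrDr mulrDr !mulrA.
(* The left side is [4 * energy us] minus 4 times the energy of the concatenation. The former
   exceeds [4 * inf E] by less than [4 * r ^ 2], and the latter is at least [4 * inf E]. *)
have sumd : \sum_s cabs (w' s - w s) ^+ 2 <= (2 * r) ^+ 2.
  have : \sum_s cabs (w' s - w s) ^+ 2 + 4 * energy e (us ++ map (mulmx g) us) =
      2 * energy e us + 2 * energy e us.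
    rewrite -{2}e' /energy !mulr_sumr -!big_split; apply: eq_bigr => s _ /=.
    rewrite catE cabsM exprMn cabsV (cabs_nat 2) -w'E -/(w s) exprVn mulrA.
    have -> : 4 * (2 ^+ 2)^-1 = 1 :> R by rewrite -natrX divff.
    by rewrite mul1r [w s + _]addrC parallelogram addrC.
  rewrite exprMn; move: lt ge; set x := r ^+ 2; lra.
have wd s : cabs (w' s - w s) <= 2 * r.
  have r2 : 0 <= 2 * r by rewrite mulr_ge0// ltW.
  rewrite -(@ler_pXn2r _ 2)// ?nnegrE ?cabs_ge0//.
  apply: le_trans sumd; rewrite (bigD1 s)//= lerDl sumr_ge0// => t _; exact: sqr_ge0.
have FE : avg us (fun u => F j (g *m u)) - avg us (F j) = \sum_s c j s * (w' s - w s).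
  have aE h : avg us (fun u => F j (h u)) = \sum_s c j s * avg us (fun u => e s (h u)).
    rewrite (_ : (fun u => _) = fun u => \sum_s c j s * e s (h u)).
      by rewrite avg_sum; apply: eq_bigr => s _; rewrite avgZ.
    by apply/funext => u; exact: cP.
  rewrite (aE (mulmx g)) (aE id) -sumrB; apply: eq_bigr => s _.
  by rewrite mulrBr.
rewrite FE; apply: le_trans (cabs_sum _ _ _) _.
apply: (@le_trans _ _ (\sum_s cabs (c j s) * (2 * r))).
  by apply: ler_sum => s _; rewrite cabsM ler_wpM2l// cabs_ge0.
rewrite -mulr_suml; apply: (@le_trans _ _ (B * (2 * r))).
  apply: ler_wpM2r; first by rewrite mulr_ge0// ltW.
  rewrite /B [leRHS](bigD1 j)//= lerDl.
  by apply: sumr_ge0 => l _; apply: sumr_ge0 => s _; exact: cabs_ge0.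
rewrite /r; have -> : B * (2 * (del / (2 * (B + 1)))) = del * (B / (B + 1)).
  by field; rewrite gt_eqF// ltr_wpDl.
by rewrite -[leRHS]mulr1 ler_pM2l// ler_pdivrMr ?ltr_wpDl// mul1r lerDl.
Qed.

End ApproximateHaar.

(** * Derivatives along curves of unitaries *)

Section Derivatives.
Context {R : realType} (k : nat).
Local Notation C := R[i].
Local Notation U := 'M[C]_k.

(** A curve through the identity with velocity [A]. A quadratic remainder on the whole of [[0, 1]]
    stands for differentiability, so that only inequalities are manipulated. *)
Definition curve_at (A : U) (g : R -> U) := exists K : R, forall s, 0 <= s <= 1 ->
  unitary (g s) /\ forall i j, cabs ((g s - 1%:M - (s%:C)%C *: A) i j) <= K * s ^+ 2.

Definition bounded_on_unitary (F : U -> C) (K : R) := forall u, unitary u -> cabs (F u) <= K.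

(** The remainder is uniform in the base point [u], so it survives averaging over a list of any
    length; the bounds on [F] and [F'] are what the product rule consumes. *)
Record derivative_along (g : R -> U) (F F' : U -> C) : Prop := DerivativeAlong {
  da_poly : polyfun F;
  da_bd : exists K, bounded_on_unitary F K /\ bounded_on_unitary F' K;
  da_diff : exists K, forall u s, unitary u -> 0 <= s <= 1 ->
    cabs (F (g s *m u) - F u - (s%:C)%C * F' u) <= K * s ^+ 2 }.

Variables (A : U) (g : R -> U).
Hypothesis gA : curve_at A g.

Lemma curve_unitary s : 0 <= s <= 1 -> unitary (g s).
Proof. by case: gA => K gK /gK[]. Qed.

Lemma derivative_cst c : derivative_along g (fun=> c) (fun=> 0).
Proof.
split; first exact: polyfun_cst.
  by exists (cabs c); split => u _ //; rewrite cabs0 cabs_ge0.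
by exists 0 => u s _ _; rewrite subrr mulr0 subr0 cabs0 mul0r.
Qed.

Lemma unitary_entry_le1 (u : U) i j : unitary u -> cabs (u i j) <= 1.
Proof. by move=> /opbd_unitary; exact: opbd_entry. Qed.

Lemma derivative_entry i j : derivative_along g (fun u => u i j) (fun u => (A *m u) i j).
Proof.
split; first exact: polyfun_entry.
  exists (1 + \sum_l cabs (A i l)); have S0 : 0 <= \sum_l cabs (A i l).
    by apply: sumr_ge0 => l _; exact: cabs_ge0.
  split=> u uu; first by rewrite (le_trans (unitary_entry_le1 _ _ uu))// lerDl.
  rewrite mxE (le_trans (cabs_sum _ _ _))//; apply: (@le_trans _ _ (\sum_l cabs (A i l))).
    by apply: ler_sum => l _; rewrite cabsM ler_piMr ?cabs_ge0 ?unitary_entry_le1.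
  by rewrite lerDr.
case: gA => K gK; exists (\sum_(l < k) K) => u s uu s01.
have [_ gs] := gK s s01.
have -> : (g s *m u) i j - u i j - (s%:C)%C * (A *m u) i j =
    ((g s - 1%:M - (s%:C)%C *: A) *m u) i j.
  by rewrite !mulmxBl mul1mx -scalemxAl !mxE.
rewrite mxE (le_trans (cabs_sum _ _ _))// mulr_suml; apply: ler_sum => l _.
by rewrite cabsM -[leRHS]mulr1 ler_pM ?cabs_ge0 ?unitary_entry_le1.
Qed.

Lemma derivativeJ F F' : derivative_along g F F' ->
  derivative_along g (fun u => conjc (F u)) (fun u => conjc (F' u)).
Proof.
move=> [pF [K [FK F'K]] [L FL]]; split; first exact: polyfunJ.
  by exists K; split=> u uu; rewrite cabsJ; [exact: FK|exact: F'K].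
exists L => u s uu s01; have := FL u s uu s01; rewrite -cabsJ !rmorphB rmorphM /=.
by rewrite oppr0.
Qed.

Lemma derivativeD F F' G G' : derivative_along g F F' -> derivative_along g G G' ->
  derivative_along g (fun u => F u + G u) (fun u => F' u + G' u).
Proof.
move=> [pF [K [FK F'K]] [L FL]] [pG [K2 [GK G'K]] [L2 GL]]; split; first exact: polyfunD.
  exists (K + K2); split=> u uu; apply: le_trans (cabsD _ _) _; apply: lerD;
  by [exact: FK|exact: GK|exact: F'K|exact: G'K].
exists (L + L2) => u s uu s01.
have -> : F (g s *m u) + G (g s *m u) - (F u + G u) - (s%:C)%C * (F' u + G' u) =
  (F (g s *m u) - F u - (s%:C)%C * F' u) + (G (g s *m u) - G u - (s%:C)%C * G' u) by ring.
by apply: le_trans (cabsD _ _) _; rewrite mulrDl lerD ?FL ?GL.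
Qed.

Lemma derivative_sum (T : Type) (r : seq T) (F F' : T -> U -> C) :
  (forall t, derivative_along g (F t) (F' t)) ->
  derivative_along g (fun u => \sum_(t <- r) F t u) (fun u => \sum_(t <- r) F' t u).
Proof.
move=> FP; elim: r => [|t r IH].
  by under eq_fun do rewrite big_nil; under [X in derivative_along _ _ X]eq_fun do rewrite big_nil;
    exact: derivative_cst.
under eq_fun do rewrite big_cons; under [X in derivative_along _ _ X]eq_fun do rewrite big_cons.
exact: derivativeD.
Qed.

Lemma derivativeM F F' G G' : derivative_along g F F' -> derivative_along g G G' ->
  derivative_along g (fun u => F u * G u) (fun u => F' u * G u + F u * G' u).
Proof.
move=> [pF [K [FK F'K]] [L FL]] [pG [K2 [GK G'K]] [L2 GL]]; split; first exact: polyfunM.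
  exists (`|K * K2| + `|K * K2|); split=> u uu.
    rewrite cabsM; apply: le_trans (ler_pM (cabs_ge0 _) (cabs_ge0 _) (FK _ uu) (GK _ uu)) _.
    by rewrite (le_trans (ler_norm _))// lerDl.
  apply: le_trans (cabsD _ _) _; apply: lerD; rewrite cabsM; apply: le_trans (ler_norm _);
  by apply: ler_pM; rewrite ?cabs_ge0 ?FK ?GK ?F'K ?G'K.
exists (L * K2 + K * L2 + K * (K2 + `|L2|)) => u s uu s01.
have gu : unitary (g s *m u) by apply: unitaryM => //; exact: curve_unitary.
have hF := FL u s uu s01; have hG := GL u s uu s01; have /andP[s0 s1] := s01.
have hs : cabs (s%:C)%C = s by rewrite cabs_real ger0_norm.
(* The three terms account for the three summands of the constant: the remainder of [F], the
   remainder of [G], and the first-order change of [G] against [F']. *)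
have -> : F (g s *m u) * G (g s *m u) - F u * G u - (s%:C)%C * (F' u * G u + F u * G' u) =
    (F (g s *m u) - F u - (s%:C)%C * F' u) * G (g s *m u)
    + F u * (G (g s *m u) - G u - (s%:C)%C * G' u)
    + (s%:C)%C * (F' u * (G (g s *m u) - G u)) by ring.
have dG : cabs (G (g s *m u) - G u) <= s * (K2 + `|L2|).
  have -> : G (g s *m u) - G u =
    (G (g s *m u) - G u - (s%:C)%C * G' u) + (s%:C)%C * G' u by ring.
  apply: le_trans (cabsD _ _) _; rewrite mulrDr addrC; apply: lerD.
    by rewrite cabsM hs ler_wpM2l ?G'K.
  apply: le_trans hG _; rewrite expr2 mulrA [leRHS]mulrC.
  have h : L2 * s <= `|L2|.
    by apply: le_trans (ler_norm _) _; rewrite normrM (ger0_norm s0) ler_piMr.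
  by rewrite ler_wpM2r.
rewrite [leRHS]mulrDl [X in _ <= X + _]mulrDl; apply: le_trans (cabsD _ _) _; apply: lerD.
  apply: le_trans (cabsD _ _) _; apply: lerD; rewrite cabsM.
    by rewrite mulrAC ler_pM ?cabs_ge0 ?GK.
  by rewrite -mulrA ler_pM ?cabs_ge0 ?FK.
rewrite !cabsM hs; have -> : K * (K2 + `|L2|) * s ^+ 2 = s * (K * (s * (K2 + `|L2|))) by ring.
by rewrite ler_wpM2l// ler_pM ?cabs_ge0 ?F'K.
Qed.

Definition mx_derivative p q (M M' : U -> 'M[C]_(p, q)) :=
  forall i j, derivative_along g (fun u => M u i j) (fun u => M' u i j).

Lemma mx_derivative_eq p q (M M' M1 M1' : U -> 'M[C]_(p, q)) :
  (forall u, M u = M1 u) -> (forall u, M' u = M1' u) ->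
  mx_derivative M M' -> mx_derivative M1 M1'.
Proof. by move=> /funext -> /funext ->. Qed.

Lemma mx_derivative_cst p q (m : 'M[C]_(p, q)) : mx_derivative (fun=> m) (fun=> 0).
Proof.
move=> i j; have := derivative_cst (m i j).
by congr derivative_along; apply/funext => u; rewrite mxE.
Qed.

Lemma mx_derivativeM p q r (M M' : U -> 'M[C]_(p, q)) (N N' : U -> 'M[C]_(q, r)) :
  mx_derivative M M' -> mx_derivative N N' ->
  mx_derivative (fun u => M u *m N u) (fun u => M' u *m N u + M u *m N' u).
Proof.
move=> MM NN i j.
have := derivative_sum (index_enum 'I_q) (fun l => derivativeM (MM i l) (NN l j)).
by congr derivative_along; apply/funext => u; rewrite !mxE ?big_split.
Qed.

Lemma mx_derivative_id : mx_derivative id (mulmx A).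
Proof. exact: derivative_entry. Qed.

Lemma mx_derivative_adj : mx_derivative (@adj R k k) (fun u => adj (A *m u)).
Proof.
move=> i j; have := derivativeJ (derivative_entry j i).
by congr derivative_along; apply/funext => u; rewrite !mxE.
Qed.

Lemma mx_derivative_uconj (y : U) : adj A = - A ->
  mx_derivative (fun u => uconj u y) (fun u => A *m uconj u y - uconj u y *m A).
Proof.
move=> Askew; have := mx_derivativeM (mx_derivativeM mx_derivative_id (mx_derivative_cst y))
  mx_derivative_adj.
apply: mx_derivative_eq => u //; rewrite mulmx0 addr0 adjM Askew mulmxN !mulmxA.
by rewrite /uconj mulmxN !mulmxA.
Qed.

(** The Leibniz rule for a word whose [isy] letters move by the commutator with [B]. It is defined
    for every matrix [B] and linear in it, which permits evaluation at matrix units although the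
    curves only have skew-Hermitian velocities. *)
Fixpoint dword q (B : U) (isy : pred 'I_q) (z : 'I_q -> U) (w : seq 'I_q) : U :=
  if w is i :: w' then
    (if isy i then B *m z i - z i *m B else 0) *m word_mx z w' + z i *m dword B isy z w'
  else 0.

Lemma word_mx_nil q (z : 'I_q -> U) : word_mx z [::] = 1%:M.
Proof. by rewrite /word_mx big_nil. Qed.

Lemma word_mx_cons q (z : 'I_q -> U) i w : word_mx z (i :: w) = z i *m word_mx z w.
Proof. by rewrite /word_mx big_cons. Qed.

Lemma word_mx_cat q (z : 'I_q -> U) w w' :
  word_mx z (w ++ w') = word_mx z w *m word_mx z w'.
Proof.
elim: w => [|i w IH]; first by rewrite word_mx_nil mul1mx.
by rewrite /= !word_mx_cons IH mulmxA.
Qed.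

Definition rotated q (isy : pred 'I_q) (z : 'I_q -> U) (u : U) (i : 'I_q) : U :=
  if isy i then uconj u (z i) else z i.

Lemma mx_derivative_word q (isy : pred 'I_q) (z : 'I_q -> U) w : adj A = - A ->
  mx_derivative (fun u => word_mx (rotated isy z u) w)
    (fun u => dword A isy (rotated isy z u) w).
Proof.
move=> Askew; elim: w => [|i w IH].
  by apply: (mx_derivative_eq _ _ (mx_derivative_cst 1%:M)) => u; rewrite ?word_mx_nil.
have di : mx_derivative (fun u => rotated isy z u i)
    (fun u => if isy i then A *m rotated isy z u i - rotated isy z u i *m A else 0).
  rewrite /rotated; case: (isy i); [exact: mx_derivative_uconj|exact: mx_derivative_cst].
by apply: (mx_derivative_eq _ _ (mx_derivativeM di IH)) => u //; rewrite word_mx_cons.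
Qed.

Lemma derivativeZ c F F' : derivative_along g F F' ->
  derivative_along g (fun u => c * F u) (fun u => c * F' u).
Proof.
move=> h; have := derivativeM (derivative_cst c) h.
by congr derivative_along; apply/funext => u; rewrite mul0r add0r.
Qed.

Lemma derivative_trace (M M' : U -> U) : mx_derivative M M' ->
  derivative_along g (fun u => normalized_trace (M u)) (fun u => normalized_trace (M' u)).
Proof.
move=> MM.
have := derivativeZ (k%:R)^-1 (derivative_sum (index_enum 'I_k) (fun i => MM i i)).
by congr derivative_along; apply/funext => u; rewrite /normalized_trace mulrC.
Qed.

End Derivatives.

Section Means.
Context {R : realType} (k : nat).
Local Notation C := R[i].
Local Notation U := 'M[C]_k.

(** The average of [F'] times [s] is the change of the average of [F] under a translation, up to a
    remainder of order [s ^ 2]. Near invariance makes that change as small as desired, and one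
    divides by [s]. *)
Lemma approx_mean_derivative (J : finType) (A : J -> U) (g : J -> R -> U)
    (F F' : J -> U -> C) (del : R) : 0 < del ->
  (forall j, curve_at (A j) (g j)) ->
  (forall j, derivative_along (g j) (F j) (F' j)) ->
  exists us, [/\ us <> [::], forall u, u \in us -> unitary u &
    forall j, cabs (avg us (F' j)) <= del].
Proof.
move=> d0 gA FF.
have /choice[L LP] := fun j => da_diff (FF j).
pose K := \sum_j `|L j|.
have K0 : 0 <= K by apply: sumr_ge0.
have LK j : L j <= K.
  by apply: le_trans (ler_norm _) _; rewrite /K (bigD1 j)//= lerDl sumr_ge0.
(* The step is fixed before the list is chosen, so the list can be asked for invariance up to
   [del * s / 2]; the remainder takes the other half. *)
pose s := Num.min 1 (del / (2 * (K + 1))).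
have K1 : 0 < 2 * (K + 1) by rewrite mulr_gt0// ltr_wpDl.
have s0 : 0 < s by rewrite lt_min ltr01 divr_gt0.
have s1 : s <= 1 by rewrite ge_min lexx.
have sK : K * s <= del / 2.
  have : s <= del / (2 * (K + 1)) by rewrite ge_min lexx orbT.
  rewrite ler_pdivlMr// => h; lra.
have [us [us0 usU usP]] := @approx_invariant R k J F (del * s / 2)
  (fun j => da_poly (FF j)) (divr_gt0 (mulr_gt0 d0 s0) (ltr0Sn _ 1)).
exists us; split => // j.
have s01 : 0 <= s <= 1 by rewrite ltW.
have := usP j (g j s) (curve_unitary (gA j) s01).
pose rem u := F j (g j s *m u) - F j u - (s%:C)%C * F' j u.
have remP : cabs (avg us rem) <= K * s ^+ 2.
  apply: avg_le; first by rewrite mulr_ge0// exprn_ge0// ltW.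
  move=> u /usU uu; apply: le_trans (LP j u s uu s01) _.
  by rewrite ler_wpM2r// exprn_ge0// ltW.
have -> : avg us (fun u => F j (g j s *m u)) - avg us (F j) =
    (s%:C)%C * avg us (F' j) + avg us rem.
  rewrite -avgZ -avgD -[avg us (F j)]mul1r -mulNr -avgZ -avgD.
  by congr avg; apply/funext => u; rewrite /rem; ring.
move=> h.
have : cabs ((s%:C)%C * avg us (F' j)) <= del * s / 2 + K * s ^+ 2.
  rewrite -[X in cabs X](addrK (avg us rem)).
  by apply: le_trans (cabsB _ _) _; exact: lerD.
rewrite cabsM cabs_real (gtr0_norm s0) => h2.
rewrite -(ler_pM2l s0); apply: le_trans h2 _.
have : K * s ^+ 2 <= del / 2 * s by rewrite expr2 mulrA ler_wpM2r// ltW.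
lra.
Qed.

End Means.

Section Directions.
Context {R : realType} (k : nat).
Local Notation C := R[i].
Local Notation U := 'M[C]_k.
Local Notation I := ('i%C : C).

Definition projection (P : U) := P *m P = P /\ adj P = P.

Lemma conjcM (x y : C) : conjc (x * y) = conjc x * conjc y.
Proof. exact: rmorphM. Qed.

Lemma adjZ m p (c : C) (x : 'M[C]_(m, p)) : adj (c *: x) = conjc c *: adj x.
Proof. by apply/matrixP => i j; rewrite !mxE rmorphM. Qed.

Lemma adjD m p (x y : 'M[C]_(m, p)) : adj (x + y) = adj x + adj y.
Proof. by apply/matrixP => i j; rewrite !mxE rmorphD. Qed.

Lemma adj_skew (P : U) : projection P -> adj (I *: P) = - (I *: P).
Proof.
move=> [_ PP]; rewrite adjZ PP -scaleNr; congr (_ *: _).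
by apply/eqP; rewrite eq_complex /= oppr0 !eqxx.
Qed.

(* [1 + z] is the point [(1 + is/2) / (1 - is/2)] of the unit circle. *)
Lemma curve_projection (P : U) : projection P -> exists g, curve_at (I *: P) g.
Proof.
move=> [P2 PP].
pose w (s : R) : C := Complex 1 (- (s / 2)).
pose z (s : R) : C := (s%:C)%C * I / w s.
have w0 s : w s != 0 by rewrite eq_complex /= oner_eq0.
have w1 s : 1 <= cabs (w s).
  rewrite -(@ler_pXn2r _ 2) ?nnegrE ?cabs_ge0// expr1n.
  by rewrite cabs_ReIm /= expr1n lerDl sqr_ge0.
have zcirc s : z s + conjc (z s) + z s * conjc (z s) = 0.
  have cw : conjc (w s) = 2 - w s.
    by apply/eqP; rewrite eq_complex /=; apply/andP; split; apply/eqP; ring.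
  have cw0 : 2 - w s != 0 by rewrite -cw conjc_eq0.
  have ct : conjc ((s%:C)%C * I) = - ((s%:C)%C * I).
    by apply/eqP; rewrite eq_complex /=; apply/andP; split; apply/eqP; ring.
  have sI : (s%:C)%C * I = 2 * (1 - w s) :> C.
    by apply/eqP; rewrite eq_complex /=; apply/andP; split; apply/eqP; field.
  rewrite /z conjcM conjc_inv cw ct sI; field.
  by rewrite w0 andbT.
pose g s := 1%:M + z s *: P; exists g.
pose K := \sum_i \sum_j cabs (P i j).
exists K => s /andP[s0 s1]; split.
  rewrite /unitary /g adjD adj1 adjZ PP mulmxDl mul1mx mulmxDr mulmx1.
  rewrite -scalemxAl -scalemxAr P2 scalerA addrA -addrA -scalerDl -addrA -scalerDl.
  by rewrite [conjc _ + _]addrA [conjc _ + _]addrC zcirc scale0r addr0.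
move=> i j.
have -> : g s - 1%:M - (s%:C)%C *: (I *: P) = (z s - (s%:C)%C * I) *: P.
  by rewrite /g [1%:M + _]addrC addrK scalerBl scalerA.
rewrite mxE cabsM mulrC; apply: ler_pM; rewrite ?cabs_ge0//.
  rewrite /K (bigD1 i)//= (bigD1 j)//= -addrA lerDl addr_ge0//.
    by apply: sumr_ge0 => *; exact: cabs_ge0.
  by apply: sumr_ge0 => *; apply: sumr_ge0 => *; exact: cabs_ge0.
have -> : z s - (s%:C)%C * I = - ((s ^+ 2 / 2)%:C)%C / w s.
  have e : (s%:C)%C * I - (s%:C)%C * I * w s = - ((s ^+ 2 / 2)%:C)%C.
    by apply/eqP; rewrite eq_complex /=; apply/andP; split; apply/eqP; ring.
  by rewrite -e /z mulrBl mulfK.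
rewrite cabsM cabsN cabsV cabs_real ger0_norm; last by rewrite divr_ge0// sqr_ge0.
rewrite ler_pdivrMr ?(lt_le_trans ltr01)//.
apply: (@le_trans _ _ (s ^+ 2 * 1)); last by rewrite ler_wpM2l// sqr_ge0.
by rewrite mulr1 ler_pdivrMr// ler_peMr ?sqr_ge0// ler1n.
Qed.

Lemma projection0 : projection 0.
Proof.
split; first by rewrite mul0mx.
by apply/matrixP => i j; rewrite !mxE conjc0.
Qed.

Lemma projection_vec (v : 'cV[C]_k) (c : C) : conjc c = c -> adj v *m v = (c^-1)%:M ->
  c != 0 -> projection (c *: (v *m adj v)).
Proof.
move=> cc vv c0; split; last by rewrite adjZ adjM adjK cc.
rewrite -scalemxAl -scalemxAr mulmxA -[v *m _ *m v]mulmxA vv scalerA.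
by rewrite mul_mx_scalar -scalemxAl scalerA -mulrA mulfV// mulr1.
Qed.

(** One entry of the polarization identity below, with [a b c d] standing for the entries of the
    four matrix units; the difference of the two sides is a multiple of [i * i + 1]. *)
Lemma polarization_entries (i a b c d : C) : i * i = -1 ->
  b = - i * i / 2 * a + - i * i / 2 * b + (- i * i / 2 * c + - i * i / 2 * d) +
  (1 * i / 2 * a + 1 * i / 2 * - i * b + (1 * i / 2 * i * c + 1 * i / 2 * d) +
   (i * (1 + i) / 2 * i * a + i * (1 + i) / 2 * i * d)).
Proof.
move=> ii; apply/eqP; rewrite -subr_eq0; apply/eqP.
transitivity ((i * i + 1) * (b - i * a / 2 - i * d / 2)); first by field.
by rewrite ii addNr mul0r.
Qed.

(** Polarization: off the diagonal, the projections onto the lines of [e_a + e_b], [e_a + i e_b],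
    [e_a] and [e_b] span the matrix unit. This reduces its direction to velocities of curves of
    unitaries. *)
Lemma delta_projections (a b : 'I_k) : exists (c : 'I_4 -> C) (P : 'I_4 -> U),
  (forall l, projection (P l)) /\ delta_mx a b = \sum_l c l *: (I *: P l).
Proof.
have adjd (i : 'I_k) : adj (delta_mx i 0 : 'cV[C]_k) = delta_mx 0 i.
  by apply/matrixP => x y; rewrite !mxE conjc_nat andbC.
have prE (i : 'I_k) : projection (delta_mx i i).
  split; first by rewrite mul_delta_mx.
  by apply/matrixP => x y; rewrite !mxE conjc_nat andbC.
have II : I * I = -1 by rewrite -expr2 sqr_i.
have [<-|ab] := eqVneq a b.
  exists (fun l => if l == 0 then - I else 0), (fun l => if l == 0 then delta_mx a a else 0).
  split; first by move=> l; case: ifP => _; [exact: prE|exact: projection0].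
  rewrite (bigD1 0)//= big1 ?addr0 ?scalerA ?mulNr ?II ?opprK ?scale1r// => l /negbTE ->.
  by rewrite scaler0 scaler0.
pose v (w : C) : 'cV[C]_k := delta_mx a 0 + w *: delta_mx b 0.
have vv w : adj (v w) = delta_mx 0 a + conjc w *: delta_mx 0 b.
  by rewrite /v adjD adjZ !adjd.
have ba : b != a by rewrite eq_sym.
have prv w : w * conjc w = 1 -> projection (2^-1 *: (v w *m adj (v w))).
  move=> ww; apply: projection_vec; rewrite ?invr_eq0 ?pnatr_eq0//.
    by rewrite conjc_inv conjc_nat.
  rewrite vv /v invrK mulmxDl !mulmxDr -!scalemxAl -!scalemxAr !mul_delta_mx_cond.
  rewrite !eqxx (negbTE ab) (negbTE ba) !mulr0n !mulr1n !scaler0 addr0 add0r scalerA.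
  by rewrite mulrC ww scale1r; apply/matrixP => x y; rewrite !mxE !ord1 !eqxx.
have vE w : v w *m adj (v w) = delta_mx a a + conjc w *: delta_mx a b
    + (w *: delta_mx b a + (w * conjc w) *: delta_mx b b).
  rewrite vv /v mulmxDl !mulmxDr -!scalemxAl -!scalemxAr !mul_delta_mx.
  by rewrite scalerA.
have w1 : (1 : C) * conjc 1 = 1 by rewrite conjc1 mulr1.
have cI : conjc I = - I :> C by apply/eqP; rewrite eq_complex /= oppr0 !eqxx.
have wI : I * conjc I = 1 :> C by rewrite cI mulrN II opprK.
(* The first two weights cancel [delta_mx b a] and give [delta_mx a b] coefficient 1; the last two
   remove the diagonal that remains. *)
pose c := [:: - I; 1; I * (1 + I) / 2; I * (1 + I) / 2].
pose P := [:: 2^-1 *: (v 1 *m adj (v 1)); 2^-1 *: (v I *m adj (v I)); delta_mx a a; delta_mx b b].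
exists (fun l => nth 0 c l), (fun l => nth 0 P l); split.
  by case=> [[|[|[|[|l]]]] hl] //=; [exact: (prv _ w1)|exact: (prv _ wI)].
rewrite !big_ord_recl big_ord0 /= addr0 !scalerA !vE w1 wI cI conjc1 !scale1r.
rewrite !scalerDr !scalerA.
move: (delta_mx a a) (delta_mx a b) (delta_mx b a) (delta_mx b b) => A B D E.
apply/matrixP => x y.
rewrite !mxE.
exact: polarization_entries.
Qed.

End Directions.

(** * The loop equation for matrices *)

Section Loop.
Context {R : realType}.
Local Notation C := R[i].
Variables (T : Type) (isy : pred T).
Implicit Types (tau sigma : seq T -> C) (p w v : seq T).

(* With [p] empty this is [(tau (x) tau) (d w)], where [d] is the derivation that kills the
   letters outside [isy] and maps a letter [y] in [isy] to [y (x) 1 - 1 (x) y]. *)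
Fixpoint loop tau p w : C :=
  if w is i :: w' then
    (if isy i then tau (rcons p i) * tau w' - tau p * tau w else 0) +
    loop tau (rcons p i) w'
  else 0.

(** The product rule applied to [loop], with [tau'] the derivative of [tau]. Linearity in [tau'] is
    what extends it to complex directions. *)
Fixpoint dloop tau tau' p w : C :=
  if w is i :: w' then
    (if isy i then tau' (rcons p i) * tau w' + tau (rcons p i) * tau' w' -
       (tau' p * tau w + tau p * tau' w) else 0) +
    dloop tau tau' (rcons p i) w'
  else 0.

Lemma dloop_sum (J : finType) (c : J -> C) tau (tau' : J -> seq T -> C) p w :
  dloop tau (fun v => \sum_j c j * tau' j v) p w = \sum_j c j * dloop tau (tau' j) p w.
Proof.
elim: w p => [|i w IH] p /=; first by rewrite big1// => j _; rewrite mulr0.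
rewrite IH; under [RHS]eq_bigr do rewrite mulrDr; rewrite big_split /=; congr (_ + _).
case: ifP => _; last by rewrite big1// => j _; rewrite mulr0.
rewrite !mulr_suml !mulr_sumr -!big_split -sumrB; apply: eq_bigr => j _ /=; ring.
Qed.

Lemma eq_dloop tau tau' tau'' p w : (forall v, tau' v = tau'' v) ->
  dloop tau tau' p w = dloop tau tau'' p w.
Proof. by move=> /funext ->. Qed.

(** Each letter contributes at most four products of a moment and a derivative. *)
Lemma dloop_bound tau tau' (B B' : R) p w : 0 <= B -> 0 <= B' ->
  (forall v, (size v <= size p + size w)%N -> cabs (tau v) <= B /\ cabs (tau' v) <= B') ->
  cabs (dloop tau tau' p w) <= 4 * B * B' * (size w)%:R.
Proof.
move=> B0 B'0; elim: w p => [|i w IH] p bd /=; first by rewrite cabs0 mulr0.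
apply: le_trans (cabsD _ _) _; rewrite -[(size w).+1%:R]natr1 mulrDr mulr1 [leLHS]addrC; apply: lerD.
  by apply: IH => v; rewrite size_rcons addSnnS; exact: bd.
case: ifP => _; last by rewrite cabs0 !mulr_ge0.
have bM a b : (size a <= size p + (size w).+1)%N -> (size b <= size p + (size w).+1)%N ->
    cabs (tau a * tau' b) <= B * B'.
  by move=> /bd[ha _] /bd[_ hb]; rewrite cabsM ler_pM ?cabs_ge0.
have s1 : (size (rcons p i) <= size p + (size w).+1)%N.
  by rewrite size_rcons addnS ltnS leq_addr.
have s2 : (size w <= size p + (size w).+1)%N by rewrite addnS leqW// leq_addl.
have s3 : (size p <= size p + (size w).+1)%N by rewrite leq_addr.
have s4 : (size (i :: w) <= size p + (size w).+1)%N by rewrite leq_addl.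
have h1 := bM _ _ s2 s1; have h2 := bM _ _ s1 s2; have h3 := bM _ _ s4 s3; have h4 := bM _ _ s3 s4.
rewrite mulrC in h1; rewrite mulrC in h3.
apply: le_trans (cabsB _ _) _; have := cabsD (tau' (rcons p i) * tau w) (tau (rcons p i) * tau' w).
by have := cabsD (tau' p * tau (i :: w)) (tau p * tau' (i :: w)); lra.
Qed.

Lemma mul_lipschitz (a b a' b' : C) (B e : R) : cabs a <= B -> cabs b' <= B ->
  cabs (a - a') <= e -> cabs (b - b') <= e -> cabs (a * b - a' * b') <= 2 * B * e.
Proof.
move=> aB bB ae be; have -> : a * b - a' * b' = a * (b - b') + (a - a') * b' by ring.
apply: le_trans (cabsD _ _) _; rewrite !cabsM.
have h1 : cabs a * cabs (b - b') <= B * e by rewrite ler_pM ?cabs_ge0.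
have h2 : cabs (a - a') * cabs b' <= e * B by rewrite ler_pM ?cabs_ge0.
lra.
Qed.

Lemma loop_lipschitz tau sigma (B e : R) p w : 0 <= B -> 0 <= e ->
  (forall v, (size v <= size p + size w)%N ->
     [/\ cabs (tau v) <= B, cabs (sigma v) <= B & cabs (tau v - sigma v) <= e]) ->
  cabs (loop tau p w - loop sigma p w) <= 4 * B * e * (size w)%:R.
Proof.
move=> B0 e0; elim: w p => [|i w IH] p bd /=; first by rewrite subrr cabs0 mulr0.
rewrite opprD addrACA.
apply: le_trans (cabsD _ _) _; rewrite -[(size w).+1%:R]natr1 mulrDr mulr1 [leLHS]addrC; apply: lerD.
  by apply: IH => v; rewrite size_rcons addSnnS; exact: bd.
case: ifP => _; last by rewrite subrr cabs0 !mulr_ge0.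
have bM a b : (size a <= size p + (size w).+1)%N -> (size b <= size p + (size w).+1)%N ->
    cabs (tau a * tau b - sigma a * sigma b) <= 2 * B * e.
  by move=> /bd[ha1 ha2 ha3] /bd[hb1 hb2 hb3]; exact: mul_lipschitz.
have s1 : (size (rcons p i) <= size p + (size w).+1)%N.
  by rewrite size_rcons addnS ltnS leq_addr.
have s2 : (size w <= size p + (size w).+1)%N by rewrite addnS leqW// leq_addl.
have s3 : (size p <= size p + (size w).+1)%N by rewrite leq_addr.
have s4 : (size (i :: w) <= size p + (size w).+1)%N by rewrite leq_addl.
have h1 := bM _ _ s1 s2; have h3 := bM _ _ s3 s4.
rewrite [X in cabs X](_ : _ = (tau (rcons p i) * tau w - sigma (rcons p i) * sigma w)
  - (tau p * tau (i :: w) - sigma p * sigma (i :: w))); last by ring.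
by apply: le_trans (cabsB _ _) _; lra.
Qed.

End Loop.

Section LoopMatrix.
Context {R : realType}.
Local Notation C := R[i].
Variables (k q : nat) (isy : pred 'I_q).
Local Notation U := 'M[C]_k.
Implicit Types (z : 'I_q -> U) (w v : seq 'I_q).

Definition mx_moment z w : C := normalized_trace (word_mx z w).

Lemma derivative_loop (A : U) (g : R -> U) (tau tau' : U -> seq 'I_q -> C) p w :
  curve_at A g -> (forall v, derivative_along g (tau^~ v) (tau'^~ v)) ->
  derivative_along g (fun u => loop isy (tau u) p w) (fun u => dloop isy (tau u) (tau' u) p w).
Proof.
move=> gA tt; elim: w p => [|i w IH] p /=; first exact: derivative_cst.
apply: derivativeD => //; case: (isy i); last exact: derivative_cst.
have h1 := derivativeM gA (tt (rcons p i)) (tt w).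
have h2 := derivativeZ gA (-1) (derivativeM gA (tt p) (tt (i :: w))).
have := derivativeD h1 h2.
by congr derivative_along; apply/funext => u; rewrite mulN1r.
Qed.

Lemma dword_sum (J : finType) (c : J -> C) (X : J -> U) z w :
  dword (\sum_j c j *: X j) isy z w = \sum_j c j *: dword (X j) isy z w.
Proof.
elim: w => [|i w IH] /=; first by rewrite big1// => j _; rewrite scaler0.
rewrite IH; under [RHS]eq_bigr do rewrite scalerDr; rewrite big_split /=; congr (_ + _).
  case: (isy i); last by rewrite mul0mx big1// => j _; rewrite scaler0.
  rewrite mulmx_suml mulmx_sumr -sumrB mulmx_suml; apply: eq_bigr => j _.
  by rewrite -scalemxAl -scalemxAr -scalerBr -scalemxAl.
by rewrite mulmx_sumr; apply: eq_bigr => j _; rewrite -scalemxAr.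
Qed.

(** The gradient of the trace of a word under conjugation of its [isy] letters: every term of
    [p *m dword X] is turned cyclically until [X] stands first. *)
Fixpoint cyclic_dword z (p : U) w : U :=
  if w is i :: w' then
    (if isy i then z i *m word_mx z w' *m p - word_mx z w' *m p *m z i else 0) +
    cyclic_dword z (p *m z i) w'
  else 0.

Lemma trace_dword z (X p : U) w :
  \tr (p *m dword X isy z w) = \tr (X *m cyclic_dword z p w).
Proof.
elim: w p => [|i w IH] p /=; first by rewrite !mulmx0.
rewrite !mulmxDr !linearD /=; congr (_ + _); last first.
  by rewrite mulmxA IH.
case: ifP => _; last by rewrite mul0mx !mulmx0.
have trB (x y : U) : \tr (x - y) = \tr x - \tr y by exact: raddfB.
rewrite mulmxBl !mulmxBr !trB; congr (_ - _).
  by rewrite mxtrace_mulC !mulmxA.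
by rewrite mxtrace_mulC -!mulmxA mxtrace_mulC !mulmxA.
Qed.

Lemma opbd_word z (r : R) w : 0 <= r -> (forall i, opbd (z i) r) ->
  opbd (word_mx z w) (r ^+ size w).
Proof.
move=> r0 zr; elim: w => [|i w IH]; first by rewrite word_mx_nil; exact: opbd1.
by rewrite word_mx_cons exprS; apply: opbdM.
Qed.

Lemma opbd_cyclic_dword z (r : R) (p : U) m w : 1 <= r -> (forall i, opbd (z i) r) ->
  opbd p (r ^+ m) -> opbd (cyclic_dword z p w) (2 * (size w)%:R * r ^+ (m + size w)).
Proof.
move=> r1 zr; have r0 : 0 <= r by apply: le_trans r1.
elim: w p m => [|i w IH] p m pm /=; first by rewrite mulr0 mul0r; exact: opbd0.
rewrite -[(size w).+1%:R]natr1 mulrDr mulr1 mulrDl addrC; apply: opbdD.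
  have := IH (p *m z i) m.+1; rewrite addSnnS; apply.
  by rewrite exprSr; apply: opbdM; rewrite ?exprn_ge0.
have rn j : 0 <= r ^+ j by rewrite exprn_ge0.
case: ifP => _; last by apply: (opbd_le _ (@opbd0 R k)); rewrite mulr_ge0.
have -> : 2 * r ^+ (m + (size w).+1) = r * r ^+ size w * r ^+ m + r ^+ size w * r ^+ m * r.
  by rewrite exprD exprS; ring.
apply: opbdD; last apply: opbdN.
  apply: opbdM => //; first by rewrite mulr_ge0.
  by apply: opbdM => //; exact: opbd_word.
apply: opbdM => //; first by rewrite mulr_ge0.
by apply: opbdM => //; exact: opbd_word.
Qed.

(** The square of the norm of [adj x *m v] is the inner product of [v] with [x *m (adj x *m v)], and
    Cauchy-Schwarz applies. *)
Lemma opbd_adj (x : U) r : opbd x r -> opbd (adj x) r.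
Proof.
move=> xr v; have [e0|e0] := eqVneq (l2norm (adj x *m v)) 0.
  by rewrite e0; exact: le_trans (l2norm_ge0 _) (xr v).
rewrite -(ler_pM2l (x := l2norm (adj x *m v))) ?lt_neqAle 1?eq_sym ?e0 ?l2norm_ge0//.
rewrite -expr2; have -> : l2norm (adj x *m v) ^+ 2 = cabs ((adj v *m (x *m (adj x *m v))) 0 0).
  rewrite -[LHS]ger0_norm ?sqr_ge0// -cabs_real l2norm_sqrE.
  by rewrite adjM adjK !mulmxA.
rewrite mxE; apply: le_trans (cabs_sum _ _ _) _.
apply: (@le_trans _ _ (l2norm v * l2norm (x *m (adj x *m v)))).
  rewrite !l2normE; apply: le_trans (cauchy_schwarz_sum _ _); apply: ler_sum => i _.
  by rewrite cabsM !mxE cabsJ.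
rewrite [leRHS]mulrA [leRHS]mulrC ler_wpM2l ?l2norm_ge0//.
by rewrite mulrC; exact: xr.
Qed.

Hypothesis k0 : (0 < k)%N.

Lemma trE (x : U) : \tr x = k%:R * normalized_trace x.
Proof.
by rewrite /normalized_trace mulrCA divff ?mulr1// pnatr_eq0 -lt0n.
Qed.

Lemma entry_delta (p x : U) a b c d : (p *m delta_mx a b *m x) c d = p c a * x b d.
Proof.
rewrite mxE (bigD1 b)//= big1 ?addr0 => [|j jb].
  rewrite mxE (bigD1 a)//= big1 ?addr0 => [|j ja]; first by rewrite mxE !eqxx mulr1.
  by rewrite mxE (negbTE ja) mulr0.
rewrite mxE big1 ?mul0r// => l _.
by rewrite mxE (negbTE jb) andbF mulr0.
Qed.

(** Since [(p *m delta_mx a b *m x) a b = p a a * x b b], summing over the matrix units splits a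
    word into a product of two traces. Normalising both yields [k ^ 2]; the sign reflects the order
    of the commutator. *)
Lemma sum_dword z p w :
  \sum_a \sum_b (word_mx z p *m dword (delta_mx a b) isy z w) a b =
  - (k%:R ^+ 2 * loop isy (mx_moment z) p w).
Proof.
elim: w p => [|i w IH] p /=.
  by rewrite mulr0 oppr0 big1// => a _; rewrite big1// => b _; rewrite mulmx0 mxE.
under eq_bigr do under eq_bigr do rewrite mulmxDr mxE.
under eq_bigr do rewrite big_split /=.
rewrite big_split /= mulrDr opprD addrC [RHS]addrC; congr (_ + _).
  under eq_bigr do under eq_bigr do rewrite mulmxA.
  have -> : word_mx z p *m z i = word_mx z (rcons p i).
    by rewrite -cats1 word_mx_cat word_mx_cons word_mx_nil mulmx1.
  exact: IH.
case: ifP => _; last first.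
  by rewrite mulr0 oppr0 big1// => a _; rewrite big1// => b _; rewrite mul0mx mulmx0 mxE.
transitivity (\tr (word_mx z p) * \tr (word_mx z (i :: w))
   - \tr (word_mx z (rcons p i)) * \tr (word_mx z w)).
  rewrite /mxtrace !mulr_suml -sumrB; apply: eq_bigr => a _.
  rewrite !mulr_sumr -sumrB; apply: eq_bigr => b _.
  rewrite mulmxBl mulmxBr mxE [X in _ + X]mxE word_mx_cons; congr (_ - _).
    by rewrite -mulmxA mulmxA entry_delta.
  rewrite -mulmxA [word_mx z p *m _]mulmxA mulmxA entry_delta.
  by rewrite -cats1 word_mx_cat word_mx_cons word_mx_nil mulmx1.
by rewrite !trE /mx_moment; ring.
Qed.

End LoopMatrix.

Section LoopMean.
Context {R : realType}.
Local Notation C := R[i].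
Variables (k q : nat) (isy : pred 'I_q).
Local Notation U := 'M[C]_k.
Hypothesis k0 : (0 < k)%N.
Implicit Types (z : 'I_q -> U) (w v : seq 'I_q).

Definition loop_at z w : C := loop isy (mx_moment z) [::] w.

(** The value [4 * B * B' * m] of [dloop_bound] for [B = r ^ m] and [B' = 2 * m * r ^ m ^ 2], the
    bound on [paired_derivative]. *)
Definition loop_constant (m : nat) (r : R) : R := 8 * m%:R ^+ 2 * r ^+ m ^+ 3.

Lemma trace_delta (a b : 'I_k) (x : U) : \tr (delta_mx b a *m x) = x a b.
Proof.
rewrite /mxtrace (bigD1 b)//= big1 ?addr0 => [|c cb].
  by rewrite -[delta_mx b a]mul1mx entry_delta mxE eqxx mul1r.
by rewrite -[delta_mx b a]mul1mx entry_delta mxE (negbTE cb) mul0r.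
Qed.

Definition moment_derivative (X : U) z v : C := normalized_trace (dword X isy z v).

Lemma moment_derivative_sum (J : finType) (c : J -> C) (X : J -> U) z v :
  moment_derivative (\sum_j c j *: X j) z v = \sum_j c j * moment_derivative (X j) z v.
Proof.
rewrite /moment_derivative dword_sum /normalized_trace linear_sum mulr_suml.
by apply: eq_bigr => j _; rewrite linearZ /= mulrA.
Qed.

(** The [k ^ 2] derivatives of a moment, paired with the entries of a word, contract to one
    normalized trace. Its bound is therefore independent of [k]. *)
Definition paired_derivative z w v : C :=
  normalized_trace (adj (word_mx z w) *m cyclic_dword isy z 1%:M v).

Lemma paired_derivativeE z w v :
  paired_derivative z w v =
  \sum_a \sum_b conjc (word_mx z w a b) * moment_derivative (delta_mx b a) z v.
Proof.
rewrite /paired_derivative /moment_derivative /normalized_trace.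
transitivity (\sum_a \sum_b conjc (word_mx z w a b) * cyclic_dword isy z 1%:M v a b / k%:R).
  rewrite /mxtrace exchange_big mulr_suml; apply: eq_bigr => b _.
  by rewrite mxE mulr_suml; apply: eq_bigr => a _; rewrite !mxE.
apply: eq_bigr => a _; apply: eq_bigr => b _.
by rewrite -[dword _ _ _ _]mul1mx trace_dword trace_delta mulrA.
Qed.

Lemma paired_derivative_bound z w v (r : R) m : 1 <= r -> (forall i, opbd (z i) r) ->
  (size w <= m)%N -> (size v <= m)%N ->
  cabs (paired_derivative z w v) <= 2 * m%:R * r ^+ m ^+ 2.
Proof.
move=> r1 zr wm vm; have r0 : 0 <= r by exact: le_trans r1.
apply: trace_opbd; first by rewrite !mulr_ge0// exprn_ge0// exprn_ge0.
apply: (@opbd_le _ _ _ (r ^+ size w * (2 * (size v)%:R * r ^+ (0 + size v)))).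
  have -> : 2 * m%:R * r ^+ m ^+ 2 = r ^+ m * (2 * m%:R * r ^+ m) by ring.
  rewrite add0n; apply: ler_pM; rewrite ?exprn_ge0// ?mulr_ge0 ?exprn_ge0//.
    by rewrite ler_weXn2l.
  by apply: ler_pM; rewrite ?exprn_ge0// ?ler_weXn2l// ler_wpM2l// ler_nat.
apply: opbdM; first by rewrite exprn_ge0.
  by apply: opbd_adj; exact: opbd_word.
by apply: opbd_cyclic_dword => //; rewrite expr0; exact: opbd1.
Qed.

Lemma moment_bound z v (r : R) m : 1 <= r -> (forall i, opbd (z i) r) ->
  (size v <= m)%N -> cabs (mx_moment z v) <= r ^+ m.
Proof.
move=> r1 zr vm; have r0 : 0 <= r by exact: le_trans r1.
apply: trace_opbd; first by rewrite exprn_ge0.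
by apply: opbd_le (opbd_word v r0 zr); rewrite ler_weXn2l.
Qed.

Lemma opbd_rotated z u (r : R) : 0 <= r -> unitary u -> (forall i, opbd (z i) r) ->
  forall i, opbd (rotated isy z u i) r.
Proof. by move=> r0 uu zr i; rewrite /rotated; case: (isy i) => //; exact: opbd_conj. Qed.

(* The sum over [a, b] of the derivatives in the direction [delta_mx a b] of
   [word_mx z w a b * conjc (loop_at z w)]. *)
Lemma loop_equation z w (c : 'I_k -> 'I_k -> 'I_4 -> C) (P : 'I_k -> 'I_k -> 'I_4 -> U) :
  (forall a b l, projection (P a b l)) ->
  (forall a b, delta_mx a b = \sum_l c a b l *: ('i%C *: P a b l)) ->
  \sum_a \sum_b \sum_l c a b l *
    (dword ('i%C *: P a b l) isy z w a b * conjc (loop_at z w) +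
     word_mx z w a b * conjc (dloop isy (mx_moment z)
       (moment_derivative ('i%C *: P a b l) z) [::] w)) =
  - (k%:R ^+ 2 * (loop_at z w * conjc (loop_at z w))) -
    conjc (dloop isy (mx_moment z) (paired_derivative z w) [::] w).
Proof.
move=> projP dE.
have part1 a b : \sum_l c a b l * (dword ('i%C *: P a b l) isy z w a b) =
    (word_mx z [::] *m dword (delta_mx a b) isy z w) a b.
  rewrite word_mx_nil mul1mx dE dword_sum summxE.
  by apply: eq_bigr => l _; rewrite mxE.
(* The directions ['i%C *: P] are skew-Hermitian, so conjugating the coefficients turns
   [delta_mx a b] into [- delta_mx b a]. *)
have part2 a b : \sum_l c a b l * conjc (dloop isy (mx_moment z)
       (moment_derivative ('i%C *: P a b l) z) [::] w) =
   - conjc (dloop isy (mx_moment z) (moment_derivative (delta_mx b a) z) [::] w).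
  transitivity (conjc (dloop isy (mx_moment z) (fun v => \sum_l conjc (c a b l) *
      moment_derivative ('i%C *: P a b l) z v) [::] w)).
    rewrite dloop_sum rmorph_sum; apply: eq_bigr => l _.
    by rewrite rmorphM /= conjcK.
  rewrite -rmorphN -mulN1r; congr conjc.
  have := @dloop_sum R _ isy unit (fun=> -1) (mx_moment z)
     (fun=> moment_derivative (delta_mx b a) z) [::] w.
  rewrite [RHS](big_pred1 tt); last by case.
  move=> <-; apply: eq_dloop => v; rewrite (big_pred1 tt); last by case.
  rewrite -moment_derivative_sum.
  have -> : \sum_l conjc (c a b l) *: ('i%C *: P a b l) = \sum_(l : unit) (-1) *: delta_mx b a.
    rewrite (big_pred1 tt); last by case.
    have -> : delta_mx b a = adj (delta_mx a b) :> U.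
      by apply/matrixP => x y; rewrite !mxE conjc_nat andbC.
    rewrite dE scaleN1r; apply/matrixP => x y; rewrite !mxE !summxE rmorph_sum -sumrN.
    apply: eq_bigr => l _; have /matrixP/(_ x y) := adj_skew (projP a b l).
    by rewrite !mxE => h; rewrite rmorphM /= h mulrN opprK.
  by rewrite (@moment_derivative_sum unit (fun=> -1) (fun=> delta_mx b a)) (big_pred1 tt)//; case.
transitivity (\sum_a \sum_b (word_mx z [::] *m dword (delta_mx a b) isy z w) a b *
    conjc (loop_at z w) + \sum_a \sum_b word_mx z w a b *
    - conjc (dloop isy (mx_moment z) (moment_derivative (delta_mx b a) z) [::] w)).
  rewrite -big_split; apply: eq_bigr => a _; rewrite -big_split; apply: eq_bigr => b _ /=.
  rewrite -part1 -part2 mulr_suml mulr_sumr -big_split; apply: eq_bigr => l _ /=.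
  by rewrite mulrDr !mulrA [word_mx _ _ _ _ * _]mulrC.
congr (_ + _).
  under eq_bigr do rewrite -mulr_suml.
  by rewrite -mulr_suml sum_dword// mulNr mulrA.
transitivity (- conjc (dloop isy (mx_moment z) (fun v => \sum_(p : 'I_k * 'I_k)
   conjc (word_mx z w p.1 p.2) * moment_derivative (delta_mx p.2 p.1) z v) [::] w)).
  rewrite dloop_sum rmorph_sum -sumrN.
  rewrite -(pair_bigA _ (fun a b => - conjc (conjc (word_mx z w a b) *
    dloop isy (mx_moment z) (moment_derivative (delta_mx b a) z) [::] w))).
  apply: eq_bigr => a _; apply: eq_bigr => b _ /=.
  by rewrite conjcM conjcK mulrN.
congr (- conjc _); apply: eq_dloop => v.
by rewrite paired_derivativeE pair_bigA.
Qed.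

(** The derivatives in [loop_equation] nearly vanish on average, which leaves [k ^ 2] times the mean
    squared defect against a bounded term. One list serves all the finitely many pairs of a tuple
    and a word. *)
Lemma loop_mean (J : finType) (z : J -> 'I_q -> U) (w : J -> seq 'I_q) (r : R) (m : nat) :
  1 <= r -> (forall j i, opbd (z j i) r) -> (forall j, (size (w j) <= m)%N) ->
  exists us, [/\ us <> [::], forall u, u \in us -> unitary u &
    forall j, k%:R ^+ 2 * cabs (avg us (fun u =>
        loop_at (rotated isy (z j) u) (w j) * conjc (loop_at (rotated isy (z j) u) (w j))))
      <= loop_constant m r + 1].
Proof.
move=> r1 zr wm; have r0 : 0 <= r by exact: le_trans r1.
have /choice[c0 /choice[P0 cP]] : forall ab : 'I_k * 'I_k, exists (c : 'I_4 -> C) (P : 'I_4 -> U),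
  (forall l, projection (P l)) /\ delta_mx ab.1 ab.2 = \sum_l c l *: ('i%C *: P l).
  by case=> a b; exact: delta_projections.
pose c a b l := c0 (a, b) l; pose P a b l := P0 (a, b) l.
have projP a b l : projection (P a b l) by have [h _] := cP (a, b); exact: h.
have dE a b : delta_mx a b = \sum_l c a b l *: ('i%C *: P a b l) by have [_] := cP (a, b).
have /choice[g gP] : forall j : J * ('I_k * 'I_k * 'I_4), exists g, curve_at ('i%C *: P j.2.1.1 j.2.1.2 j.2.2) g.
  by move=> j; exact: curve_projection.
pose K := \sum_(a < k) \sum_(b < k) \sum_(l < 4) cabs (c a b l).
have K0 : 0 <= K.
  by apply: sumr_ge0 => a _; apply: sumr_ge0 => b _; apply: sumr_ge0 => l _; exact: cabs_ge0.
(* Weighted by the coefficients [c], whose moduli sum to [K], errors of this size add up to at most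
   the 1 of the conclusion. *)
have del0 : 0 < (K + 1)^-1 by rewrite invr_gt0 ltr_wpDl.
pose A (j : J * ('I_k * 'I_k * 'I_4)) : U := 'i%C *: P j.2.1.1 j.2.1.2 j.2.2.
pose rot j u := rotated isy (z j) u.
pose F (j : J * ('I_k * 'I_k * 'I_4)) u := word_mx (rot j.1 u) (w j.1) j.2.1.1 j.2.1.2 *
  conjc (loop_at (rot j.1 u) (w j.1)).
pose F' (j : J * ('I_k * 'I_k * 'I_4)) u :=
  dword (A j) isy (rot j.1 u) (w j.1) j.2.1.1 j.2.1.2 * conjc (loop_at (rot j.1 u) (w j.1)) +
  word_mx (rot j.1 u) (w j.1) j.2.1.1 j.2.1.2 *
    conjc (dloop isy (mx_moment (rot j.1 u)) (moment_derivative (A j) (rot j.1 u)) [::] (w j.1)).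
have FF j : derivative_along (g j) (F j) (F' j).
  apply: (derivativeM (gP j)).
    by apply: (mx_derivative_word (gP j)); exact: adj_skew.
  apply: derivativeJ.
  apply: (@derivative_loop R k q isy (A j) (g j) (fun u => mx_moment (rot j.1 u))
    (fun u => moment_derivative (A j) (rot j.1 u)) [::] (w j.1) (gP j)) => v.
  apply: derivative_trace.
    exact: (gP j).
  by apply: (mx_derivative_word (gP j)); exact: adj_skew.
have [us [us0 usU usP]] := approx_mean_derivative del0 gP FF.
exists us; split => // j.
pose L u := loop_at (rot j u) (w j).
pose E u := conjc (dloop isy (mx_moment (rot j u)) (paired_derivative (rot j u) (w j)) [::] (w j)).
have eqn : \sum_a \sum_b \sum_l c a b l * avg us (F' (j, (a, b, l))) =
    - (k%:R ^+ 2 * avg us (fun u => L u * conjc (L u))) - avg us E.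
  transitivity (avg us (fun u => \sum_a \sum_b \sum_l c a b l * F' (j, (a, b, l)) u)).
    rewrite avg_sum; apply: eq_bigr => a _; rewrite avg_sum; apply: eq_bigr => b _.
    by rewrite avg_sum; apply: eq_bigr => l _; rewrite avgZ.
  rewrite -mulN1r -avgZ -mulN1r -[- avg us E]mulN1r -!avgZ -avgD; congr avg.
  by apply/funext => u; rewrite !mulN1r -(loop_equation _ _ projP dE).
have Ebd : cabs (avg us E) <= loop_constant m r.
  apply: avg_le; first by rewrite /loop_constant !mulr_ge0// ?exprn_ge0// exprn_ge0.
  move=> u /usU uu; rewrite /E cabsJ.
  have rr := opbd_rotated r0 uu (zr j).
  have rm0 : 0 <= r ^+ m by rewrite exprn_ge0.
  apply: (@le_trans _ _ (4 * (r ^+ m) * (2 * m%:R * r ^+ m ^+ 2) * (size (w j))%:R)).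
    apply: dloop_bound => //; first by rewrite !mulr_ge0// exprn_ge0.
    move=> v; rewrite add0n => vw; have vm := leq_trans vw (wm j).
    by split; [exact: moment_bound|exact: paired_derivative_bound].
  have -> : loop_constant m r = 4 * (r ^+ m) * (2 * m%:R * r ^+ m ^+ 2) * m%:R.
    by rewrite /loop_constant; ring.
  by rewrite ler_wpM2l ?ler_nat// !mulr_ge0// exprn_ge0.
have Kbd : cabs (\sum_a \sum_b \sum_l c a b l * avg us (F' (j, (a, b, l)))) <= 1.
  apply: (@le_trans _ _ (K * (K + 1)^-1)); last first.
    by rewrite ler_pdivrMr ?ltr_wpDl// mul1r lerDl.
  apply: le_trans (cabs_sum _ _ _) _; rewrite mulr_suml; apply: ler_sum => a _.
  apply: le_trans (cabs_sum _ _ _) _; rewrite mulr_suml; apply: ler_sum => b _.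
  apply: le_trans (cabs_sum _ _ _) _; rewrite mulr_suml; apply: ler_sum => l _.
  by rewrite cabsM ler_wpM2l ?cabs_ge0.
have -> : k%:R ^+ 2 = cabs (k%:R ^+ 2) :> R by rewrite cabsX cabs_nat.
rewrite -cabsM.
have -> : k%:R ^+ 2 * avg us (fun u => L u * conjc (L u)) =
   - (avg us E + \sum_a \sum_b \sum_l c a b l * avg us (F' (j, (a, b, l)))).
  by rewrite eqn; ring.
by rewrite cabsN; apply: le_trans (cabsD _ _) _; exact: lerD.
Qed.

End LoopMean.

(** Each choice at least halves the set still to be served, so fewer than [2 ^ t] points are
    exhausted after [t] choices. *)
Lemma greedy_cover (J : finType) (T : Type) (P : T -> Prop) (good : J -> T -> bool) :
  (forall Q : {set J}, exists2 u, P u & (2 * #|[set j in Q | ~~ good j u]| <= #|Q|)%N) ->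
  forall t (Q : {set J}), (#|Q| < 2 ^ t)%N ->
  exists us : seq T, [/\ size us = t, forall i, (i < t)%N -> forall u0, P (nth u0 us i) &
    forall j, j \in Q -> has (good j) us].
Proof.
move=> halve; elim=> [|t IH] Q.
  by rewrite expn0 ltnS leqn0 cards_eq0 => /eqP ->; exists [::]; split=> // j; rewrite inE.
move=> Qt; have [u Pu uQ] := halve Q.
have [|us [sus Pus goodus]] := IH [set j in Q | ~~ good j u].
  by rewrite -(ltn_pmul2l (isT : 0 < 2)%N) -expnS; exact: leq_ltn_trans uQ Qt.
exists (u :: us); split; first by rewrite /= sus.
  by move=> [|i] it u0 //=; exact: Pus.
move=> j jQ /=; have [//|bad] := boolP (good j u).
by apply: goodus; rewrite inE jQ.
Qed.

(** * Short lists of rotations *)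

Section Rotations.
Context {R : realType}.
Local Notation C := R[i].

Definition second_half n (i : 'I_(n + n)) : bool :=
  match fintype.split i with inl _ => false | inr _ => true end.

Definition joint_loop n k (x y : mxtuple (R := R) n k) (w : seq 'I_(n + n)) : C :=
  loop_at (@second_half n) (concat x y) w.

Definition loops_small n k (x y : mxtuple (R := R) n k) (eta : R) (m : nat) :=
  forall w, (size w <= m)%N -> cabs (joint_loop x y w) <= eta.

Lemma rotated_concat n k (x y : mxtuple (R := R) n k) u :
  rotated (@second_half n) (concat x y) u = concat x (conj_tuple u y).
Proof.
by apply/funext => i; rewrite /rotated /second_half /concat /conj_tuple; case: fintype.split.
Qed.

Lemma opbd_concat n k (x y : mxtuple (R := R) n k) r : (forall i, opbd (x i) r) ->
  (forall i, opbd (y i) r) -> forall i, opbd (concat x y i) r.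
Proof. by move=> xr yr i; rewrite /concat; case: fintype.split. Qed.

Lemma sum_le_exists (T : eqType) (s : seq T) (f : T -> R) (B : R) : s <> [::] ->
  \sum_(t <- s) f t <= (size s)%:R * B -> exists2 t, t \in s & f t <= B.
Proof.
move=> s0 sB; apply: contrapT => no.
have lt t : t \in s -> B < f t.
  by move=> ts; rewrite ltNge; apply/negP => fB; apply: no; exists t.
have : \sum_(t <- s) B < \sum_(t <- s) f t.
  case: s s0 {sB no} lt => // t s _ lt; rewrite !big_cons; apply: ltr_leD.
    by apply: lt; rewrite mem_head.
  rewrite big_seq [leRHS]big_seq; apply: ler_sum => t' ts.
  by apply/ltW/lt; rewrite inE ts orbT.
by rewrite big_const_seq count_predT iter_addr_0 -mulr_natl => /(le_lt_trans sB); rewrite ltxx.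
Qed.

(** Chebyshev's inequality: some rotation in the list keeps the sum over [Q] and over words of the
    squared defects below [#|Q| * eta ^ 2 / 2], and every bad point contributes at least
    [eta ^ 2]. *)
Lemma loop_halving n k (J : finType) (x : mxtuple (R := R) n k) (y : J -> mxtuple n k)
    (r eta : R) (m : nat) : (0 < k)%N -> 1 <= r -> 0 < eta ->
  (forall i, opbd (x i) r) -> (forall j i, opbd (y j i) r) ->
  2 * (#|{: m.-bseq 'I_(n + n)}|%:R * (loop_constant m r + 1)) <= k%:R ^+ 2 * eta ^+ 2 ->
  forall Q : {set J}, exists2 u, unitary u &
    (2 * #|[set j in Q | ~~ `[< loops_small x (conj_tuple u (y j)) eta m >] ]| <= #|Q|)%N.
Proof.
move=> k0 r1 e0 xr yr kbig Q.
have [us [us0 usU usP]] := @loop_mean R k (n + n) (@second_half n) k0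
  (J * m.-bseq 'I_(n + n))%type (fun p => concat x (y p.1)) (fun p => val p.2) r m r1
  (fun p => opbd_concat xr (yr p.1)) (fun p => size_bseq p.2).
pose f u (j : J) (w : m.-bseq 'I_(n + n)) := cabs (joint_loop x (conj_tuple u (y j)) w) ^+ 2.
have f0 u j w : 0 <= f u j w by exact: sqr_ge0.
have mean j w : k%:R ^+ 2 * \sum_(u <- us) f u j w <= (size us)%:R * (loop_constant m r + 1).
  have := usP (j, w); rewrite /=.
  have -> : (fun u => loop_at (@second_half n) (rotated (@second_half n) (concat x (y j)) u) w *
      conjc (loop_at (@second_half n) (rotated (@second_half n) (concat x (y j)) u) w)) =
      (fun u => ((f u j w)%:C)%C).
    by apply/funext => u; rewrite rotated_concat /f cabs_sqr.
  rewrite /avg -rmorph_sum cabsM cabsV cabs_nat cabs_real ger0_norm ?sumr_ge0//.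
  have sz : 0 < (size us)%:R :> R by rewrite ltr0n lt0n size_eq0; apply/eqP.
  by rewrite mulrCA mulrC (ler_pdivrMr _ _ sz) [leRHS]mulrC.
have k2 : 0 < k%:R ^+ 2 :> R by rewrite exprn_gt0// ltr0n.
have [u uus uB] : exists2 u, u \in us & \sum_(j in Q) \sum_w f u j w <= #|Q|%:R * (eta ^+ 2 / 2).
  apply: sum_le_exists => //; rewrite -(ler_pM2l k2) exchange_big mulr_sumr.
  under eq_bigr do rewrite exchange_big mulr_sumr.
  apply: (@le_trans _ _ (\sum_(j in Q) \sum_(w : m.-bseq 'I_(n + n))
     (size us)%:R * (loop_constant m r + 1))).
    by apply: ler_sum => j _; apply: ler_sum => w _; exact: mean.
  set S := (size us)%:R; move: kbig; set c := loop_constant m r + 1 => kbig.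
  have -> : \sum_(j in Q) \sum_(w : m.-bseq 'I_(n + n)) S * c =
      #|Q|%:R * S * (#|{: m.-bseq 'I_(n + n)}|%:R * c).
    by rewrite !sumr_const -mulrnA -[LHS]mulr_natr natrM; ring.
  move: kbig; set W := #|_|%:R => kbig.
  have -> : k%:R ^+ 2 * (S * (#|Q|%:R * (eta ^+ 2 / 2))) = #|Q|%:R * S * (k%:R ^+ 2 * eta ^+ 2 / 2).
    by ring.
  by rewrite ler_wpM2l ?mulr_ge0// ler_pdivlMr// mulrC.
exists u; first exact: usU.
set B := [set j in Q | _]; rewrite -(ler_nat R) natrM.
have : \sum_(j in B) eta ^+ 2 <= \sum_(j in Q) \sum_w f u j w.
  rewrite [leRHS](big_setID B) /=; have -> : Q :&: B = B.
    by apply/finset.setIidPr/fintype.subsetP => j; rewrite inE => /andP[].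
  apply: (@le_trans _ _ (\sum_(j in B) \sum_w f u j w)); last first.
    by rewrite lerDl sumr_ge0// => j _; exact: sumr_ge0.
  apply: ler_sum => j; rewrite inE => /andP[_ /asboolPn].
  move=> /existsNP[w /not_implyP[wm /negP]]; rewrite -ltNge => ltw.
  rewrite (bigD1 (Bseq wm))//= -[leLHS]addr0 lerD ?sumr_ge0//.
  by rewrite /f /= lerXn2r ?nnegrE ?cabs_ge0 ?ltW.
rewrite sumr_const => /le_trans/(_ uB); rewrite -[X in X <= _]mulr_natl.
have e2 : 0 < eta ^+ 2 by rewrite exprn_gt0.
move: e2; move: (eta ^+ 2) #|B|%:R #|Q|%:R => e x1 x2 e2 h.
by rewrite -(ler_pM2r e2); nra.
Qed.

End Rotations.

Section RotationFamily.
Context {R : realType}.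
Local Notation C := R[i].

Lemma opbd_word_diff k q (z z' : 'I_q -> 'M[C]_k) (r e : R) w : 1 <= r -> 0 <= e ->
  (forall i, opbd (z i) r) -> (forall i, opbd (z' i) r) -> (forall i, opbd (z i - z' i) e) ->
  opbd (word_mx z w - word_mx z' w) ((size w)%:R * r ^+ size w * e).
Proof.
move=> r1 e0 zr z'r ze; have r0 : 0 <= r by exact: le_trans r1.
elim: w => [|i w IH]; first by rewrite !word_mx_nil subrr !mul0r; exact: opbd0.
rewrite !word_mx_cons.
have -> : z i *m word_mx z w - z' i *m word_mx z' w =
    z i *m (word_mx z w - word_mx z' w) + (z i - z' i) *m word_mx z' w.
  by rewrite mulmxBr mulmxBl addrA subrK.
apply: (@opbd_le _ _ _ (r * ((size w)%:R * r ^+ size w * e) + e * r ^+ size w)).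
  rewrite /= -[(size w).+1%:R]natr1 exprS.
  have h : r ^+ size w * e <= r * (r ^+ size w * e).
    by rewrite ler_peMl// mulr_ge0// exprn_ge0.
  have -> : ((size w)%:R + 1) * (r * r ^+ size w) * e =
    r * ((size w)%:R * r ^+ size w * e) + r * (r ^+ size w * e) by ring.
  by rewrite lerD2l mulrC.
by apply: opbdD; apply: opbdM => //; exact: opbd_word.
Qed.

Lemma normalized_traceB k (x y : 'M[C]_k) :
  normalized_trace x - normalized_trace y = normalized_trace (x - y).
Proof. by rewrite /normalized_trace linearB mulrBl. Qed.

Lemma moment_lipschitz k q (z z' : 'I_q -> 'M[C]_k) (r e : R) w m : 1 <= r -> 0 <= e ->
  (forall i, opbd (z i) r) -> (forall i, opbd (z' i) r) -> (forall i, opbd (z i - z' i) e) ->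
  (size w <= m)%N -> cabs (mx_moment z w - mx_moment z' w) <= m%:R * r ^+ m * e.
Proof.
move=> r1 e0 zr z'r ze wm; have r0 : 0 <= r by exact: le_trans r1.
rewrite /mx_moment normalized_traceB; apply: trace_opbd.
  by rewrite !mulr_ge0// exprn_ge0.
apply: opbd_le (opbd_word_diff w r1 e0 zr z'r ze).
rewrite ler_wpM2r// ler_pM// ?exprn_ge0// ?ler_nat//.
by rewrite ler_weXn2l.
Qed.

Lemma joint_loop_lipschitz n k (x y y' : mxtuple (R := R) n k) (r e : R) w m :
  1 <= r -> 0 <= e -> (forall i, opbd (x i) r) -> (forall i, opbd (y i) r) ->
  (forall i, opbd (y' i) r) -> (forall i, opbd (y i - y' i) e) -> (size w <= m)%N ->
  cabs (joint_loop x y w - joint_loop x y' w) <= 4 * m%:R ^+ 2 * r ^+ m ^+ 2 * e.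
Proof.
move=> r1 e0 xr yr y'r ye wm; have r0 : 0 <= r by exact: le_trans r1.
have rm0 : 0 <= r ^+ m by rewrite exprn_ge0.
apply: (@le_trans _ _ (4 * r ^+ m * (m%:R * r ^+ m * e) * (size w)%:R)); last first.
  have -> : 4 * m%:R ^+ 2 * r ^+ m ^+ 2 * e = 4 * r ^+ m * (m%:R * r ^+ m * e) * m%:R by ring.
  by rewrite ler_wpM2l ?ler_nat// !mulr_ge0.
apply: loop_lipschitz => //; first by rewrite !mulr_ge0.
move=> v; rewrite add0n => vw; have vm := leq_trans vw wm; split.
- exact: (moment_bound r1 (opbd_concat xr yr) vm).
- exact: (moment_bound r1 (opbd_concat xr y'r) vm).
- apply: (moment_lipschitz r1 e0 (opbd_concat xr yr) (opbd_concat xr y'r) _ vm).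
  move=> i; rewrite /concat; case: fintype.split => j; last exact: ye.
  by rewrite subrr; exact: (opbd_le e0 (@opbd0 R k)).
Qed.

Lemma cabs_le_ReIm (z : C) (s : R) : `|complex.Re z| <= s -> `|complex.Im z| <= s ->
  cabs z <= 2 * s.
Proof.
move=> rs is'; have -> : z = ((complex.Re z)%:C)%C + 'i%C * ((complex.Im z)%:C)%C by exact: complexE.
apply: le_trans (cabsD _ _) _; rewrite cabsM !cabs_real.
have -> : cabs ('i%C : C) = 1.
  by rewrite /cabs normc_def /= expr0n expr1n add0r sqrtr1.
by rewrite mul1r mulr_natl mulr2n lerD.
Qed.

Lemma norm_part_le (z : C) (b : bool) :
  `|if b then complex.Re z else complex.Im z| <= cabs z.
Proof.
rewrite -(@ler_pXn2r _ 2) ?nnegrE ?cabs_ge0// real_normK ?num_real// cabs_ReIm.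
by case: b; rewrite ?lerDl ?lerDr sqr_ge0.
Qed.

(** The space of real and imaginary parts is cut into cells of side [s]. The net takes a point
    inside each occupied cell, because the center of a cell may violate the operator bound. *)
Lemma tuple_net n k (r s : R) : 0 <= r -> 0 < s ->
  exists (J : finType) (y : J -> mxtuple (R := R) n k),
  [/\ forall j i, opbd (y j i) r,
      (#|J| <= (Num.truncn (2 * r / s)).+1 ^ (n * k * k * 2))%N &
      forall y', (forall i, opbd (y' i) r) ->
        exists j, forall i a b, cabs (y' i a b - y j i a b) <= 2 * s].
Proof.
move=> r0 s0; set N := (Num.truncn _).+1.
pose part (y : mxtuple (R := R) n k) (p : 'I_n * 'I_k * 'I_k * bool) :=
  if p.2 then complex.Re (y p.1.1.1 p.1.1.2 p.1.2) else complex.Im (y p.1.1.1 p.1.1.2 p.1.2).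
pose cell (y : mxtuple (R := R) n k) p := Num.truncn ((part y p + r) / s).
pose J := {ffun 'I_n * 'I_k * 'I_k * bool -> 'I_N}.
pose inside (j : J) (y : mxtuple (R := R) n k) := (forall i, opbd (y i) r) /\ forall p, cell y p = j p :> nat.
have /choice[y yP] : forall j : J, exists y, (forall i, opbd (y i) r) /\
    ((exists y', inside j y') -> inside j y).
  move=> j; have [[y' iy']|no] := pselect (exists y', inside j y').
    by exists y'; split => // i; case: iy'.
  by exists (fun=> 0); split => // i; exact: (opbd_le r0 (@opbd0 R k)).
exists J, y; split.
- by move=> j; case: (yP j).
- by rewrite card_ffun card_ord !card_prod !card_ord card_bool.
move=> y' yr'.
have partb (x : mxtuple (R := R) n k) : (forall i, opbd (x i) r) -> forall p, 0 <= part x p + r <= 2 * r.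
  move=> xr p; have := norm_part_le (x p.1.1.1 p.1.1.2 p.1.2) p.2.
  move=> /le_trans/(_ (opbd_entry _ _ (xr _))); rewrite -/(part x p) ler_norml.
  by move=> /andP[h1 h2]; apply/andP; split; lra.
have cN p : (cell y' p < N)%N.
  rewrite ltnS; apply: le_truncn; rewrite ler_pM2r ?invr_gt0//.
  by have /andP[] := partb _ yr' p.
pose j : J := [ffun p => Ordinal (cN p)].
have [yjr iy] : inside j (y j).
  by case: (yP j) => _; apply; exists y'; split => // p; rewrite ffunE.
exists j => i a b; have close p : `|part y' p - part (y j) p| <= s.
  have := iy p; rewrite ffunE /=; rewrite /cell.
  have q1 : 0 <= (part y' p + r) / s by rewrite divr_ge0 ?(ltW s0)//; have /andP[] := partb _ yr' p.
  have q2 : 0 <= (part (y j) p + r) / s by rewrite divr_ge0 ?(ltW s0)//; have /andP[] := partb _ yjr p.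
  have /andP[] := truncn_itv q1; have /andP[] := truncn_itv q2.
  move: (Num.truncn _) => t1 + + + + e; rewrite -e => {e}.
  rewrite !ler_pdivlMr// !ltr_pdivrMr// -[t1.+1%:R]natr1 => h1 h2 h3 h4.
  by rewrite ler_norml; apply/andP; split; nra.
have RB (z1 z2 : C) : complex.Re (z1 - z2) = complex.Re z1 - complex.Re z2 by case: z1; case: z2.
have IB (z1 z2 : C) : complex.Im (z1 - z2) = complex.Im z1 - complex.Im z2 by case: z1; case: z2.
apply: cabs_le_ReIm; first by rewrite RB; have := close (i, a, b, true).
by rewrite IB; have := close (i, a, b, false).
Qed.

(* The rotations are chosen greedily over a finite net, each one taking care of half of the
   remaining points, so polynomially many in [k] suffice. *)
Lemma rotation_family n m (r eta : R) : 1 <= r -> 0 < eta ->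
  exists c k1 : nat, forall k, (0 < k)%N -> (k1 <= k)%N ->
  forall x : mxtuple (R := R) n k, (forall i, opbd (x i) r) ->
  exists us : seq 'M[C]_k, [/\ (size us <= c * k ^ 4)%N,
    forall i, (i < size us)%N -> unitary (nth 0 us i) &
    forall y : mxtuple (R := R) n k, (forall i, opbd (y i) r) ->
      exists2 i, (i < size us)%N & loops_small x (conj_tuple (nth 0 us i) y) eta m].
Proof.
move=> r1 eta0; have r0 : 0 <= r by exact: le_trans r1.
pose L := 4 * m%:R ^+ 2 * r ^+ m ^+ 2 : R.
have L0 : 0 <= L by rewrite /L !mulr_ge0// exprn_ge0// exprn_ge0.
(* Half of [eta] is spent on the distance to the net, through the Lipschitz constant [L], and half
   on the defect at the net point. *)
pose e := eta / (2 * (L + 1)).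
have L1 : 0 < 2 * (L + 1) by rewrite mulr_gt0// ltr_wpDl.
have e0 : 0 < e by rewrite divr_gt0.
have Le : L * e <= eta / 2.
  have -> : L * e = eta / 2 * (L / (L + 1)) by rewrite /e; field; rewrite gt_eqF// ltr_wpDl.
  by rewrite ler_piMr ?divr_ge0 ?ltW// ltr_pdivrMr ?ltr_wpDl// mul1r ltrDl.
pose K := 2 * (#|{: m.-bseq 'I_(n + n)}|%:R * (loop_constant m r + 1)) / (eta / 2) ^+ 2.
pose c1 := (Num.truncn (4 * r / e)).+2.
exists (n * 2 * c1 + 1)%N, (Num.truncn K).+1 => k k0 kk1 x xr.
have eta2 : 0 < (eta / 2) ^+ 2 by rewrite exprn_gt0// divr_gt0.
have kbig : 2 * (#|{: m.-bseq 'I_(n + n)}|%:R * (loop_constant m r + 1)) <=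
    k%:R ^+ 2 * (eta / 2) ^+ 2.
  rewrite -ler_pdivrMr// -/K; apply: (@le_trans _ _ k%:R).
    by apply/ltW/(lt_le_trans (truncnS_gt K)); rewrite ler_nat.
  by rewrite expr2 -natrM ler_nat leq_pmulr.
(* Entries within [2 * s] give an operator distance of at most [k ^ 2 * (2 * s) = e]. *)
pose s := e / (2 * (k * k)%:R).
have kk : 0 < (k * k)%:R :> R by rewrite ltr0n muln_gt0 k0.
have s0 : 0 < s by rewrite divr_gt0// mulr_gt0.
have [J [y [yr Jcard net]]] := @tuple_net n k r s r0 s0.
have eta20 : 0 < eta / 2 by rewrite divr_gt0.
pose good j u := `[< loops_small x (conj_tuple u (y j)) (eta / 2) m >].
(* The net has at most [b ^ a] points with [a = 2 * n * k ^ 2] and [b] of order [1 / s], that is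
   [k ^ 2]. As [b ^ a <= 2 ^ (a * b)], about [k ^ 4] halvings suffice. *)
pose t := (n * k * k * 2 * (Num.truncn (2 * r / s)).+1).+1.
have [||us [sus usU cover]] := @greedy_cover J _ (@unitary R k) good _ t [set: J].
- exact: (loop_halving k0 r1 eta20 xr yr kbig).
- rewrite cardsT; apply: leq_ltn_trans Jcard _.
  rewrite /t; set a := (n * k * k * 2)%N; set b := (Num.truncn _).+1.
  apply: (@leq_ltn_trans ((2 ^ b) ^ a)); last by rewrite -expnM mulnC ltn_exp2l.
  have bb : (b <= 2 ^ b)%N by exact/ltnW/ltn_expl.
  by case: (a) => [|a']; rewrite ?expn0// leq_exp2r.
exists us; split.
- rewrite sus /t; have tb : ((Num.truncn (2 * r / s)).+1 <= c1 * (k * k))%N.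
    have rs : 2 * r / s = 4 * r / e * (k * k)%:R.
      by rewrite /s; field; rewrite !gt_eqF// ltr0n.
    have rs0 : 0 <= 2 * r / s by rewrite divr_ge0 ?(ltW s0)// mulr_ge0.
    apply: (@leq_trans ((Num.truncn (4 * r / e)).+1 * (k * k))); last by rewrite leq_mul2r leqnSn orbT.
    rewrite truncn_lt_nat// natrM rs ltr_pM2r//; exact: truncnS_gt.
  have k4 : (k ^ 4 = k * k * (k * k))%N by rewrite !expnS expn0 muln1 !mulnA.
  rewrite k4 mulnDl mul1n -addn1 leq_add ?muln_gt0 ?k0//.
  apply: leq_trans (leq_mul (leqnn _) tb) _.
  by rewrite (_ : n * k * k * 2 * (c1 * (k * k)) = n * 2 * c1 * (k * k * (k * k)))%N//; ring.
- by move=> i; rewrite sus => it; exact: usU.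
- move=> y' yr'; have [j jy] := net y' yr'.
  have /(has_nthP 0)[i ius /asboolP small] := cover j (finset.in_setT j).
  exists i => // w wm; rewrite -[joint_loop _ _ _](subrK (joint_loop x (conj_tuple (nth 0 us i) (y j)) w)).
  have uu : unitary (nth 0 us i) by apply: usU; rewrite -sus.
  apply: le_trans (cabsD _ _) _; rewrite [eta]splitr; apply: lerD; last exact: small.
  apply: le_trans Le.
  apply: (joint_loop_lipschitz r1 (ltW e0) xr
    (fun l => opbd_conj r0 uu (yr' l)) (fun l => opbd_conj r0 uu (yr j l)) _ wm).
  move=> i'; rewrite /conj_tuple -uconjB; apply: (opbd_conj (ltW e0) uu).
  have -> : e = (k * k)%:R * (2 * s).
    by rewrite /s; move: kk; move: (k * k)%:R => kk kk0; field; rewrite gt_eqF.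
  by apply: opbd_entries => a b; rewrite !mxE.
Qed.

End RotationFamily.

(** * The loop equation and freeness *)

Section Reconstruction.
Context {R : realType}.
Local Notation C := R[i].
Variables (q : nat) (isy : pred 'I_q).
Implicit Types (w v p : seq 'I_q) (tau sigma : seq 'I_q -> C).

Lemma words_bound (f : seq 'I_q -> R) (m : nat) :
  exists2 B, 0 <= B & forall w, (size w <= m)%N -> f w <= B.
Proof.
exists (\sum_(w : m.-bseq 'I_q) `|f w|); first exact: sumr_ge0.
move=> w wm; apply: le_trans (ler_norm _) _.
by rewrite (bigD1 (Bseq wm))//= lerDl sumr_ge0.
Qed.

(** Read cyclically, a mixed word has an [isy] letter directly followed by one that is not; the word
    is cut there. The rotation by [j] first brings an [isy] letter to the front. *)
Lemma rot_mixed w : has isy w -> has (predC isy) w ->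
  exists i j x v y, [/\ rot i (rot j w) = x :: rcons v y, ~~ isy x & isy y].
Proof.
have start_y y w' : isy y -> has (predC isy) (y :: w') ->
    exists i x v z, [/\ rot i (y :: w') = x :: rcons v z, ~~ isy x & isy z].
  move=> yy hw; pose i := find (predC isy) (y :: w').
  have iw : (i < size (y :: w'))%N by rewrite -has_find.
  have nx : ~~ isy (nth y (y :: w') i) by have := nth_find y hw.
  have i0 : (0 < i)%N by rewrite /i /= yy.
  exists i, (nth y (y :: w') i).
  have [i' ii'] : exists i', i = i'.+1 by exists i.-1; rewrite prednK.
  exists (drop i.+1 (y :: w') ++ take i' (y :: w')), (nth y (y :: w') i'); split => //.
    rewrite /rot (drop_nth y iw) rcons_cat -take_nth -?ii'//.
    by rewrite ltnW// -ii'.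
  have := @before_find _ y (predC isy) (y :: w') i'.
  by rewrite -/i ii' ltnSn => /(_ isT) /negbFE.
case: w => [//|x w] hy hx; have [xy|xn] := boolP (isy x).
  by have [i [x' [v [z h]]]] := start_y x w xy hx; exists i, 0%N, x', v, z; rewrite rot0.
pose j := find isy (x :: w).
have jw : (j < size (x :: w))%N by rewrite -has_find.
have hr : has (predC isy) (rot j (x :: w)) by rewrite has_rot.
have rE : rot j (x :: w) = nth x (x :: w) j :: (drop j.+1 (x :: w) ++ take j (x :: w)).
  by rewrite /rot (drop_nth x jw).
move: hr; rewrite rE => /(start_y _ _ (nth_find x hy)) [i [x' [v [z h]]]]; exists i, j, x', v, z.
by rewrite rE.
Qed.

(** With a nonempty prefix, the moment of the whole word enters the loop only once, from the last
    letter, multiplied by the moment 1 of the empty word. All other terms are products of moments of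
    shorter words. *)
Lemma loop_top tau sigma (B e : R) p v y : isy y -> (0 < size p)%N -> 0 <= B -> 0 <= e ->
  tau [::] = 1 -> sigma [::] = 1 ->
  (forall w, (size w <= size p + size v)%N ->
     [/\ cabs (tau w) <= B, cabs (sigma w) <= B & cabs (tau w - sigma w) <= e]) ->
  cabs ((loop isy tau p (rcons v y) - tau (p ++ rcons v y)) -
        (loop isy sigma p (rcons v y) - sigma (p ++ rcons v y))) <=
    4 * B * e * (size v).+1%:R.
Proof.
move=> yy + B0 e0 t1 s1; elim: v p => [|i v IH] p p0 bd.
  rewrite /= yy t1 s1 !mulr1 !addr0 !cats1.
  have [|h1 h2 h3] := bd p; first by rewrite addn0.
  have [|g1 g2 g3] := bd [:: y]; first by rewrite addn0.
  have -> : tau (rcons p y) - tau p * tau [:: y] - tau (rcons p y) -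
      (sigma (rcons p y) - sigma p * sigma [:: y] - sigma (rcons p y)) =
      - (tau p * tau [:: y] - sigma p * sigma [:: y]) by ring.
  rewrite cabsN; apply: le_trans (mul_lipschitz h1 g2 h3 g3) _.
  by rewrite -!mulrA ler_wpM2r ?mulr_ge0// ler_nat.
rewrite rcons_cons -cat_rcons.
have := IH (rcons p i); rewrite size_rcons addSnnS => /(_ isT bd).
rewrite /=; set X := (_ - _ - (_ - _)) => hX.
pose d (t : seq 'I_q -> C) := if isy i then t (rcons p i) * t (rcons v y) - t p * t (i :: rcons v y) else 0.
have -> : (if isy i then tau (rcons p i) * tau (rcons v y) - tau p * tau (i :: rcons v y) else 0) +
    loop isy tau (rcons p i) (rcons v y) - tau (rcons p i ++ rcons v y) -
   ((if isy i then sigma (rcons p i) * sigma (rcons v y) - sigma p * sigma (i :: rcons v y) else 0) +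
    loop isy sigma (rcons p i) (rcons v y) - sigma (rcons p i ++ rcons v y)) =
   X + (d tau - d sigma) by rewrite /X /d; ring.
rewrite -[(size v).+2%:R]natr1 mulrDr mulr1.
apply: le_trans (cabsD _ _) _; apply: lerD => //.
rewrite /d; case: (isy i); last by rewrite subrr cabs0 !mulr_ge0.
have [|h1 h2 h3] := bd (rcons p i); first by rewrite size_rcons /= addnS ltnS leq_addr.
have [|g1 g2 g3] := bd (rcons v y); first by rewrite size_rcons leq_addl.
have [|k1 k2 k3] := bd p; first by rewrite leq_addr.
have [|l1 l2 l3] := bd (i :: rcons v y).
  by rewrite /= size_rcons -(addn1 (size v).+1) addnC leq_add2r.
have -> : tau (rcons p i) * tau (rcons v y) - tau p * tau (i :: rcons v y) -
  (sigma (rcons p i) * sigma (rcons v y) - sigma p * sigma (i :: rcons v y)) =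
  (tau (rcons p i) * tau (rcons v y) - sigma (rcons p i) * sigma (rcons v y)) -
  (tau p * tau (i :: rcons v y) - sigma p * sigma (i :: rcons v y)) by ring.
apply: le_trans (cabsB _ _) _.
have := mul_lipschitz h1 g2 h3 g3; have := mul_lipschitz k1 l2 k3 l3; lra.
Qed.

(** Induction on the length. A mixed word is rotated to begin outside [isy] and end in [isy]; the
    loop equation then expresses its moment by shorter ones. *)
Lemma moment_reconstruction sigma m : sigma [::] = 1 ->
  (forall i w, sigma (rot i w) = sigma w) -> (forall w, loop isy sigma [::] w = 0) ->
  exists2 K, 0 <= K & forall tau (e : R), 0 <= e <= 1 ->
    tau [::] = 1 -> (forall i w, tau (rot i w) = tau w) ->
    (forall w, (size w <= m)%N -> all isy w || all (predC isy) w ->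
       cabs (tau w - sigma w) <= e) ->
    (forall w, (size w <= m)%N -> cabs (loop isy tau [::] w) <= e) ->
    forall w, (size w <= m)%N -> cabs (tau w - sigma w) <= K * e.
Proof.
move=> s1 srot sloop; elim: m => [|m [K K0 IH]].
  exists 0 => // tau e /andP[e0 _] t1 _ _ _ w; rewrite leqn0 size_eq0 => /eqP ->.
  by rewrite t1 s1 subrr cabs0 mulr_ge0.
have [B0 B00 B0P] := words_bound (fun w => cabs (sigma w)) m.
pose B := B0 + K; have Bge : 0 <= B by rewrite addr_ge0.
(* The 1 pays for pure words or for the loop defect, [K] for words already treated, and the last
   term for the error of [loop_top] with [K * e] in the role of [e]. *)
exists (1 + K + 4 * B * K * m.+1%:R).
  by rewrite !addr_ge0// !mulr_ge0.
move=> tau e e01 t1 trot tpure tloop w; rewrite leq_eqVlt; have /andP[e0 e1] := e01.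
have short v : (size v <= m)%N -> cabs (tau v - sigma v) <= K * e.
  apply: IH => // [v' v'm|v' v'm]; first by apply: tpure; exact: leqW.
  by apply: tloop; exact: leqW.
have KB : 0 <= 4 * B * K * m.+1%:R by rewrite !mulr_ge0.
case/orP=> [/eqP wm|]; last first.
  rewrite ltnS => /short/le_trans; apply; rewrite ler_wpM2r//; lra.
have [pure|] := boolP (all isy w || all (predC isy) w).
  apply: le_trans (tpure _ _ pure) _; first by rewrite wm.
  by rewrite ler_peMl//; lra.
rewrite negb_or -!has_predC => /andP[h1 h2].
have h2' : has isy w by apply: sub_has h2 => z /= /negPn.
have [i [j [x [v [y [rw nx yy]]]]]] := rot_mixed h2' h1.
rewrite -(trot j) -(trot i) -(srot j) -(srot i) rw.
have sz : size v = m.-1 /\ (0 < m)%N.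
  have : size (rot i (rot j w)) = m.+1 by rewrite !size_rot.
  by rewrite rw /= size_rcons => -[<-].
have {sz} [sv m0] := sz.
have bd u : (size u <= size [:: x] + size v)%N ->
    [/\ cabs (tau u) <= B, cabs (sigma u) <= B & cabs (tau u - sigma u) <= K * e].
  rewrite sv add1n prednK// => um; have h := short u um; split => //.
    rewrite -[tau u](subrK (sigma u)); apply: le_trans (cabsD _ _) _.
    rewrite addrC /B; apply: lerD; first exact: B0P.
    by apply: le_trans h _; rewrite ler_piMr.
  by apply: le_trans (B0P _ um) _; rewrite lerDl.
have := loop_top yy (isT : (0 < size [:: x])%N) Bge (mulr_ge0 K0 e0) t1 s1 bd.
(* The first letter is outside [isy] and contributes nothing, so the loop may start from the
   nonempty prefix that [loop_top] asks for. *)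
have lx t : loop isy t [:: x] (rcons v y) = loop isy t [::] (x :: rcons v y).
  by rewrite /= (negbTE nx) add0r.
rewrite !lx sloop sub0r opprK sv prednK// => ht.
have lw : (size (x :: rcons v y) <= m.+1)%N by rewrite /= size_rcons sv prednK.
have := tloop _ lw; set l := loop _ _ _ _ => hl.
have -> : tau (x :: rcons v y) - sigma (x :: rcons v y) =
  l - (l - tau ([:: x] ++ rcons v y) + sigma ([:: x] ++ rcons v y)) by rewrite /=; ring.
apply: le_trans (cabsB _ _) _.
apply: le_trans (lerD hl ht) _.
have -> : (1 + K + 4 * B * K * m.+1%:R) * e = e + K * e + 4 * B * K * m.+1%:R * e by ring.
have : 0 <= K * e by rewrite mulr_ge0.
have : 4 * B * (K * e) * m%:R <= 4 * B * K * m.+1%:R * e.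
  have -> : 4 * B * (K * e) * m%:R = 4 * B * K * e * m%:R by ring.
  have -> : 4 * B * K * m.+1%:R * e = 4 * B * K * e * m.+1%:R by ring.
  by rewrite ler_wpM2l ?ler_nat// !mulr_ge0.
lra.
Qed.

End Reconstruction.

Section VonNeumannClosure.
Context {R : realType} {H : completeNormedModType R[i]}.
Variable ip : {dot H for Num.conj}.
Variable M : set (H -> H).
Hypothesis MvN : von_neumann_algebra ip M.
Implicit Types S T : H -> H.

Lemma vN_bounded T : M T -> bounded_op T.
Proof. by case: MvN => _ <- [[]]. Qed.

Lemma vN_idfun : M idfun.
Proof.
case: MvN => _ <-; split; first by split=> // v; exact: cvg_id.
by move=> S _.
Qed.

Lemma vN_comp S T : M S -> M T -> M (S \o T).
Proof.
case: MvN => _ <- [[Sl Sc] Scom] [[Tl Tc] Tcom]; split.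
  split; first by move=> c u v /=; rewrite Tl Sl.
  by move=> v; apply: continuous_comp; [exact: Tc|exact: Sc].
move=> V hV; have h1 := Scom V hV; have h2 := Tcom V hV.
apply/funext => v /=; have := congr1 (fun f => f (T v)) h1.
have := congr1 (fun f => f v) h2 => /= -> <-.
by [].
Qed.

Lemma vN_linear c S T : M S -> M T -> M (c *: S + T).
Proof.
case: MvN => _ <- [[Sl Sc] Scom] [[Tl Tc] Tcom].
have E w : (c *: S + T) w = c *: S w + T w by [].
split.
  split.
    move=> d u v; rewrite !E Sl Tl !scalerDr !scalerA [c * d]mulrC.
    by rewrite addrACA.
  by move=> v; apply: cvgD; [apply: cvgZl_tmp; exact: Sc|exact: Tc].
move=> V hV; have h1 := Scom V hV; have h2 := Tcom V hV.
have [[Vl _] _] := hV.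
apply/funext => v; have := congr1 (fun f => f v) h1; have := congr1 (fun f => f v) h2.
by rewrite /= !E => -> ->; rewrite -Vl.
Qed.

Lemma unital_algebra_vN A T : A `<=` M -> unital_algebra A T -> M T.
Proof.
move=> AM; elim=> [S /AM//||c S V _ hS _ hV|S V _ hS _ hV].
- exact: vN_idfun.
- exact: vN_linear.
- exact: vN_comp.
Qed.

End VonNeumannClosure.

Section FreeLoop.
Context {R : realType} {H : completeNormedModType R[i]}.
Local Notation C := R[i].
Variable ip : {dot H for Num.conj}.
Variable M : set (H -> H).
Hypothesis MvN : von_neumann_algebra ip M.
Variable phi : (H -> H) -> C.
Hypothesis phi_state : normal_tracial_state ip M phi.
Implicit Types (S T P Q : H -> H) (s : seq (bool * (H -> H))).

Let phi_linear c S T : M S -> M T -> phi (c *: S + T) = c * phi S + phi T.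
Proof. exact: (nts_linear phi_state). Qed.

Let comp := vN_comp MvN.
Let lin := vN_linear MvN.

Definition letters_in s := forall i, (i < size s)%N -> M (nth (false, idfun) s i).2.

Definition prod_op s : H -> H := foldr (fun p T => p.2 \o T) idfun s.

Lemma prod_op_cat s1 s2 : prod_op (s1 ++ s2) = prod_op s1 \o prod_op s2.
Proof. by elim: s1 => //= p s ->. Qed.

Lemma letters_in_cons p s : letters_in (p :: s) <-> M p.2 /\ letters_in s.
Proof.
split=> [h|[hp hs]]; last by case=> [//|i]; exact: hs.
by split; [exact: (h 0%N isT)|move=> i; exact: (h i.+1)].
Qed.

Lemma prod_op_in s : letters_in s -> M (prod_op s).
Proof.
elim: s => [_|p s IH /letters_in_cons[hp /IH hs]] /=; first exact: vN_idfun MvN.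
exact: comp.
Qed.

(* The [loop] of the word [s] read between the operators [P] and [Q]. *)
Fixpoint op_loop P s Q : C :=
  if s is p :: s' then
    (if p.1 then phi (P \o p.2) * phi (prod_op s' \o Q) - phi P * phi (p.2 \o prod_op s' \o Q)
     else 0) + op_loop (P \o p.2) s' Q
  else 0.

Lemma op_loop_cat P s1 s2 Q : op_loop P (s1 ++ s2) Q =
  op_loop P s1 (prod_op s2 \o Q) + op_loop (P \o prod_op s1) s2 Q.
Proof.
elim: s1 P => [|p s1 IH] P /=; first by rewrite add0r.
by rewrite IH prod_op_cat addrA.
Qed.

Lemma op_loop_linear_prefix c P1 P2 s Q : M P1 -> M P2 -> letters_in s -> M Q ->
  op_loop (c *: P1 + P2) s Q = c * op_loop P1 s Q + op_loop P2 s Q.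
Proof.
move=> + + + MQ; elim: s P1 P2 => [|p s IH] P1 P2 MP1 MP2 /=; first by rewrite mulr0 addr0.
move=> /letters_in_cons[Mp Ms].
have E : (c *: P1 + P2) \o p.2 = c *: (P1 \o p.2) + (P2 \o p.2) by [].
rewrite E IH//; try exact: comp.
case: p.1; last by ring.
by rewrite !phi_linear//; [ring|exact: comp|exact: comp].
Qed.

Lemma op_linear P c S T : M P -> P \o (c *: S + T) = c *: (P \o S) + (P \o T).
Proof.
move=> MP; have [Pl _] := vN_bounded MvN MP.
by apply/funext => v /=; rewrite /GRing.add /GRing.scale /= Pl.
Qed.

Lemma op_loop_linear_suffix c P s Q1 Q2 : M P -> letters_in s -> M Q1 -> M Q2 ->
  op_loop P s (c *: Q1 + Q2) = c * op_loop P s Q1 + op_loop P s Q2.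
Proof.
move=> + + MQ1 MQ2; elim: s P => [|p s IH] P MP /=; first by rewrite mulr0 addr0.
move=> /letters_in_cons[Mp Ms]; rewrite IH//; last exact: comp.
have Mps := comp Mp (prod_op_in Ms); have MPs := prod_op_in Ms.
case: p.1; last by ring.
rewrite (op_linear _ _ _ MPs) (op_linear _ _ _ Mps).
rewrite (phi_linear _ (comp MPs MQ1) (comp MPs MQ2)).
by rewrite (phi_linear _ (comp Mps MQ1) (comp Mps MQ2)); ring.
Qed.

(** The two terms at the cut between [S] and [T] have opposite signs and cancel. *)
Lemma op_loop_merge P b S T s Q :
  op_loop P ((b, S) :: (b, T) :: s) Q = op_loop P ((b, S \o T) :: s) Q.
Proof.
rewrite /=; case: b => /=; last by rewrite !add0r.
rewrite addrA; congr (_ + _).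
rewrite -[S \o (T \o prod_op s) \o Q]/(S \o T \o prod_op s \o Q).
rewrite -[P \o S \o T]/(P \o (S \o T)).
ring.
Qed.

(** A scalar letter contributes two equal terms of opposite sign, so in the loop it amounts to its
    deletion. *)
Lemma op_loop_center c b T s1 s2 : letters_in s1 -> letters_in s2 -> M T ->
  op_loop idfun (s1 ++ (b, c *: idfun + T) :: s2) idfun =
  op_loop idfun (s1 ++ (b, T) :: s2) idfun + c * op_loop idfun (s1 ++ s2) idfun.
Proof.
move=> M1 M2 MT; have Mid := vN_idfun MvN; have Ms1 := prod_op_in M1; have Ms2 := prod_op_in M2.
have MTs := comp MT Ms2.
rewrite !op_loop_cat.
have E : prod_op ((b, c *: idfun + T) :: s2) = c *: prod_op s2 + (T \o prod_op s2) by [].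
rewrite E -[(c *: prod_op s2 + (T \o prod_op s2)) \o idfun]/(c *: prod_op s2 + (T \o prod_op s2)).
rewrite (op_loop_linear_suffix _ Mid M1 Ms2 MTs) /=.
have -> : idfun \o prod_op s1 = prod_op s1 by [].
rewrite (op_linear _ _ _ Ms1).
have id_r S : S \o idfun = S by [].
rewrite !id_r (op_loop_linear_prefix _ Ms1 (comp Ms1 MT) M2 Mid).
have -> : (c *: idfun + T) \o prod_op s2 = c *: prod_op s2 + (T \o prod_op s2) by [].
case: b {E}; last by ring.
by rewrite (phi_linear _ Ms1 (comp Ms1 MT)) (phi_linear _ Ms2 MTs); ring.
Qed.

Definition centered_alternating (A : bool -> set (H -> H)) :=
  fix ca (b : bool) s : Prop :=
    if s is p :: s' then [/\ p.1 = b, unital_algebra (A b) p.2, phi p.2 = 0 & ca (~~ b) s']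
    else True.

Variable A : bool -> set (H -> H).
Hypothesis AM : forall b, A b `<=` M.
Hypothesis A_free : free_sets phi (A true) (A false).
Local Notation alt := (centered_alternating A).

Lemma alt_nth b s : alt b s -> forall i, (i < size s)%N ->
  unital_algebra (A (odd i (+) b)) (nth (false, idfun) s i).2 /\
  phi (nth (false, idfun) s i).2 = 0.
Proof.
elim: s b => [//|p s IH] b [_ hp p0 hs] [_|i]; first by [].
rewrite ltnS => /(IH _ hs) /=.
by rewrite addNb addbN.
Qed.

Lemma alt_phi b s : alt b s -> (0 < size s)%N -> phi (prod_op s) = 0.
Proof.
move=> hs s0.
have := @A_free (size s) (fun i => (nth (false, idfun) s i).2) b s0.
rewrite (_ : \big[_/_]_(0 <= i < size s) _ = prod_op s).
  apply=> i /(alt_nth hs)[] // + _.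
  by case: (odd i (+) b).
rewrite -(big_nth (false, idfun) xpredT (fun p => p.2)).
by elim: s {hs s0} => [|p s IH]; rewrite ?big_nil// big_cons IH.
Qed.

Lemma alt_cat b s1 s2 : alt b (s1 ++ s2) <-> alt b s1 /\ alt (odd (size s1) (+) b) s2.
Proof.
elim: s1 b => [|p s1 IH] b /=; first by split=> [|[]].
rewrite addNb -addbN; split=> [[h1 h2 h3 /IH[h4 h5]]|[[h1 h2 h3 h4] h5]]; split=> //.
by apply/IH.
Qed.

(** Either product in a term has a factor whose word contains the current letter. That word is
    nonempty, centered and alternating, so freeness makes the factor vanish. *)
Lemma op_loop_alt b s : alt b s -> op_loop idfun s idfun = 0.
Proof.
move=> hs; suff main s1 s2 : s = s1 ++ s2 -> op_loop (prod_op s1) s2 idfun = 0.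
  by have := main [::] s erefl.
elim: s2 s1 => [//|p s2 IH] s1 E /=.
have E2 : s = rcons s1 p ++ s2 by rewrite cat_rcons.
have Ep : prod_op (rcons s1 p) = prod_op s1 \o p.2 by rewrite -cats1 prod_op_cat.
have -> : op_loop (prod_op s1 \o p.2) s2 idfun = 0 by rewrite -Ep; exact: IH.
case: p.1; last by rewrite addr0.
have h1 : alt b (rcons s1 p) by have := hs; rewrite E2 alt_cat => -[].
have h2 : alt (odd (size s1) (+) b) (p :: s2) by have := hs; rewrite E alt_cat => -[].
rewrite -Ep (alt_phi h1) ?size_rcons// mul0r sub0r.
have -> : (p.2 \o prod_op s2) \o idfun = prod_op (p :: s2) by [].
by rewrite (alt_phi h2)// mulr0 oppr0 addr0.
Qed.

Definition tagged_in s := forall i, (i < size s)%N ->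
  unital_algebra (A (nth (false, idfun) s i).1) (nth (false, idfun) s i).2.

Lemma tagged_in_cons p s : tagged_in (p :: s) <-> unital_algebra (A p.1) p.2 /\ tagged_in s.
Proof.
split=> [h|[hp hs]]; last by case=> [//|i]; exact: hs.
by split; [exact: (h 0%N isT)|move=> i; exact: (h i.+1)].
Qed.

Lemma tagged_in_cat s1 s2 : tagged_in (s1 ++ s2) <-> tagged_in s1 /\ tagged_in s2.
Proof.
elim: s1 => [|p s1 IH] /=; first by split=> [h|[]//]; split => // -[].
rewrite !tagged_in_cons IH; tauto.
Qed.

Lemma tagged_letters s : tagged_in s -> letters_in s.
Proof. by move=> h i /h /(unital_algebra_vN MvN (@AM _)). Qed.

Lemma alt_tagged b s : alt b s -> tagged_in s.
Proof.
elim: s b => [_ _ []//|p s IH] b [pb hp _ /IH hs].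
by apply/tagged_in_cons; split => //; rewrite pb.
Qed.

(* Equal neighbouring tags are merged; otherwise the next letter is centered, at the price of
   deleting it. Both operations shorten the word. *)
Lemma op_loop_free s : tagged_in s -> op_loop idfun s idfun = 0.
Proof.
have [N] := ubnP (size s); elim: N s => // N IHN s; rewrite ltnS => sN hs.
(* [s1] is the part already centered and alternating. The inner induction feeds it from [s2]; the
   outer one, on the length, disposes of the shorter words that arise. *)
suff main s1 s2 b : alt b s1 -> tagged_in s2 -> (size (s1 ++ s2) <= N)%N ->
    op_loop idfun (s1 ++ s2) idfun = 0 by exact: (main [::] s true).
elim: s2 s1 b => [|p s2 IH] s1 b alt1; first by rewrite cats0 => _ _; exact: op_loop_alt alt1.
move=> /tagged_in_cons[hp hs2] size12.
have hs1 := alt_tagged alt1.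
have Mp := unital_algebra_vN MvN (@AM _) hp.
(* The centered part of the letter extends the prefix and its scalar part deletes the letter. The
   tag [b'] is left open because an empty prefix may start with either algebra. *)
have center b' : alt b' s1 -> p.1 = odd (size s1) (+) b' ->
    op_loop idfun (s1 ++ p :: s2) idfun = 0.
  move=> alt1' pb.
  have := @op_loop_center (phi p.2) p.1 (- phi p.2 *: idfun + p.2) s1 s2
    (tagged_letters hs1) (tagged_letters hs2) (lin _ (vN_idfun MvN) Mp).
  rewrite addrA -scalerDl subrr scale0r add0r -surjective_pairing => ->.
  have hT : unital_algebra (A p.1) (- phi p.2 *: idfun + p.2).
    by apply: ua_linear => //; exact: ua_unit.
  have -> : op_loop idfun (s1 ++ (p.1, - phi p.2 *: idfun + p.2) :: s2) idfun = 0.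
    rewrite -cat_rcons -cats1; apply: (IH _ b') => //.
      apply/alt_cat; split => //; split=> //=; first by rewrite -pb.
      by rewrite phi_linear ?(nts_unit phi_state) ?mulr1 ?addNr//; exact: vN_idfun MvN.
    by rewrite cats1 cat_rcons; move: size12; rewrite !size_cat.
  rewrite add0r IHN ?mulr0//; last by apply/tagged_in_cat.
  by apply: leq_trans size12; rewrite !size_cat /= addnS.
case/lastP: s1 => [|s1 p1] in alt1 hs1 size12 IH center *.
  by apply: (center p.1) => //=; rewrite addbF.
have [pb|pb] := eqVneq p.1 (odd (size (rcons s1 p1)) (+) b); first exact: center alt1 pb.
have p1b : p1.1 = p.1.
  move: alt1; rewrite -cats1 alt_cat => -[_ [-> _ _ _]].
  by move: pb; rewrite size_rcons /= addNb; case: p.1; case: (_ (+) _).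
rewrite cat_rcons op_loop_cat.
have -> : prod_op (p1 :: p :: s2) = prod_op ((p.1, p1.2 \o p.2) :: s2) by [].
rewrite [p1]surjective_pairing [X in _ :: X :: _]surjective_pairing p1b op_loop_merge -op_loop_cat.
apply: IHN.
  by move: size12; rewrite cat_rcons !size_cat /= !addnS => /leq_trans; apply.
apply/tagged_in_cat; move: hs1; rewrite -cats1 tagged_in_cat tagged_in_cons => -[h1 [h2 _]].
split => //; apply/tagged_in_cons; split => //=; apply: ua_comp => //.
by rewrite -p1b.
Qed.

Lemma word_op_nil q (c : 'I_q -> H -> H) : word_op c [::] = idfun.
Proof. by rewrite /word_op big_nil. Qed.

Lemma word_op_cons q (c : 'I_q -> H -> H) i w : word_op c (i :: w) = c i \o word_op c w.
Proof. by rewrite /word_op big_cons. Qed.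

Lemma word_op_cat q (c : 'I_q -> H -> H) w1 w2 :
  word_op c (w1 ++ w2) = word_op c w1 \o word_op c w2.
Proof.
by elim: w1 => [|i w1 IH]; rewrite ?word_op_nil// cat_cons !word_op_cons IH.
Qed.

Lemma word_op_in q (c : 'I_q -> H -> H) w : (forall i, M (c i)) -> M (word_op c w).
Proof.
move=> Mc; elim: w => [|i w IH]; first by rewrite word_op_nil; exact: vN_idfun MvN.
by rewrite word_op_cons; exact: comp.
Qed.

Lemma loop_free q (isy : pred 'I_q) (c : 'I_q -> H -> H) w :
  (forall i, A (isy i) (c i)) -> loop isy (fun v => phi (word_op c v)) [::] w = 0.
Proof.
move=> cA; pose f i := (isy i, c i).
have prodE v : prod_op (map f v) = word_op c v.
  by elim: v => [|i v IH]; rewrite ?word_op_nil// word_op_cons /= IH.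
have -> : loop isy (fun v => phi (word_op c v)) [::] w = op_loop idfun (map f w) idfun.
  suff main p : loop isy (fun v => phi (word_op c v)) p w = op_loop (word_op c p) (map f w) idfun.
    by rewrite main word_op_nil.
  elim: w p => [//|i w IH] p /=.
  by rewrite IH prodE -cats1 word_op_cat !word_op_cons word_op_nil.
apply: op_loop_free; elim: w => [//|i w IH]; rewrite /= tagged_in_cons.
by split => //; apply: ua_gen; exact: cA.
Qed.

Lemma phi_rot q (c : 'I_q -> H -> H) i w : (forall i, M (c i)) ->
  phi (word_op c (rot i w)) = phi (word_op c w).
Proof.
move=> Mc; rewrite /rot word_op_cat (nts_tracial phi_state); try exact: word_op_in.
by rewrite -word_op_cat cat_take_drop.
Qed.

End FreeLoop.

(** * Microstates *)

Section Substitution.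
Context {R : realType} {H : completeNormedModType R[i]}.
Local Notation C := R[i].
Variable ip : {dot H for Num.conj}.
Variable M : set (H -> H).
Hypothesis MvN : von_neumann_algebra ip M.
Variable phi : (H -> H) -> C.
Hypothesis phi_state : normal_tracial_state ip M phi.
Variables p q : nat.
Implicit Types (w : seq 'I_q) (v : seq 'I_p).

Definition mx_letter k (z : 'I_p -> 'M[C]_k) (l : seq (C * 'I_p)) : 'M[C]_k :=
  \sum_(t <- l) t.1 *: z t.2.

Definition op_letter (c : 'I_p -> H -> H) (l : seq (C * 'I_p)) : H -> H :=
  \sum_(t <- l) t.1 *: c t.2.

Variable T : 'I_q -> seq (C * 'I_p).

(** The multilinear expansion of [w] after its letters are replaced by the linear combinations
    [T j]. The same coefficients serve matrices and operators, so moment errors are transferred term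
    by term. *)
Fixpoint expansion w : seq (C * seq 'I_p) :=
  if w is j :: w' then [seq (t.1 * u.1, t.2 :: u.2) | t <- T j, u <- expansion w']
  else [:: (1, [::])].

Lemma size_expansion w u : u \in expansion w -> size u.2 = size w.
Proof.
elim: w u => [|j w IH] u /=; first by rewrite inE => /eqP ->.
by move=> /allpairsP[[t u'] [_ /IH hu ->]] /=; rewrite hu.
Qed.

Lemma expansion_mx k (z : 'I_p -> 'M[C]_k) w :
  word_mx (fun j => mx_letter z (T j)) w = \sum_(u <- expansion w) u.1 *: word_mx z u.2.
Proof.
elim: w => [|j w IH]; first by rewrite big_seq1 scale1r !word_mx_nil.
rewrite word_mx_cons IH /mx_letter /= big_allpairs_dep mulmx_suml; apply: eq_bigr => t _.
rewrite mulmx_sumr; apply: eq_bigr => u _ /=.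
by rewrite word_mx_cons -scalemxAl -scalemxAr scalerA.
Qed.

Lemma op_sumE (I : Type) (r : seq I) (F : I -> H -> H) x : (\sum_(i <- r) F i) x = \sum_(i <- r) F i x.
Proof. by elim: r => [|i r IH]; rewrite ?big_nil// !big_cons -IH. Qed.

Lemma expansion_op (c : 'I_p -> H -> H) w : (forall i, M (c i)) ->
  word_op (fun j => op_letter c (T j)) w = \sum_(u <- expansion w) u.1 *: word_op c u.2.
Proof.
move=> Mc; elim: w => [|j w IH]; first by rewrite big_seq1 scale1r !word_op_nil.
rewrite word_op_cons IH /op_letter /= big_allpairs_dep; apply/funext => x /=.
rewrite !op_sumE; apply: eq_bigr => t _; rewrite op_sumE.
have [cl _] := vN_bounded MvN (Mc t.2).
have E (d : C) (S : H -> H) y : (d *: S) y = d *: S y by [].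
rewrite E; have c0 : c t.2 0 = 0.
  by have := cl (-1) 0 0; rewrite !scaler0 addr0 scaleN1r addNr.
have csum (r : seq (C * seq 'I_p)) : c t.2 (\sum_(u <- r) (u.1 *: word_op c u.2) x) =
    \sum_(u <- r) u.1 *: c t.2 (word_op c u.2 x).
  elim: r => [|u r IHr]; first by rewrite !big_nil.
  by rewrite !big_cons -IHr E cl.
rewrite csum scaler_sumr; apply: eq_bigr => u _.
by rewrite scalerA word_op_cons.
Qed.

Lemma vN0 : M 0.
Proof.
have := vN_linear MvN (-1) (vN_idfun MvN) (vN_idfun MvN).
by rewrite scaleN1r addNr.
Qed.

Lemma phi0 : phi 0 = 0.
Proof.
have := nts_linear phi_state (-1) (vN_idfun MvN) (vN_idfun MvN).
by rewrite scaleN1r addNr mulN1r addNr.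
Qed.

Lemma phi_sum (I : Type) (r : seq I) (d : I -> C) (F : I -> H -> H) : (forall i, M (F i)) ->
  M (\sum_(i <- r) d i *: F i) /\
  phi (\sum_(i <- r) d i *: F i) = \sum_(i <- r) d i * phi (F i).
Proof.
move=> MF; elim: r => [|i r [IH1 IH2]]; first by rewrite !big_nil; split; [exact: vN0|exact: phi0].
rewrite !big_cons; split; first exact: vN_linear MvN _ _ _ (MF i) IH1.
by rewrite (nts_linear phi_state _ (MF i) IH1) IH2.
Qed.

(** The constant is the largest sum of moduli of coefficients in an expansion. It depends on [T] and
    [m] only, not on [k] or on the matrices. *)
Lemma moment_subst (m : nat) : exists2 K : R, 0 <= K &
  forall k (z : 'I_p -> 'M[C]_k) (c : 'I_p -> H -> H) (e : R), (forall i, M (c i)) -> 0 <= e ->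
  (forall v, (1 <= size v <= m)%N -> cabs (mx_moment z v - phi (word_op c v)) <= e) ->
  forall w, (1 <= size w <= m)%N ->
    cabs (mx_moment (fun j => mx_letter z (T j)) w - phi (word_op (fun j => op_letter c (T j)) w))
      <= K * e.
Proof.
have [K K0 KP] := words_bound (fun w => \sum_(u <- expansion w) cabs u.1) m.
exists K => // k z c e Mc e0 zc w wm.
rewrite /mx_moment expansion_mx expansion_op//.
have [_ ->] := phi_sum (expansion w) (fun u => u.1) (fun u => word_op_in MvN u.2 Mc).
have -> : normalized_trace (\sum_(u <- expansion w) u.1 *: word_mx z u.2) =
    \sum_(u <- expansion w) u.1 * mx_moment z u.2.
  rewrite /normalized_trace linear_sum mulr_suml; apply: eq_bigr => u _.
  by rewrite linearZ /= mulrA.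
rewrite -sumrB; apply: le_trans (cabs_sum _ _ _) _.
have /andP[_ wm'] := wm.
apply: (@le_trans _ _ ((\sum_(u <- expansion w) cabs u.1) * e)); last first.
  by rewrite ler_wpM2r// KP.
rewrite mulr_suml big_seq [leRHS]big_seq; apply: ler_sum => u uw.
rewrite -mulrBr cabsM ler_wpM2l ?cabs_ge0//; apply: zc.
by rewrite (size_expansion uw).
Qed.

End Substitution.

Arguments Gamma {R H} phi {q} c r m k gamma _.
Arguments Gamma_rel {R H} phi {n p} c b r m k gamma _.

Section ConcatLemmas.
Variables (T : Type) (n p : nat) (c : 'I_n -> T) (b : 'I_p -> T).

Lemma concat_lshift i : concat c b (lshift p i) = c i.
Proof. by rewrite /concat (unsplitK (inl i)). Qed.

Lemma concat_rshift i : concat c b (rshift n i) = b i.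
Proof. by rewrite /concat (unsplitK (inr i)). Qed.

End ConcatLemmas.

Section MicrostateFacts.
Context {R : realType} {H : completeNormedModType R[i]}.
Local Notation C := R[i].
Variable ip : {dot H for Num.conj}.
Variable M : set (H -> H).
Hypothesis MvN : von_neumann_algebra ip M.
Variable phi : (H -> H) -> C.
Hypothesis phi_state : normal_tracial_state ip M phi.

Lemma GammaP q (c : 'I_q -> H -> H) r m k g (x : mxtuple q k) : 0 <= r ->
  Gamma phi c r m k g x <->
  [/\ herm_tuple x, forall i, opbd (x i) r &
      forall w, (1 <= size w <= m)%N -> cabs (mx_moment x w - phi (word_op c w)) < g].
Proof.
move=> r0; split=> -[h1 h2 h3]; split => //.
- by move=> i; exact: operator_norm_opbd.
- by move=> w /h3; rewrite cabs_lt.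
- by move=> i; exact: opbd_operator_norm.
- by move=> w wm; rewrite cabs_lt; exact: h3.
Qed.

Lemma Gamma_sub q (c : 'I_q -> H -> H) r r' m m' k g g' :
  0 <= r -> r <= r' -> (m' <= m)%N -> g <= g' ->
  Gamma phi c r m k g `<=` Gamma phi c r' m' k g'.
Proof.
move=> r0 rr mm gg x /(GammaP _ _ _ _ r0)[h1 h2 h3]; apply/(GammaP _ _ _ _ (le_trans r0 rr)).
split => // [i|w /andP[w1 wm]]; first exact: opbd_le rr (h2 i).
by apply: lt_le_trans gg; apply: h3; rewrite w1 (leq_trans wm).
Qed.

Lemma word_mx_conj n k (u : 'M[C]_k) (y : mxtuple (R := R) n k) w : unitary u ->
  word_mx (conj_tuple u y) w = uconj u (word_mx y w).
Proof.
move=> uu; elim: w => [|i w IH]; first by rewrite !word_mx_nil /uconj mulmx1.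
by rewrite !word_mx_cons IH uconjM.
Qed.

Lemma moment_conj n k (u : 'M[C]_k) (y : mxtuple (R := R) n k) w : unitary u ->
  mx_moment (conj_tuple u y) w = mx_moment y w.
Proof. by move=> uu; rewrite /mx_moment word_mx_conj// /normalized_trace trace_uconj. Qed.

Lemma Gamma_conj q (c : 'I_q -> H -> H) r m k g (u : 'M[C]_k) (x : mxtuple (R := R) q k) :
  0 <= r -> unitary u -> Gamma phi c r m k g x -> Gamma phi c r m k g (conj_tuple u x).
Proof.
move=> r0 uu /(GammaP _ _ _ _ r0)[h1 h2 h3]; apply/(GammaP _ _ _ _ r0); split.
- exact: herm_conj_tuple.
- by move=> i; exact: opbd_conj (h2 i).
- by move=> w wm; rewrite moment_conj//; exact: h3.
Qed.

(** A bound for [norm2 x ^ 2 / k] as soon as the second moments are within 1 of those of [c]. It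
    does not involve the cut-off, which is later sent to infinity. *)
Definition size_bound q (c : 'I_q -> H -> H) : R := \sum_i (cabs (phi (word_op c [:: i; i])) + 1).

Lemma norm2_moments q k (c : 'I_q -> H -> H) (x : mxtuple (R := R) q k) : (0 < k)%N ->
  (forall i, cabs (mx_moment x [:: i; i] - phi (word_op c [:: i; i])) <= 1) ->
  norm2 x <= Num.sqrt k%:R * Num.sqrt (size_bound c).
Proof.
move=> k0 xc; rewrite -sqrtrM// /norm2; apply: ler_wsqrtr.
rewrite /size_bound mulr_sumr; apply: ler_sum => i _.
apply: le_trans (Re_le_cabs _) _; rewrite cabsM cabs_nat ler_wpM2l//.
have -> : normalized_trace (x i *m x i) = mx_moment x [:: i; i].
  by rewrite /mx_moment !word_mx_cons word_mx_nil mulmx1.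
rewrite -[mx_moment _ _](subrK (phi (word_op c [:: i; i]))) addrC.
by apply: le_trans (cabsD _ _) _; rewrite lerD2l.
Qed.

Lemma Gamma_norm2 q (c : 'I_q -> H -> H) r m k g (x : mxtuple (R := R) q k) : (0 < k)%N ->
  0 <= r -> (2 <= m)%N -> g <= 1 -> Gamma phi c r m k g x ->
  norm2 x <= Num.sqrt k%:R * Num.sqrt (size_bound c).
Proof.
move=> k0 r0 m2 g1 /(GammaP _ _ _ _ r0)[_ _ xc]; apply: norm2_moments => // i.
by apply: ltW; apply: lt_le_trans g1; exact: xc.
Qed.

Lemma word_mx_map q p k (z : 'I_p -> 'M[C]_k) (f : 'I_q -> 'I_p) w :
  word_mx z (map f w) = word_mx (z \o f) w.
Proof. by rewrite /word_mx big_map. Qed.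

Lemma word_op_map q p (c : 'I_p -> H -> H) (f : 'I_q -> 'I_p) w :
  word_op c (map f w) = word_op (c \o f) w.
Proof. by rewrite /word_op big_map. Qed.

Lemma all_right n (w : seq 'I_(n + n)) : all (@second_half n) w ->
  exists w', w = map (@rshift n n) w'.
Proof.
elim: w => [_|j w IH /=/andP[jr /IH[w' ->]]]; first by exists [::].
move: jr; rewrite /second_half; case: splitP => // i ji _.
by exists (i :: w') => /=; congr (_ :: _); apply: val_inj.
Qed.

Lemma all_left n (w : seq 'I_(n + n)) : all (predC (@second_half n)) w ->
  exists w', w = map (@lshift n n) w'.
Proof.
elim: w => [_|j w IH /=/andP[jr /IH[w' ->]]]; first by exists [::].
move: jr; rewrite /second_half; case: splitP => // i ji _.
by exists (i :: w') => /=; congr (_ :: _); apply: val_inj.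
Qed.

Lemma moment_nil q k (z : 'I_q -> 'M[C]_k) : (0 < k)%N -> mx_moment z [::] = 1.
Proof.
move=> k0; rewrite /mx_moment word_mx_nil /normalized_trace mxtrace1 divff//.
by rewrite pnatr_eq0 -lt0n.
Qed.

Lemma moment_rot q k (z : 'I_q -> 'M[C]_k) i w : mx_moment z (rot i w) = mx_moment z w.
Proof.
by rewrite /mx_moment /rot word_mx_cat /normalized_trace mxtrace_mulC -word_mx_cat cat_take_drop.
Qed.

Section Joint.
Variables (n : nat) (a h : 'I_n -> H -> H).
Hypothesis aM : forall i, M (a i).
Hypothesis hM : forall i, M (h i).
Hypothesis h_free : free_sets phi (range h) (range a).

Lemma concat_in i : M (concat a h i).
Proof. by rewrite /concat; case: fintype.split. Qed.

(** The same tolerance [e] controls the separate moments of [x] and [y] and the loop defects; the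
    reconstruction amplifies it by at most [K]. The list depends on [x] but serves every [y]. *)
Lemma joint_microstates (r : R) (m : nat) (g : R) : 1 <= r -> 0 < g ->
  exists (c k1 : nat) (e : R), [/\ 0 < e, e <= 1 & forall k, (0 < k)%N -> (k1 <= k)%N ->
  forall x, Gamma phi a r m k e x ->
  exists us : seq 'M[C]_k, [/\ (size us <= c * k ^ 4)%N,
    forall i, (i < size us)%N -> unitary (nth 0 us i) &
    forall y, Gamma phi h r m k e y -> exists2 i, (i < size us)%N &
      forall w, (size w <= m)%N ->
        cabs (mx_moment (concat x (conj_tuple (nth 0 us i) y)) w - phi (word_op (concat a h) w)) <= g]].
Proof.
move=> r1 g0; have r0 : 0 <= r by exact: le_trans r1.
pose A b := if b then range h else range a.
have AM b : A b `<=` M by case: b => _ [i _ <-].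
have cA i : A (second_half i) (concat a h i).
  by rewrite /A /second_half /concat; case: fintype.split => j; exists j.
have [K K0 KP] := @moment_reconstruction R _ (@second_half n)
  (fun w => phi (word_op (concat a h) w)) m
  (etrans (congr1 phi (word_op_nil _)) (nts_unit phi_state))
  (fun i w => phi_rot MvN phi_state i w concat_in)
  (fun w => loop_free MvN phi_state AM h_free w cA).
pose e := Num.min 1 (g / (K + 1)).
have K1 : 0 < K + 1 by rewrite ltr_wpDl.
have e0 : 0 < e by rewrite lt_min ltr01 divr_gt0.
have Ke : K * e <= g.
  have : e <= g / (K + 1) by rewrite ge_min lexx orbT.
  by rewrite ler_pdivlMr// => h'; apply: le_trans h'; rewrite mulrC ler_wpM2l ?(ltW e0)// lerDl.
have [c [k1 fam]] := rotation_family n m r1 e0.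
exists c, k1, e; split => //; first by rewrite ge_min lexx.
move=> k k0 kk1 x /(GammaP _ _ _ _ r0)[hx xr xm].
have [us [us_size us_unit us_loop]] := fam k k0 kk1 x xr.
exists us; split => // y /(GammaP _ _ _ _ r0)[hy yr ym].
have [i ius small] := us_loop y yr; exists i => // w wm.
have uu := us_unit i ius; set y' := conj_tuple _ y.
apply: le_trans Ke; apply: (KP (mx_moment (concat x y')) e) => //.
- by rewrite (ltW e0) ge_min lexx.
- exact: moment_nil.
- by move=> *; exact: moment_rot.
move=> v vm; case: v vm => [|j v] vm.
  by move=> _; rewrite moment_nil// word_op_nil (nts_unit phi_state) subrr cabs0 ltW.
case/orP=> [/all_right|/all_left] [v' vE]; rewrite vE in vm *.
  rewrite /mx_moment word_mx_map word_op_map.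
  have -> : concat x y' \o @rshift n n = y' by apply/funext => l; exact: concat_rshift.
  have -> : concat a h \o @rshift n n = h by apply/funext => l; exact: concat_rshift.
  rewrite -/(mx_moment y' v') moment_conj//; apply: ltW; apply: ym.
  by move: vm; rewrite size_map => ->; case: (v') vE.
rewrite /mx_moment word_mx_map word_op_map.
have -> : concat x y' \o @lshift n n = x by apply/funext => l; exact: concat_lshift.
have -> : concat a h \o @lshift n n = a by apply/funext => l; exact: concat_lshift.
apply: ltW; apply: xm.
by move: vm; rewrite size_map => ->; case: (v') vE.
Qed.

Variable t : R.
Hypothesis t01 : 0 <= t <= 1.
Local Notation ath := (fun i => a i + (t%:C)%C *: h i).

Lemma perturbed_in i : M (concat ath h i).
Proof.
rewrite /concat; case: fintype.split => // j.
by rewrite addrC; exact: vN_linear MvN _ _ _ (hM j) (aM j).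
Qed.

(** The linear substitution that sends the letters [(a, h)] to [(a + t h, h)]; since [t <= 1], the
    cut-off at most doubles. *)
Lemma perturbed_microstates (m : nat) (g : R) : 0 < g ->
  exists2 e : R, 0 < e & forall k r (x y : mxtuple (R := R) n k), 0 <= r ->
    herm_tuple x -> herm_tuple y -> (forall i, opbd (x i) r) -> (forall i, opbd (y i) r) ->
    (forall w, (size w <= m)%N ->
      cabs (mx_moment (concat x y) w - phi (word_op (concat a h) w)) <= e) ->
    Gamma phi (concat ath h) (2 * r) m k g (concat (fun i => x i + (t%:C)%C *: y i) y).
Proof.
move=> g0; have /andP[t0 t1] := t01.
pose T (j : 'I_(n + n)) : seq (C * 'I_(n + n)) := match fintype.split j with
  inl i => [:: (1, lshift n i); ((t%:C)%C, rshift n i)] | inr i => [:: (1, rshift n i)] end.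
have [K K0 KP] := moment_subst MvN phi_state T m.
have K1 : 0 < K + 1 by rewrite ltr_wpDl.
have gK : 0 < g / (K + 1) by rewrite divr_gt0.
exists (g / (K + 1)) => [//|k r x y r0 hx hy xr yr xy].
apply/GammaP; [by rewrite mulr_ge0|split].
- move=> j; rewrite /concat; case: fintype.split => // i.
  exact: (herm_tupleD hx (herm_tupleZ t hy)).
- move=> j; rewrite /concat; case: fintype.split => i; last first.
    by apply: opbd_le (yr i); rewrite mulr_natl mulr2n lerDl.
  have -> : 2 * r = r + r by rewrite mulr_natl mulr2n.
  apply: opbdD => //; apply: (@opbd_le _ _ _ (cabs (t%:C)%C * r)); last exact: opbdZ.
  by rewrite cabs_real ger0_norm// ler_piMl.
move=> w /andP[w1 wm].
have mxE' : concat (fun i => x i + (t%:C)%C *: y i) y = (fun j => mx_letter (concat x y) (T j)).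
  apply/funext => j; rewrite /T /mx_letter {1}/concat.
  by case: fintype.split => i; rewrite !big_cons big_nil /= ?concat_lshift ?concat_rshift addr0 ?scale1r.
have opE' : concat ath h = (fun j => op_letter (concat a h) (T j)).
  apply/funext => j; rewrite /T /op_letter {1}/concat.
  by case: fintype.split => i; rewrite !big_cons big_nil /= ?concat_lshift ?concat_rshift addr0 ?scale1r.
rewrite mxE' opE'; apply: (@le_lt_trans _ _ (K * (g / (K + 1)))).
  apply: (KP _ _ _ _ concat_in (ltW gK)) => [v /andP[_ vm]|]; first exact: xy.
  by rewrite w1.
by rewrite mulrCA -[ltRHS]mulr1 ltr_pM2l// ltr_pdivrMr// mul1r ltrDl.
Qed.

(** The inverse substitution, which recovers [a] from [(a + t h, h)]. *)
Lemma unperturbed_microstates (m : nat) (g : R) : 0 < g ->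
  exists2 e : R, 0 < e & forall k r (z : mxtuple (R := R) (n + n) k), 0 <= r ->
    Gamma phi (concat ath h) r m k e z ->
    Gamma phi a (2 * r) m k g (fun i => z (lshift n i) + ((- t)%:C)%C *: z (rshift n i)).
Proof.
move=> g0; have /andP[t0 t1] := t01.
pose T (i : 'I_n) : seq (C * 'I_(n + n)) := [:: (1, lshift n i); (((- t)%:C)%C, rshift n i)].
have [K K0 KP] := moment_subst MvN phi_state T m.
have K1 : 0 < K + 1 by rewrite ltr_wpDl.
have gK : 0 < g / (K + 1) by rewrite divr_gt0.
exists (g / (K + 1)) => [//|k r z r0 /(GammaP _ _ _ _ r0)[hz zr zm]].
apply/GammaP; [by rewrite mulr_ge0|split].
- exact: (herm_tupleD (fun i => hz (lshift n i)) (herm_tupleZ (- t) (fun i => hz (rshift n i)))).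
- move=> i; have -> : 2 * r = r + r by rewrite mulr_natl mulr2n.
  apply: opbdD => //; apply: (@opbd_le _ _ _ (cabs ((- t)%:C)%C * r)); last exact: opbdZ.
  by rewrite cabs_real normrN ger0_norm// ler_piMl.
move=> w /andP[w1 wm].
have mxE' : (fun i => z (lshift n i) + ((- t)%:C)%C *: z (rshift n i)) = (fun j => mx_letter z (T j)).
  by apply/funext => j; rewrite /T /mx_letter !big_cons big_nil /= addr0 scale1r.
have opE' : a = (fun j => op_letter (concat ath h) (T j)).
  apply/funext => j; rewrite /T /op_letter !big_cons big_nil /= addr0 scale1r.
  rewrite concat_lshift concat_rshift -addrA -scalerDl -rmorphD subrr rmorph0 scale0r.
  by rewrite addr0.
rewrite mxE' [in phi _]opE'; apply: (@le_lt_trans _ _ (K * (g / (K + 1)))).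
  apply: (KP _ _ _ _ perturbed_in (ltW gK)) => [v vm|]; first by apply: ltW; exact: zm.
  by rewrite w1.
by rewrite mulrCA -[ltRHS]mulr1 ltr_pM2l// ltr_pdivrMr// mul1r ltrDl.
Qed.

End Joint.
End MicrostateFacts.

Lemma sume_const_ord (R : realType) (N : nat) (x : \bar R) : (0 <= x)%E ->
  (\sum_(i < N) x = N%:R%:E * x)%E.
Proof.
move=> x0; elim: N => [|N IH]; first by rewrite big_ord0 mul0e.
by rewrite big_ord_recr /= IH -natr1 EFinD ge0_muleDl ?lee_fin// mul1e.
Qed.

Section VolumeEstimates.
Context {R : realType} {H : completeNormedModType R[i]}.
Local Notation C := R[i].
Variable ip : {dot H for Num.conj}.
Variable M : set (H -> H).
Hypothesis MvN : von_neumann_algebra ip M.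
Variable phi : (H -> H) -> C.
Hypothesis phi_state : normal_tracial_state ip M phi.
Variables (n : nat) (a h : 'I_n -> H -> H).
Hypothesis aM : forall i, M (a i).
Hypothesis hM : forall i, M (h i).
Variable t : R.
Hypothesis t0 : 0 < t.
Hypothesis t1 : t <= 1.
Local Notation ath := (fun i => a i + (t%:C)%C *: h i).
Local Notation Ch := (Num.sqrt (size_bound phi h)).
Local Notation d k := (n * k * k)%N.

Let t01 : 0 <= t <= 1. Proof. by rewrite ltW. Qed.

Lemma upper_volume (r : R) (m' : nat) (g' : R) : 0 <= r -> 0 < g' ->
  exists (m : nat) (g : R), 0 < g /\ forall k, (0 < k)%N ->
  forall (N : nat) (z : 'I_N -> mxtuple n k), (forall j, Gamma phi a (2 * r) m' k g' (z j)) ->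
    Gamma phi a (2 * r) m' k g' `<=` \bigcup_j ball_in (Gamma phi a (2 * r) m' k g') (@rho R n k) t (z j) ->
    (vol (Gamma_rel phi ath h r m k g) <=
      (N%:R * (8 * (t * (1 + Ch) / Num.sqrt k%:R)) ^+ d k)%:E)%E.
Proof.
move=> r0 g'0; have [e e0 eP] := unperturbed_microstates MvN phi_state aM hM t01 m' g'0.
(* Order 2 and precision 1 make the second moments bound the norm of the [h] part. *)
exists (maxn m' 2), (Num.min e 1); split; first by rewrite lt_min e0 ltr01.
(* With this [s], the ball of [vol_ball] has squared radius [n * (Num.sqrt k * (t * (1 + Ch))) ^ 2]:
   one [t] for the covering radius and [t * Ch] for the shift by [t y]. The factor [n] is to spare
   if [n > 0], and for [n = 0] distances vanish. *)
move=> k k0 N z zG cov; set s := t * (1 + Ch) / Num.sqrt k%:R.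
have sk0 : 0 < Num.sqrt k%:R :> R by rewrite sqrtr_gt0 ltr0n.
have C1 : 0 < 1 + Ch by rewrite ltr_wpDr ?sqrtr_ge0.
have s0 : 0 < s by rewrite divr_gt0// mulr_gt0.
have r20 : 0 <= 2 * r by rewrite mulr_ge0.
have hz j : herm_tuple (z j) by have /(GammaP _ _ _ _ _ r20)[] := zG j.
pose B (j : 'I_N) : set (mxtuple n k) := [set x | norm2 (fun i => x i - z j i) ^+ 2 <= (d k)%:R * s ^+ 2].
apply: (@le_trans _ _ (vol (\bigcup_(j in [set` predT]) B j))).
  apply: le_vol => x hx [zz zzG xE].
  have zzG' : Gamma phi (concat ath h) r m' k e zz.
    by apply: Gamma_sub zzG; rewrite ?leq_maxl// ge_min lexx.
  have yG := eP k r zz r0 zzG'.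
  have [j _ [_ bj]] := cov _ yG.
  exists j => //=; move: yG => /(GammaP _ _ _ _ _ r20)[hw _ _].
  move: zzG => /(GammaP _ _ _ _ _ r0)[hzz _ mom].
  have hy : herm_tuple (fun i => zz (rshift n i)) by move=> i; exact: hzz.
  have ynorm : norm2 (fun i => zz (rshift n i)) <= Num.sqrt k%:R * Ch.
    apply: norm2_moments => // i.
    have := mom [:: rshift n i; rshift n i]; rewrite /= leq_maxr => /(_ isT) lt.
    have -> : mx_moment (fun i => zz (rshift n i)) [:: i; i] = mx_moment zz [:: rshift n i; rshift n i].
      by rewrite /mx_moment !word_mx_cons !word_mx_nil.
    have -> : word_op h [:: i; i] = word_op (concat ath h) [:: rshift n i; rshift n i].
      by rewrite !word_op_cons !word_op_nil concat_rshift.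
    by apply/ltW/(lt_le_trans lt); rewrite ge_min lexx orbT.
  set w := (fun i => zz (lshift n i) + ((- t)%:C)%C *: zz (rshift n i)) in hw bj.
  have norm_le : norm2 (fun i => x i - z j i) <= Num.sqrt k%:R * (t * (1 + Ch)).
    have -> : (fun i => x i - z j i) = (fun i => (w i - z j i) + (t%:C)%C *: zz (rshift n i)).
      apply/funext => i; rewrite -xE /w rmorphN /= scaleNr.
      by rewrite [RHS]addrAC subrK.
    apply: le_trans (norm2D k0 (herm_tupleB hw (hz j)) (herm_tupleZ t hy)) _.
    rewrite (norm2Z t k0 hy) (gtr0_norm t0) mulrDr mulr1 mulrDr; apply: lerD.
      rewrite (norm2_rho _ _ k0) rhoC.
      exact: (ler_wpM2l (ltW sk0) (ltW _)).
    by rewrite mulrCA ler_wpM2l ?(ltW t0).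
  rewrite /B /=; have [n0|n0] := posnP n.
    rewrite /norm2 big1 => [|i]; last by have := ltn_ord i; rewrite {2}n0.
    by rewrite sqrtr0 expr0n /=; exact: mulr_ge0 (ler0n _ _) (sqr_ge0 _).
  have -> : (d k)%:R * s ^+ 2 = n%:R * (Num.sqrt k%:R * (t * (1 + Ch))) ^+ 2.
    rewrite /s !natrM expr_div_n [in RHS]exprMn sqr_sqrtr//.
    by field; rewrite pnatr_eq0 -lt0n.
  apply: (@le_trans _ _ (1 * (Num.sqrt k%:R * (t * (1 + Ch))) ^+ 2)).
    rewrite mul1r lerXn2r ?nnegrE ?norm2_ge0//.
    by rewrite mulr_ge0 ?(ltW sk0)// mulr_ge0 ?(ltW t0) ?(ltW C1).
  by rewrite ler_wpM2r ?sqr_ge0// ler1n.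
apply: le_trans (vol_bigcup _ _) _.
apply: (@le_trans _ _ (\sum_(j < N) ((8 * s) ^+ d k)%:E)%E).
  by apply: lee_sum => j _; exact: vol_ball.
by rewrite sumEFin sumr_const card_ord lee_fin [leRHS]mulr_natl.
Qed.

Lemma packing_rho k (X : set (mxtuple n k)) (e : R) N (x : 'I_N -> mxtuple n k) :
  0 < e -> (forall i, X (x i)) ->
  (forall i j, i != j -> ball_in X (@rho R n k) e (x i) `&` ball_in X (@rho R n k) e (x j) = set0) ->
  forall i j, i != j -> e <= rho (x i) (x j).
Proof.
move=> e0 Xx disj i j ij; rewrite leNgt; apply/negP => lt.
have : (ball_in X (@rho R n k) e (x i) `&` ball_in X (@rho R n k) e (x j)) (x j).
  by split; split; [exact: Xx | exact: lt | exact: Xx | rewrite rho_self].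
by rewrite disj.
Qed.

Hypothesis h_free : free_sets phi (range h) (range a).

(** The radius [(2 * Ch + 1) * t] leaves a gap [t] between the sets [x s + t Y], whose [rho]
    diameters are at most [2 * Ch * t]. The packing lives at the cut-off [ra], while [r] must also
    accommodate the microstates of [h]. *)
Lemma lower_volume (ra r : R) (m : nat) (g : R) : 0 <= ra -> ra <= r -> 1 <= r -> 0 < g ->
  exists (m' c k1 : nat) (g' : R), 0 < g' /\ forall k, (0 < k)%N -> (k1 <= k)%N ->
  forall (N : nat) (x : 'I_N -> mxtuple n k), (forall s, Gamma phi a ra m' k g' (x s)) ->
    (forall s s', s != s' ->
       ball_in (Gamma phi a ra m' k g') (@rho R n k) ((2 * Ch + 1) * t) (x s) `&`
       ball_in (Gamma phi a ra m' k g') (@rho R n k) ((2 * Ch + 1) * t) (x s') = set0) ->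
    (N%:R%:E * vol (Gamma phi h r m' k g') <=
      ((c * k ^ 4)%:R * 8 ^+ d k * t^-1 ^+ d k)%:E *
        vol (Gamma_rel phi ath h (2 * r) m k g))%E.
Proof.
move=> ra0 rar r1 g0; have r0 : 0 <= r by exact: le_trans r1.
have [e e0 eP] := perturbed_microstates MvN phi_state aM hM t01 m g0.
pose m' := maxn m 2.
have [c [k1 [e' [e'0 e'1 jointP]]]] := joint_microstates MvN phi_state aM hM h_free m' r1 e0.
exists m', c, k1, e'; split => // k k0 kk1 N x xGa disj.
have xG s : Gamma phi a r m' k e' (x s) by exact: Gamma_sub (xGa s).
set Y := Gamma phi h r m' k e'.
have ctd : 0 <= (c * k ^ 4)%:R * 8 ^+ d k :> R by rewrite mulr_ge0// exprn_ge0.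
have hx s : herm_tuple (x s) by have /(GammaP _ _ _ _ _ r0)[] := xG s.
have xr s i : opbd (x s i) r by have /(GammaP _ _ _ _ _ r0)[_ + _] := xG s; exact.
(* The [y] that are nearly free from [x s] without rotation. Finitely many conjugates of this set
   cover [Y], and conjugation costs [8 ^ d k]. *)
pose G s : set (mxtuple n k) := [set y | Y y /\ forall w, (size w <= m)%N ->
   cabs (mx_moment (concat (x s) y) w - phi (word_op (concat a h) w)) <= e].
pose A s : set (mxtuple n k) := [set p | exists2 y, G s y & p = (fun i => x s i + (t%:C)%C *: y i)].
have volG s : (vol Y <= ((c * k ^ 4)%:R * 8 ^+ d k)%:E * vol (G s))%E.
  have [us [us_size us_unit us_cov]] := jointP k k0 kk1 (x s) (xG s).
  pose V (i : 'I_(size us)) : set (mxtuple n k) := [set y | G s (conj_tuple (nth 0 us i) y)].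
  apply: (@le_trans _ _ (vol (\bigcup_(i in [set` predT]) V i))).
    apply: le_vol => y _ yY; have [i ius good] := us_cov y yY.
    exists (Ordinal ius) => //; split; first exact: Gamma_conj r0 (us_unit _ ius) yY.
    by move=> w wm; apply: good; rewrite (leq_trans wm)// leq_maxl.
  apply: le_trans (vol_bigcup _ _) _.
  apply: (@le_trans _ _ (\sum_(i < size us) (8 ^+ d k)%:E * vol (G s))%E).
    by apply: lee_sum => i _; apply: vol_conj => //; exact: us_unit.
  rewrite sume_const_ord ?mule_ge0 ?vol_ge0 ?lee_fin ?exprn_ge0// EFinM -muleA; apply: lee_wpmul2r => //.
    by rewrite mule_ge0 ?vol_ge0// lee_fin exprn_ge0.
  by rewrite lee_fin ler_nat.
have volA s : (vol (G s) <= (t^-1 ^+ d k)%:E * vol (A s))%E.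
  apply: (le_trans _ (vol_affine (A s) (hx s) t0)).
  by apply: le_vol => y _ yG; exists y.
have sub : (vol (\bigcup_s A s) <= vol (Gamma_rel phi ath h (2 * r) m k g))%E.
  apply: le_vol => p _ [s _ [y [yY ymom] ->]].
  move: yY => /(GammaP _ _ _ _ _ r0)[hy yr _].
  exists (concat (fun i => x s i + (t%:C)%C *: y i) y); first exact: eP.
  by apply/funext => i; rewrite concat_lshift.
have Ysize y : Y y -> herm_tuple y /\ norm2 y <= Num.sqrt k%:R * Ch.
  move=> yY; split; first by have /(GammaP _ _ _ _ _ r0)[] := yY.
  by apply: Gamma_norm2 yY => //; rewrite leq_maxr.
have sk0 : 0 < Num.sqrt k%:R :> R by rewrite sqrtr_gt0 ltr0n.
have C0 : 0 <= Ch by exact: sqrtr_ge0.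
have rad : 0 < (2 * Ch + 1) * t by rewrite mulr_gt0// ltr_wpDl// mulr_ge0.
have sepA : (\sum_s vol (A s) <= vol (\bigcup_s A s))%E.
  apply: (@vol_separated _ _ _ k0 _ _ (Num.sqrt k%:R * t)); first by rewrite mulr_gt0.
  move=> s s' p p' ss' _ _ [y [yY _] ->] [y' [y'Y _] ->].
  have [hy yn] := Ysize _ yY; have [hy' y'n] := Ysize _ y'Y.
  have far := packing_rho rad xGa disj ss'.
  have hd : herm_tuple (fun i => (t%:C)%C *: (y' i - y i)) by exact/herm_tupleZ/herm_tupleB.
  have hp : herm_tuple (fun i => x s i + (t%:C)%C *: y i - (x s' i + (t%:C)%C *: y' i)).
    exact: (herm_tupleB (herm_tupleD (hx s) (herm_tupleZ t hy)) (herm_tupleD (hx s') (herm_tupleZ t hy'))).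
  have := norm2D k0 hp hd.
  have -> : (fun i => x s i + (t%:C)%C *: y i - (x s' i + (t%:C)%C *: y' i) + (t%:C)%C *: (y' i - y i))
    = (fun i => x s i - x s' i).
    have zmod (V : zmodType) (v1 v2 v3 v4 : V) : v1 + v2 - (v3 + v4) + (v4 - v2) = v1 - v3.
      by rewrite opprD -addrA [- v3 - v4 + _]addrA subrK addrACA subrr addr0.
    by apply/funext => i; rewrite scalerBr zmod.
  rewrite norm2_rho// (norm2Z t k0 (herm_tupleB hy' hy)) (gtr0_norm t0).
  have yy' : norm2 (fun i => y' i - y i) <= 2 * (Num.sqrt k%:R * Ch).
    have -> : (fun i => y' i - y i) = (fun i => y' i + ((- (1 : R))%:C)%C *: y i).
      by apply/funext => i; rewrite rmorphN1 scaleN1r.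
    apply: le_trans (norm2D k0 hy' (herm_tupleZ (-1) hy)) _.
    by rewrite (norm2Z (-1) k0 hy) normrN1 mul1r; lra.
  set q := norm2 _; move=> le1.
  have le2 : Num.sqrt k%:R * ((2 * Ch + 1) * t) <= Num.sqrt k%:R * rho (x s) (x s').
    by rewrite ler_wpM2l// ltW.
  have le3 : t * norm2 (fun i => y' i - y i) <= t * (2 * (Num.sqrt k%:R * Ch)).
    by rewrite ler_wpM2l// ltW.
  have E : Num.sqrt k%:R * ((2 * Ch + 1) * t) = t * (2 * (Num.sqrt k%:R * Ch)) + Num.sqrt k%:R * t by ring.
  rewrite E in le2; lra.
apply: (@le_trans _ _ (((c * k ^ 4)%:R * 8 ^+ d k * t^-1 ^+ d k)%:E * \sum_s vol (A s))%E); last first.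
  apply: lee_wpmul2l; first by rewrite lee_fin mulr_ge0// exprn_ge0// invr_ge0 ltW.
  exact: le_trans sepA sub.
rewrite ge0_sume_distrr; last by move=> s _; exact: vol_ge0.
rewrite -sume_const_ord ?vol_ge0//; apply: lee_sum => s _.
apply: (le_trans (volG s)).
have h0 : (0 <= ((c * k ^ 4)%:R * 8 ^+ d k)%:E :> \bar R)%E by rewrite lee_fin.
by apply: (le_trans (lee_wpmul2l h0 (volA s))); rewrite muleA -EFinM.
Qed.

End VolumeEstimates.

(** * Entropy, covering and packing *)

Section UpperLimits.
Context {R : realType}.
Local Open Scope ereal_scope.
Implicit Types x y : \bar R.

Lemma limf_esup_lt (T : choiceType) (X : filteredType T) (F : set (set X)) (f : X -> \bar R) x :
  Filter F -> limf_esup f F < x -> F [set t | f t < x].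
Proof.
move=> FF /ereal_inf_lt[_ [V FV <-] ltx]; apply: filterS FV => t Vt.
by apply: le_lt_trans ltx; apply: ereal_sup_ubound; exists t.
Qed.

Lemma limf_esup_le (T : choiceType) (X : filteredType T) (F : set (set X)) (f : X -> \bar R) x :
  F [set t | f t <= x] -> limf_esup f F <= x.
Proof.
move=> Fx; apply: ge_ereal_inf; exists (ereal_sup (f @` [set t | f t <= x])).
  by exists [set t | f t <= x].
by apply: ge_ereal_sup => _ [t tx <-].
Qed.

Lemma limf_esup_addr_le (T : choiceType) (X : filteredType T) (F : set (set X))
    (f g : X -> \bar R) (c : R) : Filter F ->
  F [set t | f t + c%:E <= g t] -> limf_esup f F + c%:E <= limf_esup g F.
Proof.
move=> FF fg; apply: le_ereal_inf_tmp => _ [V FV <-]; rewrite -leeBrDr//.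
apply: limf_esup_le; apply: filterS2 fg FV => t tfg Vt.
suff : f t <= ereal_sup (g @` V) - c%:E by [].
rewrite leeBrDr//; apply: (le_trans tfg).
by apply: ereal_sup_ubound; exists t.
Qed.

Lemma limn_einf_gt (u : nat -> \bar R) x : x < limn_einf u -> \forall k \near \oo, x < u k.
Proof.
rewrite /limn_einf lteNr => /(limf_esup_lt _).
by apply: filterS => k /=; rewrite lteN2.
Qed.

(** The order of choices matters: [c] is common to all parameters, the cut-off [r'] depends on [r]
    only, and [m] and [e] are chosen last. *)
Lemma sup_inf_addr_le (f g : R -> nat -> R -> \bar R) (c : R) :
  (forall r, (0 < r)%R -> exists2 r', (0 < r')%R & forall m' e', (0 < e')%R ->
     exists m e, (0 < e)%R /\ f r m e + c%:E <= g r' m' e') ->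
  sup_inf f + c%:E <= sup_inf g.
Proof.
move=> fg; rewrite -leeBrDr//; apply: ge_ereal_sup => _ [r r0 <-].
have [r' r'0 h] := fg r r0; rewrite leeBrDr//.
apply: (@le_trans _ _ (ereal_inf [set g r' m e | m in [set: nat] & e in [set e : R | (0 < e)%R]])).
  apply: le_ereal_inf_tmp => _ [m' _ [e' /= e'0 <-]].
  have [m [e [e0 le]]] := h m' e' e'0; apply: le_trans le; rewrite leeD2r//.
  by apply: ereal_inf_lbound; exists m => //; exists e.
by apply: ereal_sup_ubound; exists r'.
Qed.

(** Logarithms of cardinalities have this property and it survives the suprema, infima and limits.
    It supplies the sign needed when the denominator [|ln e|] is changed. *)
Definition trivial_or_ge0 x := x = -oo \/ 0 <= x.

Lemma trivial_or_ge0_sup (S : set (\bar R)) : (forall x, S x -> trivial_or_ge0 x) ->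
  trivial_or_ge0 (ereal_sup S).
Proof.
move=> SP; have [[x Sx x0]|no] := pselect (exists2 x, S x & 0 <= x).
  by right; apply: le_trans x0 _; exact: ereal_sup_ubound.
left; apply/ereal_sup_ninfty => x Sx; case: (SP x Sx) => // x0.
by exfalso; apply: no; exists x.
Qed.

Lemma trivial_or_ge0_inf (S : set (\bar R)) : (forall x, S x -> trivial_or_ge0 x) ->
  trivial_or_ge0 (ereal_inf S).
Proof.
move=> SP; have [Sy|no] := pselect (S -oo).
  left; apply/eqP; rewrite -leeNy_eq; exact: ereal_inf_lbound.
right; apply: le_ereal_inf_tmp => x Sx; case: (SP x Sx) => // xE.
by exfalso; apply: no; rewrite -xE.
Qed.

Lemma trivial_or_ge0_limn_esup (u : nat -> \bar R) : (forall k, trivial_or_ge0 (u k)) ->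
  trivial_or_ge0 (limn_esup u).
Proof.
move=> uP; apply: trivial_or_ge0_inf => _ [V _ <-].
by apply: trivial_or_ge0_sup => _ [k _ <-].
Qed.

Lemma trivial_or_ge0_sup_inf (f : R -> nat -> R -> \bar R) :
  (forall r m e, trivial_or_ge0 (f r m e)) -> trivial_or_ge0 (sup_inf f).
Proof.
move=> fP; apply: trivial_or_ge0_sup => _ [r _ <-].
by apply: trivial_or_ge0_inf => _ [m _ [e _ <-]].
Qed.

Lemma trivial_or_ge0_mul (r : R) x : (0 <= r)%R -> trivial_or_ge0 x -> trivial_or_ge0 (r%:E * x).
Proof.
rewrite le_eqVlt => /predU1P[<-|r0]; first by right; rewrite mul0e.
case=> [->|x0]; first by left; rewrite gt0_mulNye ?lte_fin// || rewrite mulrNy gtr0_sg// mul1e.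
by right; rewrite mule_ge0// lee_fin ltW.
Qed.

Lemma lne_addr_le x y (v : R) : 0 <= x -> 0 <= y -> (0 < v)%R -> x * v%:E <= y ->
  lne x + (ln v)%:E <= lne y.
Proof.
move=> x0 y0 v0 xy; have [x1|x1] := eqVneq x 0.
  by rewrite x1 /= lexx addNye leNye.
have xpos : 0 < x by rewrite lt_neqAle eq_sym x1.
rewrite -lne_EFin// -lneM ?in_itv/= ?leey ?andbT ?lte_fin//.
by rewrite lee_lne ?in_itv/= ?leey ?andbT// mule_ge0// lee_fin ltW.
Qed.

Lemma near_ln_gt (B : R) : \forall t \near (0%R : R)^'+, [/\ (0 < t)%R, (t < 1)%R & (B < `|ln t|)%R].
Proof.
have e0 : (0 < expR (- (`|B| + 1)))%R by exact: expR_gt0.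
near=> t.
have t0 : (0 < t)%R by near: t; exact: nbhs_right_gt.
have te : (t < expR (- (`|B| + 1)))%R by near: t; exact: nbhs_right_lt.
have lnt : (ln t < - (`|B| + 1))%R by rewrite -ltr_expR lnK.
have B0 : (0 <= `|B|)%R by [].
have t1 : (t < 1)%R by apply: (lt_trans te); rewrite -[X in (_ < X)%R]expR0 ltr_expR; lra.
have Bt : (B < `|ln t|)%R by rewrite ltr0_norm; [have := ler_norm B; lra|lra].
by split.
Unshelve. all: by end_near.
Qed.

Lemma lte_between2 x y : x < y -> exists v w : R, [/\ x < v%:E, (v < w)%R & w%:E < y].
Proof.
case: x => [x||]; case: y => [y||] // h.
- exists (x + (y - x) / 3)%R, (x + 2 * (y - x) / 3)%R.
  by rewrite !lte_fin in h *; split; lra.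
- by exists (x + 1)%R, (x + 2)%R; rewrite lte_fin ltry; split => //; lra.
- by exists (y - 2)%R, (y - 1)%R; rewrite ltNyr lte_fin; split => //; lra.
- by exists 0%R, 1%R; rewrite ltNyr ltry; split => //; lra.
Qed.

(** Passing from [e] to [e / c] changes [|ln e|] by the constant [ln c], which is negligible in the
    limit; the gap between [v] and [w] absorbs it. *)
Lemma limsup_log_ratio_rescale (F : R -> \bar R) (c : R) : (1 <= c)%R ->
  (forall e, trivial_or_ge0 (F e)) ->
  limsup_log_ratio F <= limf_esup (fun e => F (c * e)%R * (`|ln e|^-1)%:E) ((0%R : R)^'+).
Proof.
move=> c1 FP; have c0 : (0 < c)%R by exact: lt_le_trans c1.
rewrite leNgt; apply/negP => /lte_between2[v [w [/limf_esup_lt near_v vw]]].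
rewrite ltNge => /negP; apply; apply: limf_esup_le.
have lnc : (0 <= ln c)%R by rewrite ln_ge0.
(* Beyond this threshold for [|ln e|], one has [v * (|ln e| + ln c) <= w * |ln e|]. *)
pose B := `|v * ln c / (w - v)|%R.
have [delta /= delta0 deltaP] := near_v.
near=> e.
have [e0 e1 Be] : [/\ (0 < e)%R, (e < 1)%R & (B < `|ln e|)%R] by near: e; exact: near_ln_gt.
have ed : (e < c * delta)%R by near: e; apply: nbhs_right_lt; rewrite mulr_gt0.
have ec0 : (0 < e / c)%R by rewrite divr_gt0.
have := deltaP (e / c)%R; rewrite /ball_ /= sub0r normrN gtr0_norm//.
rewrite ltr_pdivrMr// mulrC => /(_ ed ec0); rewrite mulrC divfK ?gt_eqF//.
have lne0 : (ln e < 0)%R by rewrite ln_lt0// e0.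
have -> : `|ln (e / c)|%R = (`|ln e| + ln c)%R.
  by rewrite ln_div ?posrE// !ltr0_norm//; lra.
have B0 : (0 <= B)%R by exact: normr_ge0.
have L0 : (0 < `|ln e|)%R by exact: le_lt_trans Be.
set A := (`|ln e| + ln c)%R; have A0 : (0 < A)%R by rewrite ltr_pwDl.
have iL : 0 < (`|ln e|^-1)%:E by rewrite lte_fin invr_gt0.
have iA : 0 < (A^-1)%:E by rewrite lte_fin invr_gt0.
have [->|] := FP e; first by rewrite (gt0_mulNye iL) leNye.
case: (F e) => [x||] //; last by rewrite (gt0_mulye iA).
move=> x0; have {}x0 : (0 <= x)%R by rewrite -lee_fin.
rewrite -!EFinM lte_fin lee_fin.
rewrite ltr_pdivrMr// ler_pdivrMr// => xvA.
have v0 : (0 < v)%R by rewrite -(pmulr_lgt0 _ A0); exact: le_lt_trans xvA.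
have wv0 : (0 < w - v)%R by rewrite subr_gt0.
apply/ltW/(lt_le_trans xvA); rewrite /A mulrDr -lerBrDl -mulrBl.
have -> : (v * ln c = (w - v) * (v * ln c / (w - v)))%R by field; rewrite gt_eqF.
by rewrite ler_pM2l//; apply/ltW/(le_lt_trans (ler_norm _)).
Unshelve. all: by end_near.
Qed.

End UpperLimits.

Section PackingCovering.
Context {R : realType}.
Variables (T : Type) (X : set T) (d : T -> T -> R).
Hypothesis dC : forall x y, d x y = d y x.
Hypothesis d_triangle : forall x y z, X x -> X y -> X z -> d x z <= d x y + d y z.

Lemma packing_number_ge0 e : (0 <= packing_number X d e)%E.
Proof.
apply: ereal_sup_ubound; exists 0%N => //.
by exists (fun i : 'I_0 => False_rect T (notF (ltn_ord i))); split; case.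
Qed.

Lemma covering_number_ge0 e : (0 <= covering_number X d e)%E.
Proof. by apply: le_ereal_inf_tmp => _ [N _ <-]; rewrite lee_fin. Qed.

(** The center of a covering ball containing a packing point lies in that point's packing ball, so
    distinct packing points use distinct covering balls. *)
Lemma packing_le_covering e : (packing_number X d e <= covering_number X d e)%E.
Proof.
apply: le_ereal_inf_tmp => _ [N [y [yX cov]] <-].
apply: ge_ereal_sup => _ [m [x [xX disj]] <-].
have /choice[f fP] : forall i, exists j, ball_in X d e (y j) (x i).
  by move=> i; have [j _ h] := cov _ (xX i); exists j.
have finj : injective f.
  move=> i j fij; apply/eqP; case: eqVneq => // ij.
  have : (ball_in X d e (x i) `&` ball_in X d e (x j)) (y (f i)).
    split; split; rewrite // dC; first by have [_] := fP i.
    by rewrite fij; have [_] := fP j.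
  by rewrite disj.
by rewrite lee_fin ler_nat; have := leq_card f finj; rewrite !card_ord.
Qed.

(** The centers of a maximal packing cover at twice the radius, since an uncovered point could be
    added to it. If no packing is maximal, the packing number is infinite. *)
Lemma covering_le_packing e : 0 < e -> (covering_number X d (2 * e) <= packing_number X d e)%E.
Proof.
move=> e0; pose S N := exists x : 'I_N -> T, (forall i, X (x i)) /\
  forall i j, i != j -> ball_in X d e (x i) `&` ball_in X d e (x j) = set0.
have [[b bP]|unb] := pselect (exists b, forall N, S N -> (N <= b)%N); last first.
  rewrite (_ : packing_number X d e = +oo%E) ?leey//; apply/eqP; rewrite eq_le leey/=.
  rewrite leNgt; apply/negP => /lte_between2[v [_ [lt _ _]]]; apply: unb.
  exists (Num.truncn v) => N SN; rewrite leqNgt; apply/negP => vN.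
  have : ((N%:R)%:E <= packing_number X d e)%E by apply: ereal_sup_ubound; exists N.
  move=> /le_lt_trans/(_ lt); rewrite lte_fin => Nv.
  have : v < N%:R by apply: (lt_le_trans (truncnS_gt v)); rewrite ler_nat.
  by rewrite ltNge ltW.
have ex : exists N, `[< S N >].
  exists 0%N; apply/asboolP.
  by exists (fun i : 'I_0 => False_rect T (notF (ltn_ord i))); split; case.
have ub N : `[< S N >] -> (N <= b)%N by move=> /asboolP; exact: bP.
case: (ex_maxnP ex ub) => N /asboolP[x [xX disj]] maxN.
apply: (@le_trans _ _ (N%:R)%:E); last first.
  by apply: ereal_sup_ubound; exists N => //; exists x.
apply: ereal_inf_lbound; exists N => //; exists x; split => // y yX.
apply: contrapT => ncov.
have far i : 2 * e <= d (x i) y.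
  by rewrite leNgt; apply/negP => lt; apply: ncov; exists i.
have disj_y i : ball_in X d e (x i) `&` ball_in X d e y = set0.
  apply/seteqP; split => // z [[zX xz] [_ yz]].
  have := far i; rewrite leNgt => /negP; apply.
  apply: (le_lt_trans (d_triangle (xX i) zX yX)).
  by rewrite (dC z y); lra.
have : S N.+1.
  pose x' (i : 'I_N.+1) := if unlift ord0 i is Some j then x j else y.
  exists x'; split => [i|i j ij]; first by rewrite /x'; case: (unlift ord0 i).
  move: ij; rewrite /x'; case: (unliftP ord0 i) => [i' ->|->]; case: (unliftP ord0 j) => [j' ->|->] ij.
  - by apply: disj; apply: contra ij => /eqP ->.
  - exact: disj_y.
  - by rewrite setIC; exact: disj_y.
  - by rewrite eqxx in ij.
by move=> /asboolP/maxN; rewrite ltnn.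
Qed.

Lemma trivial_or_ge0_lne_covering e : trivial_or_ge0 (lne (covering_number X d e)).
Proof.
have [[x Sx]|no] := pselect ([set N : nat | exists x : 'I_N -> T, (forall i, X (x i)) /\
      X `<=` \bigcup_i ball_in X d e (x i)] 0%N).
  left; have -> : covering_number X d e = 0%E.
    apply/eqP; rewrite eq_le covering_number_ge0 andbT.
    by apply: ereal_inf_lbound; exists 0%N => //; exists x.
  by rewrite /= lexx.
right; rewrite lne_ge0; apply: le_ereal_inf_tmp => _ [N NS <-].
by case: N NS => [/no//|N _]; rewrite lee_fin ler1n.
Qed.

End PackingCovering.

Section Main.
Context {R : realType} {H : completeNormedModType R[i]}.
Local Notation C := R[i].
Variable ip : {dot H for Num.conj}.
Variable M : set (H -> H).
Hypothesis MvN : von_neumann_algebra ip M.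
Variable phi : (H -> H) -> C.
Hypothesis phi_state : normal_tracial_state ip M phi.
Variables (n : nat) (a h : 'I_n -> H -> H).
Hypothesis aM : forall i, M (a i).
Hypothesis hM : forall i, M (h i).
Local Notation ath t := (fun i => a i + (t%:C)%C *: h i).
Local Notation Ch := (Num.sqrt (size_bound phi h)).
Local Notation d k := (n * k * k)%N.

Lemma inv_sqr_dim k : (0 < k)%N -> (k%:R ^+ 2)^-1 * (d k)%:R = n%:R :> R.
Proof.
by move=> k0; rewrite !natrM; field; rewrite pnatr_eq0 -lt0n.
Qed.

Lemma ln_sqrt_nat k : (0 < k)%N -> ln (Num.sqrt k%:R) = ln k%:R / 2 :> R.
Proof.
move=> k0; have : ln (Num.sqrt k%:R ^+ 2) = ln (k%:R : R) by rewrite sqr_sqrtr.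
by rewrite lnXn ?sqrtr_gt0 ?ltr0n// mulr2n => <-; lra.
Qed.

Lemma lne_scale k (x y : \bar R) (c : R) : (lne x + c%:E <= lne y)%E ->
  (((k%:R ^+ 2)^-1)%:E * lne x + ((k%:R ^+ 2)^-1 * c)%:E <= ((k%:R ^+ 2)^-1)%:E * lne y)%E.
Proof.
move=> h'; rewrite EFinM -muleDr//; last by case: (lne x).
by apply: lee_wpmul2l => //; rewrite lee_fin invr_ge0 exprn_ge0.
Qed.

(** The [Num.sqrt k] that relates [rho] to the coordinates produces exactly the normalisation
    [n / 2 * ln k] of free entropy. *)
Lemma ln_ball_volume k (t c : R) : (0 < k)%N -> 0 < t -> 0 < c ->
  (k%:R ^+ 2)^-1 * ln (((8 * (t * c / Num.sqrt k%:R)) ^+ d k)^-1)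
    = n%:R / 2 * ln k%:R - (n%:R * ln t + n%:R * ln (8 * c)).
Proof.
move=> k0 t0 c0; have sk0 : 0 < Num.sqrt k%:R :> R by rewrite sqrtr_gt0 ltr0n.
have -> : 8 * (t * c / Num.sqrt k%:R) = t * (8 * c) / Num.sqrt k%:R by ring.
have tc0 : 0 < t * (8 * c) by rewrite !mulr_gt0.
have q0 : 0 < t * (8 * c) / Num.sqrt k%:R by rewrite divr_gt0.
rewrite lnV ?posrE ?exprn_gt0// lnXn// -[ln _ *+ _]mulr_natl mulrN (mulrA (k%:R ^+ 2)^-1) inv_sqr_dim//.
by rewrite ln_div ?posrE// lnM ?posrE ?mulr_gt0// ln_sqrt_nat//; ring.
Qed.

Lemma chi_le_covering (t : R) : 0 < t -> t <= 1 ->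
  (chi_rel phi (ath t) h + (- (n%:R * ln t + n%:R * ln (8 * (1 + Ch))))%:E
     <= free_covering phi a t)%E.
Proof.
move=> t0 t1; apply: sup_inf_addr_le => r r0.
exists (2 * r) => [|m' g' g'0]; first by rewrite mulr_gt0.
have [m [g [g0 upper]]] := upper_volume MvN phi_state aM hM t0 t1 m' (ltW r0) g'0.
exists m, g; split => //; apply: limf_esup_addr_le.
exists 1%N => // k /= k0; rewrite /log_vol.
set X := Gamma phi a (2 * r) m' k g'; set V := vol _; set K := covering_number _ _ _.
have sk0 : 0 < Num.sqrt k%:R :> R by rewrite sqrtr_gt0 ltr0n.
have C1 : 0 < 1 + Ch by rewrite ltr_wpDr ?sqrtr_ge0.
pose c := (8 * (t * (1 + Ch) / Num.sqrt k%:R)) ^+ d k.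
have c0 : 0 < c by rewrite exprn_gt0// mulr_gt0// divr_gt0// mulr_gt0.
have VK : (V * c^-1%:E <= K)%E.
  apply: le_ereal_inf_tmp => _ [N [z [zX cov]] <-].
  by rewrite muleC lee_pdivrMl// -EFinM mulrC; exact: upper k k0 N z zX cov.
have ci : 0 < c^-1 by rewrite invr_gt0.
have := lne_scale k (lne_addr_le (vol_ge0 _) (covering_number_ge0 _ _ _) ci VK).
by rewrite -addeA -EFinD /c ln_ball_volume.
Qed.

Lemma expR_le_vol k (A : set (mxtuple (R := R) n k)) (c : R) : (0 < k)%N ->
  (c%:E < log_vol A)%E -> ((expR (k%:R ^+ 2 * (c - n%:R / 2 * ln k%:R)))%:E <= vol A)%E.
Proof.
move=> k0; have kk : 0 < k%:R ^+ 2 :> R by rewrite exprn_gt0// ltr0n.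
rewrite /log_vol -lteBlDr// -EFinB muleC lte_pdivlMr// -EFinM mulrC => /ltW.
case: (vol A) (vol_ge0 A) => [v||] //; [|by move=> _ _; rewrite leey].
rewrite lee_fin => v0; have [->|vn] := eqVneq v 0; first by move=> /=; rewrite ?eqxx ?ltxx ?lexx leeNy_eq.
have vp : 0 < v by rewrite lt_neqAle eq_sym vn.
by rewrite lne_EFin// !lee_fin -[X in _ -> (_ <= X)]lnK ?posrE// ler_expR.
Qed.

(** The length of the list of rotations is invisible at the scale [k ^ 2]. The threshold comes from
    [ln x < x]: [c + 1 + 4 * k <= k ^ 2] once [k >= c + 6]. *)
Lemma ln_poly_le (c k : nat) : (c + 6 <= k)%N -> ln ((c.+1 * k ^ 4)%:R : R) <= k%:R ^+ 2.
Proof.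
move=> ck; have k0 : (0 < k)%N by lia.
have kR : c%:R + 6 <= k%:R :> R by rewrite -[6]/(6%:R) -natrD ler_nat.
have c0 : 0 <= c%:R :> R by [].
have k1 : 0 < k%:R :> R by rewrite ltr0n.
rewrite natrM natrX lnM ?posrE ?exprn_gt0 ?ltr0n// lnXn//.
have lnk := ln_sublinear k1; have lnc : ln (c.+1%:R : R) < c.+1%:R by apply: ln_sublinear; rewrite ltr0n.
rewrite -[ln _ *+ 4]mulr_natl; rewrite -natr1 in lnc *.
by rewrite expr2; nra.
Qed.


Hypothesis h_free : free_sets phi (range h) (range a).
Hypothesis h_chi : (-oo < chi_inf phi h)%E.

(** One cut-off and one level serve all [m] and [g], and the bound holds for all large [k], hence
    along whatever subsequence realises the packing numbers of [a]. *)
Lemma eventually_log_vol_gt : exists (r0 c0 : R), 0 < r0 /\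
  forall m (g : R), 0 < g -> \forall k \near \oo, (c0%:E < log_vol (Gamma phi h r0 m k g))%E.
Proof.
have [v [w [_ vw /ereal_sup_gt[_ [r0 r00 <-] wr]]]] := lte_between2 h_chi.
exists r0, w; split => // m g g0; apply: limn_einf_gt; apply: (lt_le_trans wr).
by apply: ereal_inf_lbound; exists m => //; exists g.
Qed.

Lemma packing_le_chi : exists c : R, forall t, 0 < t -> t <= 1 ->
  (free_packing phi a ((2 * Ch + 1) * t) + (c + n%:R * ln t)%:E <= chi_rel phi (ath t) h)%E.
Proof.
have [r0 [c0 [r00 vol_large]]] := eventually_log_vol_gt.
(* The level of the microstates of [h], less 1 for the list of rotations and [n * ln 8] for the
   volume lost by conjugating. None of these depends on [t] or [r]. *)
exists (c0 - 1 - n%:R * ln 8) => t t0 t1; apply: sup_inf_addr_le => r rpos.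
pose r1 := Num.max 1 (Num.max r r0).
have r1r : r <= r1 by rewrite /r1 !le_max lexx !orbT.
have r1r0 : r0 <= r1 by rewrite /r1 !le_max lexx !orbT.
have r11 : 1 <= r1 by rewrite /r1 !le_max lexx.
exists (2 * r1) => [|m g g0]; first by rewrite mulr_gt0// (lt_le_trans ltr01).
have [m' [c [k1 [g' [g'0 lower]]]]] :=
  lower_volume MvN phi_state aM hM t0 t1 h_free m (ltW rpos) r1r r11 g0.
exists m', g'; split => //; apply: limf_esup_addr_le.
near=> k.
have k0 : (0 < k)%N by near: k; exists 1%N.
have k1k : (k1 <= k)%N by near: k; exists k1.
have ck : (c + 6 <= k)%N by near: k; exists (c + 6)%N.
have volk : (c0%:E < log_vol (Gamma phi h r0 m' k g'))%E by near: k; exact: vol_large.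
have kk : 0 < k%:R ^+ 2 :> R by rewrite exprn_gt0// ltr0n.
have {}volk := expR_le_vol k0 volk.
have subk : Gamma phi h r0 m' k g' `<=` Gamma phi h r1 m' k g'.
  by apply: Gamma_sub => //; exact: ltW.
have {}volk := le_trans volk (le_vol (fun x _ => subk x)).
rewrite /log_vol /=; set P := packing_number _ _ _; set V := vol (Gamma_rel _ _ _ _ _ _ _).
set E := expR _ in volk.
have E0 : 0 < E by exact: expR_gt0.
(* The successor of [c] makes [D] positive, so that its logarithm can be taken. *)
pose D := (c.+1 * k ^ 4)%:R * 8 ^+ d k * t^-1 ^+ d k : R.
have D0 : 0 < D by rewrite /D !mulr_gt0 ?exprn_gt0 ?invr_gt0// ltr0n muln_gt0 expn_gt0 k0.
have V0 : (0 <= V)%E by exact: vol_ge0.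
have PV : (P * (E / D)%:E <= V)%E.
  rewrite EFinM muleA lee_pdivrMr// -lee_pdivlMr//.
  apply: ge_ereal_sup => _ [N [x [xG disj]] <-].
  rewrite lee_pdivlMr//.
  apply: (@le_trans _ _ ((N%:R)%:E * vol (Gamma phi h r1 m' k g'))%E).
    by apply: lee_wpmul2l => //; rewrite lee_fin.
  apply: (le_trans (lower k k0 k1k N x xG disj)).
  rewrite [leRHS]muleC; apply: lee_wpmul2r => //; rewrite lee_fin /D.
  by rewrite !ler_pM2r ?exprn_gt0 ?invr_gt0// ler_nat leq_mul2r leqnSn orbT.
have ED : 0 < E / D by rewrite divr_gt0.
have := lne_scale k (lne_addr_le (packing_number_ge0 _ _ _) V0 ED PV).
move=> /(leeD2r (n%:R / 2 * ln k%:R)%:E); apply: le_trans.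
rewrite -addeA -EFinD; apply: leeD2l; rewrite lee_fin.
have tn : 0 < t^-1 by rewrite invr_gt0.
have lnE : ln (E / D) = k%:R ^+ 2 * (c0 - n%:R / 2 * ln k%:R)
    - (ln ((c.+1 * k ^ 4)%:R : R) + (d k)%:R * ln 8 - (d k)%:R * ln t).
  have K0 : 0 < (c.+1 * k ^ 4)%:R :> R by rewrite ltr0n muln_gt0 expn_gt0 k0.
  rewrite ln_div ?posrE// expRK /D !lnM ?posrE ?mulr_gt0 ?exprn_gt0//.
  by rewrite !lnXn// lnV ?posrE// -[ln 8 *+ _]mulr_natl -[(- ln t) *+ _]mulr_natl mulrN.
have poly : (k%:R ^+ 2)^-1 * ln ((c.+1 * k ^ 4)%:R : R) <= 1.
  by rewrite mulrC ler_pdivrMr// mul1r ln_poly_le.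
rewrite lnE mulrBr mulrA mulVf ?gt_eqF// mul1r mulrBr mulrDr !(mulrA (k%:R ^+ 2)^-1).
by rewrite inv_sqr_dim//; lra.
Unshelve. all: by end_near.
Qed.

Lemma packing_le_free_covering e : (free_packing phi a e <= free_covering phi a e)%E.
Proof.
rewrite -[leLHS]adde0; apply: sup_inf_addr_le => r r0; exists r => // m g g0.
exists m, g; split => //; apply: limf_esup_addr_le; exists 0%N => // k _ /=.
rewrite adde0; apply: lee_wpmul2l; first by rewrite lee_fin invr_ge0 exprn_ge0.
rewrite lee_lne ?in_itv/= ?leey ?packing_number_ge0 ?covering_number_ge0//.
by apply: packing_le_covering => x y; exact: rhoC.
Qed.

Lemma free_covering_le_packing e : 0 < e ->
  (free_covering phi a (2 * e) <= free_packing phi a e)%E.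
Proof.
move=> e0; rewrite -[leLHS]adde0; apply: sup_inf_addr_le => r r0; exists r => // m g g0.
exists m, g; split => //; apply: limf_esup_addr_le; exists 1%N => // k /= k0.
rewrite adde0; apply: lee_wpmul2l; first by rewrite lee_fin invr_ge0 exprn_ge0.
rewrite lee_lne ?in_itv/= ?leey ?packing_number_ge0 ?covering_number_ge0//.
apply: (covering_le_packing _ _ e0) => [x y|x y z [hx _ _] [hy _ _] [hz _ _]].
  exact: rhoC.
exact: (rho_triangle k0 hx hy hz).
Qed.

Lemma trivial_or_ge0_free_covering e : trivial_or_ge0 (free_covering phi a e).
Proof.
apply: trivial_or_ge0_sup_inf => r m g; apply: trivial_or_ge0_limn_esup => k.
apply: trivial_or_ge0_mul; first by rewrite invr_ge0 exprn_ge0.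
exact: trivial_or_ge0_lne_covering.
Qed.


(** After division by [|ln t|] the term [b * ln t] becomes [- b] and the constant [c] tends to 0. *)
Lemma limsup_log_ratio_addr_le (F G : R -> \bar R) (b c : R) :
  (forall t, 0 < t -> t <= 1 -> (F t + (c + b * ln t)%:E <= G t)%E) ->
  (limsup_log_ratio F - b%:E <= limsup_log_ratio G)%E.
Proof.
move=> FG; apply/lee_addgt0Pr => e e0; rewrite -leeBlDr// -addeA -EFinN -EFinD.
apply: limf_esup_addr_le; near=> t.
have [t0 t1 ct] : [/\ 0 < t, t < 1 & `|c| / e < `|ln t|] by near: t; exact: near_ln_gt.
have lt0 : 0 < `|ln t| by apply: le_lt_trans ct; rewrite divr_ge0// ltW.
have iL : 0 < `|ln t|^-1 by rewrite invr_gt0.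
have lnt : ln t * `|ln t|^-1 = - 1.
  have ln0 : ln t < 0 by rewrite ln_lt0// t0.
  by rewrite ltr0_norm// invrN mulrN divff// lt_eqF.
have ce : - e <= c * `|ln t|^-1.
  have : `|c| * `|ln t|^-1 < e by rewrite ltr_pdivrMr// mulrC -ltr_pdivrMr.
  have := ler_norm (- (c * `|ln t|^-1)); rewrite normrN normrM (gtr0_norm iL); lra.
apply: (@le_trans _ _ ((F t + (c + b * ln t)%:E) * (`|ln t|^-1)%:E)%E); last first.
  by apply: lee_wpmul2r; [rewrite lee_fin ltW|exact: FG (ltW t1)].
rewrite muleDl//; last by rewrite fin_num_adde_defl.
apply: leeD2l; rewrite -EFinM lee_fin mulrDl -mulrA lnt mulrN1.
by rewrite addrC lerD2r.
Unshelve. all: by end_near.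
Qed.

End Main.

Theorem lemma2p2 (R : realType) (H : completeNormedModType R[i])
    (ip : {dot H for Num.conj}) (ip_norm : induces_norm ip)
    (M : set (H -> H)) (M_vN : von_neumann_algebra ip M)
    (phi : (H -> H) -> R[i]) (phi_state : normal_tracial_state ip M phi)
    (n : nat) (a h : 'I_n -> H -> H)
    (aM : forall i, M (a i)) (a_sa : forall i, self_adjoint ip (a i))
    (hM : forall i, M (h i)) (h_sa : forall i, self_adjoint ip (h i))
    (h_free : free_sets phi (range h) (range a))
    (h_chi : (-oo < chi_inf phi h)%E) :
  (n%:R%:E + limsup_log_ratio
     (fun e : R => chi_rel phi (fun i => a i + (e%:C)%C *: h i)%R h))%E
     = limsup_log_ratio (free_covering phi a) /\
  limsup_log_ratio (free_covering phi a)
     = limsup_log_ratio (free_packing phi a).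
Proof.
set chi_t := fun e : R => _.
set K := free_covering phi a; set P := free_packing phi a.
(* The packing radius of the lower bound, in units of [t]. *)
pose c := 2 * Num.sqrt (size_bound phi h) + 1.
have c1 : 1 <= c by rewrite /c lerDr mulr_ge0// sqrtr_ge0.
have upper : (n%:R%:E + limsup_log_ratio chi_t <= limsup_log_ratio K)%E.
  rewrite addeC -[n%:R]opprK EFinN; apply: (@limsup_log_ratio_addr_le _ _ _ (- n%:R)
    (- (n%:R * ln (8 * (1 + Num.sqrt (size_bound phi h)))))) => t t0 t1.
  have := chi_le_covering M_vN phi_state aM hM t0 t1.
  apply: le_trans; apply: leeD2l; rewrite lee_fin; lra.
have lower : (limsup_log_ratio (fun t => P (c * t)%R) - n%:R%:E <= limsup_log_ratio chi_t)%E.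
  have [b bP] := packing_le_chi M_vN phi_state aM hM h_free h_chi.
  exact: limsup_log_ratio_addr_le bP.
have limsup_mono (F G : R -> \bar R) : (forall t, (0 < t)%R -> (F t <= G t)%E) ->
    (limsup_log_ratio F <= limsup_log_ratio G)%E.
  move=> FG; have := @limsup_log_ratio_addr_le _ F G 0 0; rewrite oppe0 adde0; apply => t t0 _.
  by rewrite mul0r addr0 adde0; exact: FG.
have K0 e : trivial_or_ge0 (K e) := trivial_or_ge0_free_covering phi a e.
have PK : (limsup_log_ratio P <= limsup_log_ratio K)%E.
  by apply: limsup_mono => t _; exact: packing_le_free_covering.
have KP : (limsup_log_ratio K <= limsup_log_ratio P)%E.
  apply: (le_trans (limsup_log_ratio_rescale (ler1n _ 2) K0)).
  by apply: limsup_mono => t t0; exact: free_covering_le_packing.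
(* This closes the circle: covering at [2 * c * t] is below packing at [c * t], which the lower
   bound compares with the entropy at [t]. *)
have KPc : (limsup_log_ratio K <= limsup_log_ratio (fun t => P (c * t)%R))%E.
  have c2 : 1 <= 2 * c by lra.
  apply: (le_trans (limsup_log_ratio_rescale c2 K0)).
  apply: limsup_mono => t t0; rewrite -mulrA; apply: free_covering_le_packing.
  by rewrite mulr_gt0// (lt_le_trans ltr01).
split; apply/eqP; rewrite eq_le.
  apply/andP; split; [exact: upper | rewrite (addeC n%:R%:E) -leeBlDr; last by []].
  by apply: (le_trans _ lower); exact: leeD2r.
by apply/andP; split; [exact: KP | exact: PK].
Qed.
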